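(* Let $\mathcal A$ be a CQG algebra, let $J\subset\mathcal A^*$ be a two-sided coideal satisfying $J^*=J$ and $S(J)=J^-$, and assume that $(\mathcal A,J)$ is a generalized quantum Gelfand pair. Let $K:=(\mathcal A,J)\,\widehat{\;}$, endowed with the discrete topology. For $\alpha,\beta\in K$ define the convolution by $$(p_\alpha*p_\beta)(\gamma):=c_{\alpha\beta}(\gamma),\qquad\gamma\in K,$$ where the $c_{\alpha\beta}(\gamma)$ are the coefficients in the linearization formula $t_{11}^\alpha t_{11}^\beta=\sum_{\gamma\in K}c_{\alpha\beta}(\gamma)\,t_{11}^\gamma$. Take $\alpha\mapsto\overline\alpha$ (where $\overline\alpha$ is the class of $((t_{ij}^\alpha)^-)$) as involution on $K$, and let $e\in K$ be the class of the trivial corepresentation of $\mathcal A$. Then the quadruple $(K,*,{}^-,e)$ forms a DJS-hypergroup.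
   Context: All algebras are complex, associative and unital. A Hopf $*$-algebra is a Hopf algebra $\mathcal A$ (comultiplication $\Delta$, counit $\varepsilon$, antipode $S$) with an involutive antilinear antimultiplicative map $a\mapsto a^*$ such that $\Delta$ and $\varepsilon$ are $*$-homomorphisms (with $(a\otimes b)^*=a^*\otimes b^*$). The algebraic linear dual $\mathcal A^*$ is a unital $*$-algebra with unit $\varepsilon$, product $(fg)(a):=(f\otimes g)(\Delta(a))$ and involution $f^*(a):=\overline{f((S(a))^* )}$; moreover $(S(f))(a):=f(S(a))$, and $\Delta(f)\in(\mathcal A\otimes\mathcal A)^*$ is given by $\Delta(f)(a\otimes b):=f(ab)$ ($\mathcal A^*\otimes\mathcal A^*$ is regarded as a subspace of $(\mathcal A\otimes\mathcal A)^*$). For $f\in\mathcal A^*$, $a\in\mathcal A$ put $f.a:=(\mathrm{id}\otimes f)(\Delta(a))$ and $a.f:=(f\otimes\mathrm{id})(\Delta(a))$; these left and right actions commute. A matrix corepresentation of $\mathcal A$ is a square matrix $t=(t_{ij})$ over $\mathcal A$ with $\Delta(t_{ij})=\sum_k t_{ik}\otimes t_{kj}$ and $\varepsilon(t_{ij})=\delta_{ij}$; it is unitary if $S(t_{ij})=(t_{ji})^*$. Matrix corepresentations $s,t$ of the same dimension are equivalent if $Bs=tB$ for some invertible complex matrix $B$; $t$ is irreducible if it is not equivalent to one of block form $\left(\begin{smallmatrix}*&*\\0&*\end{smallmatrix}\right)$ with nontrivial blocks. A CQG algebra is a Hopf $*$-algebra that is the linear span of the matrix elements of its unitary matrix corepresentations.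 Let $\mathcal A$ be a CQG algebra. $\widehat{\mathcal A}$ denotes the set of equivalence classes of irreducible unitary matrix corepresentations; for each $\alpha\in\widehat{\mathcal A}$ a unitary representative $t^\alpha=(t_{ij}^\alpha)_{i,j=1,\dots,d_\alpha}$ is chosen; all $t_{ij}^\alpha$ together form a basis of $\mathcal A$. $e\in\widehat{\mathcal A}$ is the class of the trivial one-dimensional corepresentation $(1)$. The matrix $t''$ with entries $S^2(t_{ij}^\alpha)$ is equivalent to $t^\alpha$, and $F_\alpha$ denotes the unique invertible complex matrix with $F_\alpha t^\alpha=t''F_\alpha$ and $\operatorname{tr}F_\alpha=\operatorname{tr}F_\alpha^{-1}>0$; it is positive definite. For $z\in\mathbb C$, $f_z\in\mathcal A^*$ is defined by $f_z(t_{ij}^\alpha):=(F_\alpha^z)_{ij}$. A second involution on $\mathcal A$ is defined by $a^-:=f_{1/2}.a^*.f_{-1/2}$, and correspondingly on $\mathcal A^*$ by $f^-(a):=\overline{f((S(a))^-)}$ (equivalently $f^-=f_{1/2}f^*f_{-1/2}$). For $\alpha\in\widehat{\mathcal A}$, the matrix $((t_{ij}^\alpha)^-)$ is an irreducible unitary matrix corepresentation of $\mathcal A$, and $\overline\alpha\in\widehat{\mathcal A}$ denotes its class. A two-sided coideal of $\mathcal A^*$ is a linear subspace $J\subset\mathcal A^*$ with $\Delta(J)\subset J\otimes\mathcal A^*+\mathcal A^*\otimes J$ and $f(1)=0$ for all $f\in J$. Write $J^*=\{f^*:f\in J\}$, $J^-=\{f^-:f\in J\}$, $S(J)=\{S(f):f\in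 J\}$. An element $a\in\mathcal A$ is $J$-biinvariant if $f.a=0=a.f$ for all $f\in J$. For $\alpha\in\widehat{\mathcal A}$, $\pi^\alpha$ is the $*$-representation $f\mapsto(f(t_{ij}^\alpha))_{i,j}$ of $\mathcal A^*$ on $\mathcal H^\alpha=\mathbb C^{d_\alpha}$, with standard basis $e_1,\dots,e_{d_\alpha}$; $v\in\mathcal H^\alpha$ is $J$-invariant if $\pi^\alpha(f)v=0$ for all $f\in J$. $(\mathcal A,J)$, with $J$ a two-sided coideal such that $J=J^*$, is a generalized quantum Gelfand pair if for each $\alpha\in\widehat{\mathcal A}$ the $J$-invariant elements of $\mathcal H^\alpha$ form a subspace of dimension 0 or 1; $(\mathcal A,J)\,\widehat{\;}$ is the set of $\alpha$ for which this dimension is 1. For $\alpha\in(\mathcal A,J)\,\widehat{\;}$ the representative $t^\alpha$ is chosen such that $e_1$ is $J$-invariant. The elements $t_{11}^\alpha$, $\alpha\in(\mathcal A,J)\,\widehat{\;}$, form a basis of the algebra of $J$-biinvariant elements of $\mathcal A$, so that for $\alpha,\beta\in(\mathcal A,J)\,\widehat{\;}$ there is a unique expansion $t_{11}^\alpha t_{11}^\beta=\sum_{\gamma}c_{\alpha\beta}(\gamma)\,t_{11}^\gamma$ over $\gamma\in(\mathcal A,J)\,\widehat{\;}$, with finitely many nonzero terms. DJS-hypergroup: let $K$ be a locally compact Hausdorff space, $M(K)$ the complex regular Borel measures on $K$, $M^1(K)$ the probability measures among them, $p_x$ the point measure at $x$. Data: a continuous map $(x,y)\mapsto p_x*p_y:K\times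 K\to M^1(K)$ (convolution), where $M^1(K)$ carries the weak topology with respect to $C_c(K)$, extended to a bilinear map $M(K)\times M(K)\to M(K)$ by $\mu*\nu=\int\!\int p_x*p_y\,d\mu(x)\,d\nu(y)$; an involutive homeomorphism $x\mapsto\overline x$ of $K$ (involution), with $\mu^-$ denoting the image of a probability measure $\mu$ under the involution; and an element $e\in K$ (unit). $(K,*,{}^-,e)$ is a DJS-hypergroup if: (H1) $p_x*(p_y*p_z)=(p_x*p_y)*p_z$ for all $x,y,z$; (H2) $\mathrm{supp}(p_x*p_y)$ is compact for all $x,y$; (H3) $(p_x*p_y)^-=p_{\overline y}*p_{\overline x}$ for all $x,y$; (H4) $p_e*p_x=p_x=p_x*p_e$ for all $x$; (H5) $e\in\mathrm{supp}(p_x*p_{\overline y})$ if and only if $x=y$; (H6) $(x,y)\mapsto\mathrm{supp}(p_x*p_y)$ is continuous from $K\times K$ to the space of nonvoid compact subsets of $K$ with the topology generated by the sets $\{A: A\cap U\neq\emptyset,\ A\subset V\}$, $U,V\subset K$ open. *)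

(* Defs.v *)
From HB Require Import structures.
From mathcomp Require Import all_boot all_order all_algebra generic_quotient.
From mathcomp Require Import spectral.
From mathcomp Require Import all_classical all_reals all_analysis.
From mathcomp.real_closed Require Import complex.

Set Implicit Arguments.
Unset Strict Implicit.
Unset Printing Implicit Defensive.

Import Order.TTheory GRing.Theory Num.Theory numFieldNormedType.Exports.
Local Open Scope classical_set_scope.
Local Open Scope quotient_scope.
Local Open Scope complex_scope.
Local Open Scope ring_scope.

(** [tensor U V] is the quotient of the formal sums of pairs [(u, v)], encoded as
  sequences, by the relations that hold under every balanced biadditive map. *)

Section Tensor.
Variables (k : comNzRingType) (U V : lmodType k).

Definition balanced (W : zmodType) (phi : U -> V -> W) : Prop :=
  [/\ forall v, {morph phi^~ v : u u' / u + u'},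
      forall u, {morph phi u : v v' / v + v'} &
      forall c u v, phi (c *: u) v = phi u (c *: v)].

Definition fsum_eval (W : zmodType) (phi : U -> V -> W) (s : seq (U * V)) : W :=
  \sum_(p <- s) phi p.1 p.2.

Definition fsum_eq (s t : seq (U * V)) : Prop :=
  forall (W : zmodType) (phi : U -> V -> W),
    balanced phi -> fsum_eval phi s = fsum_eval phi t.

Definition fsum_eqb (s t : seq (U * V)) : bool := `[< fsum_eq s t >].

Lemma fsum_eqb_refl : reflexive fsum_eqb.
Proof. by move=> s; apply/asboolP. Qed.

Lemma fsum_eqb_sym : symmetric fsum_eqb.
Proof.
by move=> s t; apply/idP/idP => /asboolP h; apply/asboolP => W phi b;
   rewrite (h W phi b).
Qed.

Lemma fsum_eqb_trans : transitive fsum_eqb.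
Proof.
by move=> t s r /asboolP h1 /asboolP h2; apply/asboolP => W phi b;
   rewrite (h1 W phi b) (h2 W phi b).
Qed.

Definition fsum_equiv : equiv_rel (seq (U * V)) :=
  EquivRel fsum_eqb fsum_eqb_refl fsum_eqb_sym fsum_eqb_trans.

Definition tensor : Type := {eq_quot fsum_equiv}.
HB.instance Definition _ := Choice.copy tensor {eq_quot fsum_equiv}.

Definition tclass (s : seq (U * V)) : tensor := \pi_({eq_quot fsum_equiv}) s.
Definition trepr (t : tensor) : seq (U * V) := repr (t : {eq_quot fsum_equiv}).
Definition pure (u : U) (v : V) : tensor := tclass [:: (u, v)].

Definition tlift (W : zmodType) (phi : U -> V -> W) (t : tensor) : W :=
  fsum_eval phi (trepr t).

Lemma treprK t : tclass (trepr t) = t.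
Proof. exact: reprK. Qed.

Lemma tclassP s t : tclass s = tclass t <-> fsum_eq s t.
Proof.
split=> [/(@eqmodP _ fsum_equiv) /asboolP //|h].
by apply/(@eqmodP _ fsum_equiv)/asboolP.
Qed.

Lemma tlift_class (W : zmodType) (phi : U -> V -> W) s :
  balanced phi -> tlift phi (tclass s) = fsum_eval phi s.
Proof.
move=> b; have /tclassP h : tclass (trepr (tclass s)) = tclass s by rewrite treprK.
exact: h.
Qed.

Lemma trepr_eval (W : zmodType) (phi : U -> V -> W) s :
  balanced phi -> fsum_eval phi (trepr (tclass s)) = fsum_eval phi s.
Proof. exact: tlift_class. Qed.

Lemma tlift_pure (W : zmodType) (phi : U -> V -> W) u v :
  balanced phi -> tlift phi (pure u v) = phi u v.
Proof. by move=> b; rewrite tlift_class// /fsum_eval big_seq1. Qed.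

Definition fsum_scale (c : k) (s : seq (U * V)) : seq (U * V) :=
  [seq (c *: p.1, p.2) | p <- s].

Definition tzero : tensor := tclass [::].
Definition tadd (s t : tensor) : tensor := tclass (trepr s ++ trepr t).
Definition tscale (c : k) (t : tensor) : tensor := tclass (fsum_scale c (trepr t)).
Definition topp : tensor -> tensor := tscale (-1).

Lemma fsum_eval_cat (W : zmodType) (phi : U -> V -> W) s t :
  fsum_eval phi (s ++ t) = fsum_eval phi s + fsum_eval phi t.
Proof. by rewrite /fsum_eval big_cat. Qed.

Lemma balanced_scale (W : zmodType) (phi : U -> V -> W) c :
  balanced phi -> balanced (fun u v => phi (c *: u) v).
Proof.
case=> h1 h2 h3; split=> [v u u'|u v v'|d u v]; first by rewrite scalerDr h1.
- by rewrite h2.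
- by rewrite scalerA mulrC -scalerA h3.
Qed.

Lemma fsum_eval_scale (W : zmodType) (phi : U -> V -> W) c s :
  fsum_eval phi (fsum_scale c s) = fsum_eval (fun u v => phi (c *: u) v) s.
Proof. by rewrite /fsum_eval /fsum_scale big_map. Qed.

Lemma tadd_class s t : tadd (tclass s) (tclass t) = tclass (s ++ t).
Proof.
apply/tclassP => W phi b; rewrite !fsum_eval_cat.
by rewrite !trepr_eval.
Qed.

Lemma tscale_class c s : tscale c (tclass s) = tclass (fsum_scale c s).
Proof.
apply/tclassP => W phi b; rewrite !fsum_eval_scale.
by rewrite trepr_eval//; exact: balanced_scale.
Qed.

Lemma taddA : associative tadd.
Proof.
by move=> a b c; rewrite -(treprK a) -(treprK b) -(treprK c) !tadd_class catA.
Qed.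

Lemma taddC : commutative tadd.
Proof.
move=> a b; rewrite -(treprK a) -(treprK b) !tadd_class.
by apply/tclassP => W phi _; rewrite !fsum_eval_cat addrC.
Qed.

Lemma tadd0 : left_id tzero tadd.
Proof. by move=> a; rewrite -(treprK a) tadd_class. Qed.

Lemma tscale_cat c s t : fsum_scale c (s ++ t) = fsum_scale c s ++ fsum_scale c t.
Proof. exact: map_cat. Qed.

Lemma balanced0l (W : zmodType) (phi : U -> V -> W) v : balanced phi -> phi 0 v = 0.
Proof. by case=> h _ _; apply: (@addrI _ (phi 0 v)); rewrite -h !addr0. Qed.

Lemma taddN : left_inverse tzero topp tadd.
Proof.
move=> a; rewrite -(treprK a) /topp tscale_class tadd_class.
apply/tclassP => W phi b; rewrite fsum_eval_cat fsum_eval_scale -big_split/=.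
rewrite [RHS]big_nil; apply: big1 => p _.
by case: (b) => <- _ _; rewrite scaleN1r addNr balanced0l.
Qed.

HB.instance Definition _ := GRing.isZmodule.Build tensor taddA taddC tadd0 taddN.

Lemma tclass_cat s t : tclass (s ++ t) = tclass s + tclass t.
Proof. by rewrite -[RHS]/(tadd _ _) tadd_class. Qed.

Lemma tscaleA a b v : tscale a (tscale b v) = tscale (a * b) v.
Proof.
rewrite -(treprK v) !tscale_class /fsum_scale -map_comp.
by congr tclass; apply: eq_map => p /=; rewrite scalerA.
Qed.

Lemma tscale1 : left_id 1 tscale.
Proof.
move=> v; rewrite -(treprK v) tscale_class; congr tclass.
by rewrite -[RHS]map_id; apply: eq_map => -[x y] /=; rewrite scale1r.
Qed.

Lemma tscaleDr : right_distributive tscale +%R.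
Proof.
move=> c s t; rewrite -(treprK s) -(treprK t) -tclass_cat !tscale_class.
by rewrite tscale_cat tclass_cat.
Qed.

Lemma tscaleDl v : {morph tscale^~ v : a b / a + b}.
Proof.
move=> a b; rewrite -(treprK v) !tscale_class -tclass_cat.
apply/tclassP => W phi h; rewrite fsum_eval_cat !fsum_eval_scale -big_split/=.
by apply: eq_bigr => p _; case: h => <- _ _; rewrite scalerDl.
Qed.

HB.instance Definition _ :=
  GRing.Zmodule_isLmodule.Build k tensor tscaleA tscale1 tscaleDr tscaleDl.

Lemma tensor_pureE t : t = \sum_(p <- trepr t) pure p.1 p.2.
Proof.
rewrite -[LHS]treprK; elim: (trepr t) => [|p s IH]; first by rewrite big_nil.
by rewrite big_cons -IH -tclass_cat; case: p.
Qed.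

Lemma pure_balanced : balanced pure.
Proof.
split=> [v u u'|u v v'|c u v].
- rewrite -tclass_cat; apply/tclassP => W phi [h _ _].
  by rewrite fsum_eval_cat /fsum_eval !big_seq1 h.
- rewrite -tclass_cat; apply/tclassP => W phi [_ h _].
  by rewrite fsum_eval_cat /fsum_eval !big_seq1 h.
- by apply/tclassP => W phi [_ _ h]; rewrite /fsum_eval !big_seq1 h.
Qed.

Lemma pureZ c u v : pure (c *: u) v = c *: pure u v.
Proof. by rewrite -[RHS]/(tscale _ _) tscale_class. Qed.

Lemma tliftD (W : zmodType) (phi : U -> V -> W) :
  balanced phi -> {morph tlift phi : s t / s + t}.
Proof.
move=> b s t; rewrite -(treprK s) -(treprK t) -tclass_cat !tlift_class//.
exact: fsum_eval_cat.
Qed.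

End Tensor.

Notation "A ⊗ B" := (tensor A%type B%type) (at level 40, left associativity) : type_scope.
Notation "a ⊗ b" := (pure a b) (at level 40, left associativity) : ring_scope.

Definition tmap (k : comNzRingType) (U V U' V' : lmodType k)
    (f : U -> U') (g : V -> V') : U ⊗ V -> U' ⊗ V' :=
  tlift (fun u v => f u ⊗ g v).

Definition tassoc (k : comNzRingType) (U V W : lmodType k) :
    (U ⊗ V) ⊗ W -> U ⊗ (V ⊗ W) :=
  tlift (fun s w => tlift (fun u v => u ⊗ (v ⊗ w)) s).

Definition tmul (k : comNzRingType) (A B : algType k) (s t : A ⊗ B) : A ⊗ B :=
  tlift (fun a b => tlift (fun a' b' => (a * a') ⊗ (b * b')) t) s.

Record hopf_star_alg (R : realType) := HopfStarAlg {
  hopf_carrier :> algType R[i];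
  coprod : {linear hopf_carrier -> (hopf_carrier ⊗ hopf_carrier)%type};
  counit : {scalar hopf_carrier};
  antipode : {linear hopf_carrier -> hopf_carrier};
  star : hopf_carrier -> hopf_carrier;
  coprodA : forall a, tassoc (tmap coprod idfun (coprod a)) =
                      tmap idfun coprod (coprod a);
  counitl : forall a, tlift (fun x y => counit x *: y) (coprod a) = a;
  counitr : forall a, tlift (fun x y => counit y *: x) (coprod a) = a;
  coprodM : forall a b, coprod (a * b) = tmul (coprod a) (coprod b);
  coprod1 : coprod 1 = 1 ⊗ 1;
  counitM : forall a b, counit (a * b) = counit a * counit b;
  counit1 : counit 1 = 1;
  antipodel : forall a,
    tlift (fun x y => antipode x * y) (coprod a) = (counit a)%:A;
  antipoder : forall a,
    tlift (fun x y => x * antipode y) (coprod a) = (counit a)%:A;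
  starK : involutive star;
  star_antilinear : forall (c : R[i]) a b,
    star (c *: a + b) = Num.conj c *: star a + star b;
  starM : forall a b, star (a * b) = star b * star a;
  coprod_star : forall a, coprod (star a) = tmap star star (coprod a);
  counit_star : forall a, counit (star a) = Num.conj (counit a)
}.

Section Corepresentations.
Variables (R : realType) (A : hopf_star_alg R).
Local Notation C := R[i].

Definition corep n (t : 'M[A]_n) : Prop :=
  forall i j, coprod A (t i j) = \sum_l t i l ⊗ t l j /\
              counit A (t i j) = (i == j)%:R.

Definition unitary_corep n (t : 'M[A]_n) : Prop :=
  forall i j, antipode A (t i j) = star (t j i).

Definition scal_mx m n (B : 'M[C]_(m, n)) : 'M[A]_(m, n) := map_mx (in_alg A) B.

(** Equivalence of corepresentations of possibly different sizes; the invertible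
  intertwiner forces [m = n]. *)
Definition corep_equiv m n (s : 'M[A]_m) (t : 'M[A]_n) : Prop :=
  exists (B : 'M[C]_(n, m)) (B' : 'M[C]_(m, n)),
    [/\ B *m B' = 1%:M, B' *m B = 1%:M & scal_mx B *m s = t *m scal_mx B].

Definition block_triangular n (t : 'M[A]_n) : Prop :=
  exists2 m, (0 < m < n)%N & forall i j : 'I_n, (j < m <= i)%N -> t i j = 0.

(** The empty matrix is not regarded as irreducible: see the sizes [n.+1] below. *)
Definition irreducible_corep n (t : 'M[A]_n) : Prop :=
  ~ exists2 s : 'M[A]_n, corep_equiv s t & block_triangular s.

Definition is_CQG : Prop := forall a : A, exists2 l : seq (C * A),
  forall p, p \in l -> exists n (t : 'M[A]_n) i j,
    [/\ corep t, unitary_corep t & p.2 = t i j] &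
  a = \sum_(p <- l) p.1 *: p.2.

Definition irr_unitary (x : {n & 'M[A]_n.+1}) : Prop :=
  [/\ corep (tagged x), unitary_corep (tagged x) & irreducible_corep (tagged x)].

Definition irr : Type := {x : {n & 'M[A]_n.+1} | `[< irr_unitary x >]}.
HB.instance Definition _ := Choice.on irr.

Definition irr_mx (x : irr) : 'M[A]_((tag (val x)).+1) := tagged (val x).

Definition irr_equivb (x y : irr) : bool := `[< corep_equiv (irr_mx x) (irr_mx y) >].

Lemma irr_equivb_refl : reflexive irr_equivb.
Proof.
move=> x; apply/asboolP; exists 1%:M, 1%:M; split; rewrite ?mulmx1//.
by rewrite /scal_mx map_mx1 mulmx1 mul1mx.
Qed.

Lemma corep_equiv_sym m n (s : 'M[A]_m) (t : 'M[A]_n) :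
  corep_equiv s t -> corep_equiv t s.
Proof.
case=> B [B' [BB' B'B e]]; exists B', B; split=> //.
have /(congr1 (fun M => scal_mx B' *m M *m scal_mx B')) := e.
rewrite !mulmxA -[scal_mx B' *m scal_mx B]map_mxM/= B'B map_mx1 mul1mx => ->.
by rewrite -!mulmxA -[scal_mx B *m scal_mx B']map_mxM/= BB' map_mx1 mulmx1.
Qed.

Lemma irr_equivb_sym : symmetric irr_equivb.
Proof. by move=> x y; apply/asboolP/asboolP; exact: corep_equiv_sym. Qed.

Lemma irr_equivb_trans : transitive irr_equivb.
Proof.
move=> y x z /asboolP[B [B' [BB' B'B e]]] /asboolP[D [D' [DD' D'D e']]].
apply/asboolP; exists (D *m B), (B' *m D'); split.
- by rewrite mulmxA -(mulmxA D) BB' mulmx1.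
- by rewrite mulmxA -(mulmxA B') D'D mulmx1.
- by rewrite /scal_mx map_mxM -/(scal_mx B) -/(scal_mx D) -mulmxA e !mulmxA e'.
Qed.

Definition irr_equiv : equiv_rel irr :=
  EquivRel irr_equivb irr_equivb_refl irr_equivb_sym irr_equivb_trans.

Definition hat : Type := {eq_quot irr_equiv}.
HB.instance Definition _ := Choice.copy hat {eq_quot irr_equiv}.
Definition irr_class (x : irr) : hat := \pi_({eq_quot irr_equiv}) x.

End Corepresentations.

Section PowersOfMatrices.
Variable R : realType.
Local Notation C := R[i].

(** [x ^ z = exp (z ln x)] for [x > 0] real and [z] complex *)
Definition cpow (x z : C) : C :=
  let l := ln (complex.Re x) in
  (expR (complex.Re z * l) * cos (complex.Im z * l)) +i*
  (expR (complex.Re z * l) * sin (complex.Im z * l)).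

(** meant for positive definite [F] *)
Definition mxpow n (F : 'M[C]_n) (z : C) : 'M[C]_n :=
  invmx (spectralmx F) *m diag_mx (map_mx (cpow^~ z) (spectral_diag F))
    *m spectralmx F.

End PowersOfMatrices.

Section Functionals.
Variables (R : realType) (A : hopf_star_alg R).
Local Notation C := R[i].
Implicit Types (f : A -> C) (a : A) (J : set (A -> C)).

Definition lin_dual : set (A -> C) := [set f | scalar f].

(** [lact f a] is f.a and [ract a f] is a.f *)
Definition lact f a : A := tlift (fun x y => f y *: x) (coprod A a).
Definition ract a f : A := tlift (fun x y => f x *: y) (coprod A a).

Definition dual_star f : A -> C := fun a => Num.conj (f (star (antipode A a))).
Definition dual_antipode f : A -> C := fun a => f (antipode A a).

(** In the last clause [f (a * b)] is the value of the functional Delta(f)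
  on [a ⊗ b]. *)
Definition two_sided_coideal J : Prop :=
  [/\ J `<=` lin_dual,
      J (fun=> 0),
      forall (c : C) f g, J f -> J g -> J (fun a => c * f a + g a),
      forall f, J f -> f 1 = 0 &
      forall f, J f -> exists2 l : seq ((A -> C) * (A -> C)),
        forall p, p \in l -> (J p.1 /\ lin_dual p.2) \/ (lin_dual p.1 /\ J p.2) &
        forall a b, f (a * b) = \sum_(p <- l) p.1 a * p.2 b].

(** [modular t] is the matrix F of the corepresentation [t] *)
Definition is_modular n (t : 'M[A]_n) (F : 'M[C]_n) : Prop :=
  [/\ F \in unitmx,
      scal_mx A F *m t =
        map_mx (fun a => antipode A (antipode A a)) t *m scal_mx A F,
      \tr F = \tr (invmx F) & 0 < \tr F].

Definition modular n (t : 'M[A]_n) : 'M[C]_n := xget 0 [set F | is_modular t F].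

Section Representatives.
Variable rep : hat A -> irr A.
Implicit Types (alpha beta : hat A).

Definition hdim alpha : nat := (tag (val (rep alpha))).+1.
Definition tmx alpha : 'M[A]_(hdim alpha) := irr_mx (rep alpha).
Definition t11 alpha : A := irr_mx (rep alpha) ord0 ord0.

Definition fpow (z : C) : A -> C := xget (fun=> 0) [set f | lin_dual f /\
  forall alpha i j, f (tmx alpha i j) = mxpow (modular (tmx alpha)) z i j].

Definition bar a : A := ract (lact (fpow 2^-1) (star a)) (fpow (- 2^-1)).
Definition dual_bar f : A -> C := fun a => Num.conj (f (bar (antipode A a))).

(** [alpha] is the class of the corepresentation [s] *)
Definition is_class_of n (s : 'M[A]_n) alpha : Prop := corep_equiv s (tmx alpha).

Definition dual_rep alpha f : 'M[C]_(hdim alpha) := map_mx f (tmx alpha).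

Definition J_invariant J alpha (v : 'cV[C]_(hdim alpha)) : Prop :=
  forall f, J f -> dual_rep alpha f *m v = 0.

Definition invariant_dim J alpha (n : nat) : Prop :=
  exists2 U : {vspace 'cV[C]_(hdim alpha)},
    forall v, v \in U <-> J_invariant J v & \dim U = n.

Definition gen_Gelfand_pair J : Prop :=
  [/\ two_sided_coideal J, dual_star @` J = J &
      forall alpha, invariant_dim J alpha 0 \/ invariant_dim J alpha 1].

Definition spherical J : set (hat A) := [set alpha | invariant_dim J alpha 1].

(** representatives [t^alpha] such that the first basis vector is invariant *)
Definition adapted J : Prop :=
  forall alpha, spherical J alpha ->
    @J_invariant J alpha (delta_mx (ord0 : 'I_(tag (val (rep alpha))).+1) ord0).

Definition is_linearization J (alpha beta : spherical J)
    (c : spherical J -> C) : Prop :=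
  finite_set [set gamma | c gamma != 0] /\
  t11 (val alpha) * t11 (val beta) =
    \sum_(gamma \in [set: spherical J]) c gamma *: t11 (val gamma).

Definition lin_coef J (alpha beta : spherical J) : spherical J -> C :=
  xget (fun=> 0) [set c | is_linearization alpha beta c].

End Representatives.
End Functionals.

(** [based e] is [K] pointed at [e], since [measurableType] requires a point. *)
Definition based (K : Type) (e : K) : Type := K.
HB.instance Definition _ (K : choiceType) (e : K) := Choice.on (based e).
HB.instance Definition _ (K : choiceType) (e : K) :=
  isPointed.Build (based e) e.

Section Hypergroups.
Variables (R : realType) (K : topologicalType) (e : K).

Definition borel := g_sigma_algebraType (@open K : set (set (based e))).
HB.instance Definition _ := Measurable.on borel.

Definition regular_measure (mu : set K -> \bar R) : Prop :=
  forall E : set K, measurable (E : set borel) ->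
    mu E = ereal_inf [set mu U | U in [set U : set K | open U /\ E `<=` U]] /\
    mu E = ereal_sup [set mu C | C in [set C : set K | compact C /\ C `<=` E]].

Record M1 := MkM1 {
  M1_prob :> probability borel R;
  M1_regular : regular_measure M1_prob }.

Definition Cc : set (K -> R) :=
  [set f | continuous f /\ compact (closure [set x | f x != 0])].

(** The topology of [M1] is initial for the integrals of the functions of [Cc];
  complex-valued test functions would give the same topology. *)
Definition M1_eval (mu : M1) : prod_topology (fun _ : Cc => R) :=
  fun f => \int[M1_prob mu]_(x in setT) (val f x).

HB.instance Definition _ := gen_eqMixin M1.
HB.instance Definition _ := gen_choiceMixin M1.
HB.instance Definition _ := Topological.copy M1 (initial_topology M1_eval).

Definition supp (mu : set K -> \bar R) : set K :=
  [set x | forall U, open U -> U x -> mu U != 0%E].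

(** p_x * p_y = [conv x y], extended to nonnegative measures; the extension to complex
  measures is determined from this one by bilinearity *)
Definition conv_ext (conv : K -> K -> M1) (mu nu : {measure set borel -> \bar R})
    (E : set K) : \bar R :=
  (\int[mu]_x \int[nu]_y conv x y E)%E.

End Hypergroups.

(** nonvoid compact subsets, with the topology generated by the sets
  [{A | A `&` U != set0, A `<=` V}], [U], [V] open *)
Definition compacts (K : topologicalType) : Type :=
  {A : set K | compact A /\ A !=set0}.

Section Compacts.
Variable K : topologicalType.
HB.instance Definition _ := gen_eqMixin (compacts K).
HB.instance Definition _ := gen_choiceMixin (compacts K).
HB.instance Definition _ := isSubBaseTopological.Build (compacts K)
  [set UV : set K * set K | open UV.1 /\ open UV.2]
  (fun UV => [set A : compacts K | sval A `&` UV.1 !=set0 /\ sval A `<=` UV.2]).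
End Compacts.

Record DJS_hypergroup (R : realType) (K : topologicalType) (e : K)
    (conv : K -> K -> M1 R e) (inv : K -> K) : Prop := {
  djs_hausdorff : hausdorff_space K;
  djs_locally_compact : locally_compact [set: K];
  djs_conv_continuous : continuous (fun xy : K * K => conv xy.1 xy.2);
  djs_invK : involutive inv;
  djs_inv_continuous : continuous inv;
  djs_assoc : forall (x y z : K) (E : set K), measurable (E : set (borel e)) ->
    conv_ext conv \d_(x : borel e) (conv y z) E =
    conv_ext conv (conv x y) \d_(z : borel e) E;
  djs_supp_compact : forall x y : K, compact (supp (conv x y));
  djs_inv_conv : forall (x y : K) (E : set K), measurable (E : set (borel e)) ->
    pushforward (conv x y) (inv : borel e -> borel e) E = conv (inv y) (inv x) E;
  djs_unit : forall (x : K) (E : set K), measurable (E : set (borel e)) ->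
    conv e x E = \d_(x : borel e) E /\ conv x e E = \d_(x : borel e) E;
  djs_unit_supp : forall x y : K, supp (conv x (inv y)) e <-> x = y;
  djs_supp_continuous : exists2 S : K * K -> compacts K, continuous S &
    forall x y, sval (S (x, y)) = supp (conv x y)
}.

(* Main.v *)
Require Import Defs.
From HB Require Import structures.
From mathcomp Require Import all_boot all_order all_algebra generic_quotient.
From mathcomp Require Import spectral.
From mathcomp Require Import all_classical all_reals all_analysis.
From mathcomp Require Import measurable_realfun zify.
From mathcomp.real_closed Require Import complex.
From mathcomp.real_closed Require mxtens.

Import Order.TTheory GRing.Theory Num.Theory numFieldNormedType.Exports.
(** The proof reads the coefficients off a decomposition of tensor products. Let
  [t^alpha *t t^beta] denote the matrix of the products t^alpha_ij t^beta_kl. It is a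
  unitary corepresentation, hence an orthogonal sum of copies of the t^gamma
  ([unitary_decomposition]). Since J is a two-sided coideal, e_1 (x) e_1 is annihilated by J
  in the tensor product; therefore its component in a copy of t^gamma is J-invariant, so it
  is a multiple of e_1 and vanishes unless gamma is spherical. Reading the diagonal entry at
  e_1 (x) e_1 gives t_11^alpha t_11^beta as a combination of the t_11^gamma whose
  coefficients are squared moduli ([decomposed_entry]). So the coefficients are nonnegative;
  they add up to 1 because the counit is multiplicative and takes the value 1 at each t_11.
  Associativity and the unit law hold since the coefficients are the structure constants of
  an algebra with unit 1 = t_11^e. The space being discrete and the measures finitely
  supported, the topological axioms cost nothing, and what remains of a hypergroup are two
  identities about the coefficients ([discrete_hypergroup]): compatibility with the
  involution, and the description of the pairs whose product has e in its support.

  The compatibility with the involution amounts to the antimultiplicativity of a |-> a^-,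
  hence to f_{1/2} and f_{-1/2} being characters. Spread the matrices F_gamma over the
  decomposition of w = t^alpha *t t^beta; the claim is that the result is F_alpha *t F_beta
  ([spread_tens]). Both matrices are positive definite and intertwine w with S^2(w). Moreover
  tr(D X) = tr(D^-1 X) for each of them and every X commuting with w: for the spread matrix
  because X compresses to a scalar on each copy of t^gamma and tr F_gamma = tr F_gamma^-1, for
  D = F_alpha *t F_beta because the partial traces of X twisted by F_beta, or by the inverse
  of F_alpha, commute with t^alpha, or with t^beta, so that they are scalar too
  ([tens_trace]). Only one positive definite matrix has these properties
  ([posdef_trace_uniq]), and uniqueness of positive square roots carries the equality over
  to the half powers ([half_power_tens]).

  With G = F_alpha^{1/2}, the matrix of the (t_ij^alpha)^- is the entrywise adjoint of
  t^alpha conjugated by the transpose of G ([bar_tmx]); it is an irreducible unitary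
  corepresentation, and the hypothesis S(J) = J^- makes its first basis vector J-invariant.
  So its class is spherical, and (t_11^alpha)^- is t_11 of that class
  ([conjugate_spherical]).

  Consequently the coefficient of the unit in t_11^alpha (t_11^beta)^- is the value there of
  the Haar functional, which picks the coefficient of 1. By Schur orthogonality it is zero
  if alpha and beta differ, and a positive multiple of (G_11)^2 if they are equal
  ([haar_orthogonal], [haar_t11_bar]). This settles the support of the unit.

  All of this rests on two facts. The matrix elements of pairwise inequivalent irreducible
  corepresentations are linearly independent, so functionals may be prescribed on them
  ([independent_rows], [functional_on_entries]). And each F_alpha exists and is positive
  definite, because the entrywise adjoint of t^alpha is equivalent to a unitary
  corepresentation ([gram_modular], [modular_exists]). *)

Local Open Scope classical_set_scope.
Local Open Scope quotient_scope.
Local Open Scope complex_scope.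
Local Open Scope ring_scope.

Set Implicit Arguments.
Unset Strict Implicit.
Unset Printing Implicit Defensive.

Local Open Scope sesquilinear_scope.
Local Notation mxconj B := (map_mx Num.conj B).
Local Notation "A *t B" := (mxtens.tensmx A B) (at level 40, left associativity).
Local Notation tidx := mxtens.mxtens_index.

(** * Linear functionals separate points *)

Section Functionals_separate.
Variables (k : fieldType) (V : lmodType k).

Let subspace_avoiding (a : V) (M : set V) :=
  (forall c x y, M x -> M y -> M (c *: x + y)) /\ ~ M a.

(** A subspace maximal among those that avoid a (Zorn) is a complement of the line
  through a: adjoining any further vector makes a a combination of it and the subspace. *)
Lemma maximal_subspace_avoiding (a : V) : a != 0 -> exists M : set V,
  [/\ M 0, forall c x y, M x -> M y -> M (c *: x + y), ~ M a &
      forall x, exists c, M (x - c *: a)].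
Proof.
move=> a0; have [F FP Ftot|M [[Mlin Ma] Mmax]] :=
    @Zorn_bigcup _ (subspace_avoiding a).
  split=> [c x y [X FX Xx] [Y FY Yy]|[X FX Xa]]; last by case: (FP _ FX).
  have [XY|YX] := Ftot X Y FX FY.
  - by exists Y => //; apply: (FP _ FY).1 => //; exact: XY.
  - by exists X => //; apply: (FP _ FX).1 => //; exact: YX.
have M0 : M 0.
  apply: contrapT => M0; have Mno x : ~ M x.
    by move=> Mx; apply: M0; have := Mlin (-1) _ _ Mx Mx; rewrite scaleN1r addNr.
  apply: (Mmax [set 0]); first by split=> [x /Mno//|h]; exact: (Mno 0 (h 0 erefl)).
  split=> [c x y /= -> ->|/= a0']; first by rewrite scaler0 addr0.
  by rewrite a0' eqxx in a0.
exists M; split=> // x; have [Mx|nMx] := pselect (M x).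
  by exists 0; rewrite scale0r subr0.
(* B is the span of x and M. *)
pose B := [set z | exists2 m, M m & exists c, z = c *: x + m].
have BM : M `<` B.
  split=> [m Mm|/(_ x) /=]; first by exists m => //; exists 0; rewrite scale0r add0r.
  by move=> h; apply/nMx/h; exists 0 => //; exists 1; rewrite scale1r addr0.
have [m Mm [c ac]] : B a.
  apply: contrapT => nBa; apply: (Mmax _ BM); split=> // d y z [m Mm [c ->]] [n Mn [e ->]].
  exists (d *: m + n); first exact: Mlin.
  by exists (d * c + e); rewrite scalerDr scalerA scalerDl addrACA.
have c0 : c != 0 by apply/eqP => c0; apply: Ma; rewrite ac c0 scale0r add0r.
exists c^-1; rewrite {1}ac scalerDr scalerA mulVf// scale1r opprD addrA subrr add0r.
by have := Mlin (- c^-1) _ _ Mm M0; rewrite addr0 scaleNr.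
Qed.

(** The coordinate along a with respect to a complementary hyperplane. *)
Lemma functional_neq0 (a : V) : a != 0 -> exists f : {scalar V}, f a != 0.
Proof.
move=> a0; have [M [M0 Mlin Ma Mdec]] := maximal_subspace_avoiding a0.
have uniqc x c d : M (x - c *: a) -> M (x - d *: a) -> c = d.
  move=> Mc Md; apply/eqP; rewrite eq_sym -subr_eq0; apply/negP => /negP cd.
  apply: Ma; have := Mlin (-1) _ _ Md Mc.
  rewrite scaleN1r opprB addrA subrK -scalerBl => h.
  by have := Mlin (d - c)^-1 _ _ h M0; rewrite addr0 scalerA mulVf// scale1r.
pose f x := projT1 (cid (Mdec x)); have fP x : M (x - f x *: a).
  by rewrite /f; case: cid.
have flin : scalar f.
  move=> c x y; apply: (uniqc (c *: x + y)) => //.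
  rewrite -[_ *: a](_ : c *: (f x *: a) + f y *: a = _); last first.
    by rewrite scalerA -scalerDl.
  by rewrite opprD addrACA -scalerBr; exact: Mlin.
pose fL := GRing.isLinear.Build k V k _ f flin.
exists (HB.pack f fL : {scalar V}) => /=.
by apply/eqP => fa0; apply: Ma; have := fP a; rewrite fa0 scale0r subr0.
Qed.

(** This replaces coordinates in arguments about tensors: the right leg of a coproduct
  is removed by the action of an arbitrary functional, and identities between matrices
  over A are checked on their images under all functionals. *)
Lemma functionals_separate (a b : V) :
  (forall f : {scalar V}, f a = f b) -> a = b.
Proof.
move=> fab; apply/eqP; rewrite -subr_eq0; apply/negP => /negP /functional_neq0[f].
by rewrite linearB fab subrr eqxx.
Qed.

End Functionals_separate.

(** * Maps out of a tensor product *)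

Section TensorLift.
Variables (k : comNzRingType) (U V : lmodType k).

Lemma tlift0 (W : zmodType) (phi : U -> V -> W) : balanced phi -> tlift phi 0 = 0.
Proof. by move=> b; apply: (@addrI _ (tlift phi 0)); rewrite -tliftD// !addr0. Qed.

Lemma tlift_sum (W : zmodType) (phi : U -> V -> W) I (r : seq I) P F :
  balanced phi -> tlift phi (\sum_(i <- r | P i) F i) = \sum_(i <- r | P i) tlift phi (F i).
Proof. by move=> b; apply: big_morph; [exact: tliftD|exact: tlift0]. Qed.

Lemma tliftZ (W : lmodType k) (phi : U -> V -> W) c t :
    balanced phi -> (forall u v, phi (c *: u) v = c *: phi u v) ->
  tlift phi (c *: t) = c *: tlift phi t.
Proof.
move=> b h; rewrite {1}[t]tensor_pureE scaler_sumr tlift_sum//.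
rewrite [in RHS](tensor_pureE t) tlift_sum// scaler_sumr.
by apply: eq_bigr => p _; rewrite -pureZ !tlift_pure.
Qed.

Lemma tlift_sum_pure (W : zmodType) (phi : U -> V -> W) I (r : seq I) (P : pred I) x y :
  balanced phi ->
  tlift phi (\sum_(i <- r | P i) x i ⊗ y i) = \sum_(i <- r | P i) phi (x i) (y i).
Proof. by move=> b; rewrite tlift_sum//; apply: eq_bigr => i _; rewrite tlift_pure. Qed.

Lemma pureDl (u u' : U) (v : V) : (u + u') ⊗ v = u ⊗ v + u' ⊗ v.
Proof. by have [h _ _] := @pure_balanced _ U V; exact: h. Qed.

Lemma pureDr (u : U) (v v' : V) : u ⊗ (v + v') = u ⊗ v + u ⊗ v'.
Proof. by have [_ h _] := @pure_balanced _ U V; exact: h. Qed.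

Lemma pureZr c (u : U) (v : V) : u ⊗ (c *: v) = c *: (u ⊗ v).
Proof. by have [_ _ h] := @pure_balanced _ U V; rewrite -h pureZ. Qed.

Lemma pure_suml I (r : seq I) (F : I -> U) (v : V) :
  (\sum_(x <- r) F x) ⊗ v = \sum_(x <- r) F x ⊗ v.
Proof.
elim: r => [|x r IH]; last by rewrite !big_cons pureDl IH.
by rewrite !big_nil -(scale0r (0 : U)) pureZ scale0r.
Qed.

Lemma pure_sumr I (r : seq I) (F : I -> V) (u : U) :
  u ⊗ (\sum_(x <- r) F x) = \sum_(x <- r) u ⊗ F x.
Proof.
elim: r => [|x r IH]; last by rewrite !big_cons pureDr IH.
by rewrite !big_nil -(scale0r (0 : V)) pureZr scale0r.
Qed.

End TensorLift.

(** * Matrix corepresentations *)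

Section CorepBasics.
Variables (R : realType) (A : hopf_star_alg R).
Local Notation C := R[i].
Local Notation S := (antipode A).
Implicit Types (f g : {scalar A}).

Lemma tlift_coprod n (t : 'M[A]_n) (W : zmodType) (phi : A -> A -> W) i j :
  corep t -> balanced phi ->
  tlift phi (coprod A (t i j)) = \sum_l phi (t i l) (t l j).
Proof. by move=> ct b; rewrite (ct i j).1 tlift_sum_pure. Qed.

Lemma balanced_antipodel : balanced (fun x y : A => S x * y).
Proof.
by split=> [v x y|u x y|c x y]; rewrite ?linearD ?mulrDl ?mulrDr// linearZ/= -scalerAl scalerAr.
Qed.

Lemma balanced_antipoder : balanced (fun x y : A => x * S y).
Proof.
by split=> [v x y|u x y|c x y]; rewrite ?linearD ?mulrDl ?mulrDr// linearZ/= -scalerAl scalerAr.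
Qed.

Lemma balanced_lact g : balanced (fun x y : A => g y *: x).
Proof.
split=> [v x y|u x y|c x y]; rewrite ?linearD ?scalerDl ?scalerDr//=.
by rewrite scalarZ !scalerA mulrC.
Qed.

Lemma balanced_ract g : balanced (fun x y : A => g x *: y).
Proof.
split=> [v x y|u x y|c x y]; rewrite ?linearD ?scalerDl ?scalerDr//=.
by rewrite scalarZ scalerA mulrC.
Qed.

Lemma lact_is_linear g : linear (lact g : A -> A).
Proof.
move=> c a b; rewrite /lact linearP tliftD; last exact: balanced_lact.
rewrite tliftZ //; first exact: balanced_lact.
by move=> u v; rewrite !scalerA mulrC.
Qed.

HB.instance Definition _ g := GRing.isLinear.Build C A A _ (lact g) (lact_is_linear g).

Lemma ract_is_linear g : linear ((@ract _ A)^~ g : A -> A).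
Proof.
move=> c a b; rewrite /ract linearP tliftD; last exact: balanced_ract.
rewrite tliftZ //; first exact: balanced_ract.
by move=> u v; rewrite scalarZ scalerA.
Qed.

Lemma lact_corep n (t : 'M[A]_n) g i j : corep t ->
  lact g (t i j) = \sum_l g (t l j) *: t i l.
Proof. by move=> ct; rewrite /lact tlift_coprod//; exact: balanced_lact. Qed.

Lemma ract_corep n (t : 'M[A]_n) g i j : corep t ->
  ract (t i j) g = \sum_l g (t i l) *: t l j.
Proof. by move=> ct; rewrite /ract tlift_coprod//; exact: balanced_ract. Qed.

Local Notation scal := (scal_mx A).

Lemma scal_mxM m n p (B : 'M[C]_(m, n)) (D : 'M[C]_(n, p)) :
  scal (B *m D) = scal B *m scal D.
Proof. exact: map_mxM. Qed.

Lemma scal_mxD m n (B D : 'M[C]_(m, n)) : scal (B + D) = scal B + scal D.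
Proof. exact: map_mxD. Qed.

Lemma scal_mxB m n (B D : 'M[C]_(m, n)) : scal (B - D) = scal B - scal D.
Proof. exact: map_mxB. Qed.

Lemma scal_mx0 m n : scal (0 : 'M[C]_(m, n)) = 0.
Proof. exact: map_mx0. Qed.

Lemma scal_mx1 n : scal (1%:M : 'M[C]_n) = 1%:M.
Proof. exact: map_mx1. Qed.

Lemma scal_mulE m n p (B : 'M[C]_(m, n)) (X : 'M[A]_(n, p)) i j :
  (scal B *m X) i j = \sum_l B i l *: X l j.
Proof. by rewrite !mxE; apply: eq_bigr => l _; rewrite !mxE mulr_algl. Qed.

Lemma mul_scalE m n p (X : 'M[A]_(m, n)) (B : 'M[C]_(n, p)) i j :
  (X *m scal B) i j = \sum_l B l j *: X i l.
Proof. by rewrite !mxE; apply: eq_bigr => l _; rewrite !mxE mulr_algr. Qed.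

Lemma map_scal_mul m n p (g : {scalar A}) (B : 'M[C]_(m, n)) (X : 'M[A]_(n, p)) :
  map_mx g (scal B *m X) = B *m map_mx g X.
Proof.
apply/matrixP => i j; rewrite mxE scal_mulE mxE linear_sum/=.
by apply: eq_bigr => l _; rewrite scalarZ mxE.
Qed.

Lemma map_mul_scal m n p (g : {scalar A}) (X : 'M[A]_(m, n)) (B : 'M[C]_(n, p)) :
  map_mx g (X *m scal B) = map_mx g X *m B.
Proof.
apply/matrixP => i j; rewrite mxE mul_scalE mxE linear_sum/=.
by apply: eq_bigr => l _; rewrite scalarZ mxE mulrC.
Qed.

Lemma mx_functionals_separate m n (X Y : 'M[A]_(m, n)) :
  (forall g : {scalar A}, map_mx g X = map_mx g Y) -> X = Y.
Proof.
move=> h; apply/matrixP => i j; apply: functionals_separate => g.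
by have /matrixP/(_ i j) := h g; rewrite !mxE.
Qed.

Lemma corep_counit n (t : 'M[A]_n) : corep t -> map_mx (counit A) t = 1%:M.
Proof. by move=> ct; apply/matrixP => i j; rewrite !mxE (ct i j).2. Qed.

(** With [corep_antipoder]: the antipode axiom, applied entrywise, makes S(t) the
  inverse matrix of t. *)
Lemma corep_antipodel n (t : 'M[A]_n) : corep t -> map_mx S t *m t = 1%:M.
Proof.
move=> ct; apply/matrixP => i j; have := antipodel (t i j).
rewrite tlift_coprod//; last exact: balanced_antipodel.
rewrite (ct i j).2 !mxE => e; rewrite -[RHS]/((i == j)%:R).
transitivity ((i == j)%:R%:A : A); last by rewrite scaler_nat.
by rewrite -e; apply: eq_bigr => l _; rewrite mxE.
Qed.

Lemma corep_antipoder n (t : 'M[A]_n) : corep t -> t *m map_mx S t = 1%:M.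
Proof.
move=> ct; apply/matrixP => i j; have := antipoder (t i j).
rewrite tlift_coprod//; last exact: balanced_antipoder.
rewrite (ct i j).2 !mxE => e; rewrite -[RHS]/((i == j)%:R).
transitivity ((i == j)%:R%:A : A); last by rewrite scaler_nat.
by rewrite -e; apply: eq_bigr => l _; rewrite mxE.
Qed.

End CorepBasics.

(** * Schur's lemma *)

Section Schur.
Variables (R : realType) (A : hopf_star_alg R).
Local Notation C := R[i].
Local Notation scal := (scal_mx A).

(** The columns of X, independent because X has a left inverse, span a subspace that is
  stable under t, and s = X' t X is the matrix of t on that subspace. *)
Lemma corep_restrict n m (t : 'M[A]_n) (s : 'M[A]_m) (X : 'M[C]_(n, m))
    (X' : 'M[C]_(m, n)) :
  corep t -> X' *m X = 1%:M -> t *m scal X = scal X *m s -> corep s.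
Proof.
move=> ct X'X tX; have sE : s = scal X' *m t *m scal X.
  by rewrite -mulmxA tX mulmxA -scal_mxM X'X scal_mx1 mul1mx.
have tXE i j : \sum_l X l j *: t i l = \sum_l X i l *: s l j.
  by rewrite -mul_scalE tX scal_mulE.
move=> i j; split.
  have -> : s i j = \sum_p \sum_l (X' i l * X p j) *: t l p.
    rewrite sE mul_scalE; apply: eq_bigr => p _.
    rewrite scal_mulE scaler_sumr; apply: eq_bigr => l _.
    by rewrite scalerA mulrC.
  rewrite linear_sum/=.
  transitivity (\sum_p \sum_l \sum_q (X' i l * X p j) *: (t l q ⊗ t q p)).
    apply: eq_bigr => p _; rewrite linear_sum; apply: eq_bigr => l _.
    by rewrite linearZ/= (ct l p).1 scaler_sumr.
  transitivity (\sum_l \sum_q X' i l *: (t l q ⊗ (\sum_p X p j *: t q p))).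
    rewrite exchange_big/=; apply: eq_bigr => l _.
    rewrite exchange_big/=; apply: eq_bigr => q _.
    rewrite pure_sumr scaler_sumr; apply: eq_bigr => p _.
    by rewrite pureZr scalerA.
  transitivity (\sum_l \sum_q \sum_p X' i l *: ((X q p *: t l q) ⊗ s p j)).
    apply: eq_bigr => l _; apply: eq_bigr => q _.
    rewrite tXE pure_sumr scaler_sumr; apply: eq_bigr => p _.
    by rewrite pureZr pureZ.
  transitivity (\sum_p \sum_l \sum_q X' i l *: ((X q p *: t l q) ⊗ s p j)).
    by rewrite [RHS]exchange_big/=; apply: eq_bigr => l _; rewrite exchange_big.
  apply: eq_bigr => p _.
  have -> : s i p = \sum_l X' i l *: \sum_q X q p *: t l q.
    rewrite sE -mulmxA scal_mulE; apply: eq_bigr => l _.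
    by rewrite mul_scalE.
  rewrite pure_suml; apply: eq_bigr => l _.
  by rewrite pureZ pure_suml scaler_sumr.
have /matrixP/(_ i j) : map_mx (counit A) s = 1%:M; last by rewrite !mxE.
by rewrite sE map_mul_scal map_scal_mul corep_counit// mulmx1.
Qed.

Lemma corep_of_equiv n m (t : 'M[A]_n) (s : 'M[A]_m) :
  corep_equiv s t -> corep t -> corep s.
Proof. by case=> B [B' [_ B'B e]] ct; apply: (corep_restrict ct B'B); rewrite e. Qed.

Lemma corep_equiv_trans n m p (s : 'M[A]_n) (t : 'M[A]_m) (u : 'M[A]_p) :
  corep_equiv s t -> corep_equiv t u -> corep_equiv s u.
Proof.
case=> [B [B' [BB' B'B e]]] [D [D' [DD' D'D e']]].
exists (D *m B), (B' *m D'); split.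
- by rewrite mulmxA -(mulmxA D) BB' mulmx1.
- by rewrite mulmxA -(mulmxA B') D'D mulmx1.
- by rewrite scal_mxM -mulmxA e !mulmxA e'.
Qed.

Lemma irreducible_corep_equiv n (s t : 'M[A]_n) :
  corep_equiv s t -> irreducible_corep t -> irreducible_corep s.
Proof.
by move=> st it [u us bu]; apply: it; exists u => //; exact: corep_equiv_trans us st.
Qed.

Lemma irreducible_conj_not_block n (t : 'M[A]_n) (U : 'M[C]_n) :
  irreducible_corep t -> U \in unitmx ->
  ~ block_triangular (scal (invmx U) *m t *m scal U).
Proof.
move=> it uU bt; apply: it; exists (scal (invmx U) *m t *m scal U) => //.
exists U, (invmx U); split; rewrite ?mulmxV ?mulVmx//.
by rewrite !mulmxA -scal_mxM mulmxV// scal_mx1 mul1mx.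
Qed.

(** The range of X is stable under t. Write X = U (pid_mx r) V with U and V invertible:
  after conjugation by U, the stable subspace is spanned by the first r basis vectors,
  so the matrix is block triangular, which irreducibility excludes for 0 < r < n. The
  stability of the range is expressed by an arbitrary factor Y. *)
Lemma intertwiner_range n m (t : 'M[A]_n) (X : 'M[C]_(n, m)) (Y : 'M[A]_m) :
  irreducible_corep t -> t *m scal X = scal X *m Y -> X = 0 \/ \rank X = n.
Proof.
move=> it tX; have [r0|r0] := posnP (\rank X).
  by left; apply/eqP; rewrite -mxrank_eq0 r0.
right; apply/eqP; rewrite eqn_leq rank_leq_row leqNgt; apply/negP => rn.
set r := \rank X in r0 rn *.
set U := col_ebase X; set V := row_ebase X.
have uU : U \in unitmx by exact: col_ebase_unit.
have uV : V \in unitmx by exact: row_ebase_unit.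
have UXV : invmx U *m X *m invmx V = pid_mx r.
  by rewrite -(mulmx_ebase X) -/U -/V -/r !mulmxA mulVmx// mul1mx mulmxK.
apply: (irreducible_conj_not_block it uU); exists r; first by rewrite r0 rn.
set Z := scal (invmx U) *m t *m scal U.
have ZE : Z *m scal (pid_mx r) = scal (pid_mx r) *m (scal V *m Y *m scal (invmx V)).
  rewrite -UXV !scal_mxM /Z !mulmxA.
  rewrite -(mulmxA _ (scal U)) -scal_mxM mulmxV// scal_mx1 mulmx1.
  rewrite -(mulmxA _ t) tX mulmxA.
  by rewrite -(mulmxA _ _ (scal V)) -(scal_mxM A (invmx V) V) mulVmx// scal_mx1 mulmx1.
move=> i j /andP[jr ri]; have jm : (j < m)%N.
  by apply: leq_trans jr _; exact: rank_leq_col.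
have /matrixP/(_ i (Ordinal jm)) := ZE.
rewrite mul_scalE scal_mulE (bigD1 j)//= mxE /= eqxx jr scale1r.
rewrite big1 ?addr0 => [->|l lj]; last by rewrite mxE /= val_eqE (negbTE lj) scale0r.
by apply: big1 => l _; rewrite mxE ltnNge ri andbF scale0r.
Qed.

(** The kernel of X, spanned by the columns of Z = cokermx X, is stable under s, and
  [intertwiner_range] applies to Z. *)
Lemma intertwiner_kernel n m (s : 'M[A]_m) (X : 'M[C]_(n, m)) (Y : 'M[A]_n) :
  irreducible_corep s -> scal X *m s = Y *m scal X -> X = 0 \/ \rank X = m.
Proof.
move=> is_ Xs; set Z := cokermx X; set V := row_ebase X; set U := col_ebase X.
have uU : U \in unitmx by exact: col_ebase_unit.
have uV : V \in unitmx by exact: row_ebase_unit.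
have XZ : X *m Z = 0 by exact: mulmx_coker.
have ZE : Z = invmx V *m copid_mx (\rank X) by [].
have rkZ : \rank Z = (m - \rank X)%N by exact: mxrank_coker.
clearbody Z.
have XsZ : scal X *m (s *m scal Z) = 0.
  by rewrite mulmxA Xs -mulmxA -scal_mxM XZ scal_mx0 mulmx0.
have pV : scal (pid_mx (\rank X) : 'M[C]_m) *m scal V *m (s *m scal Z) = 0.
  have -> : pid_mx (\rank X) = pid_mx (\rank X) *m invmx U *m X *m invmx V :> 'M[C]_m.
    rewrite -{3}(mulmx_ebase X) -/U -/V !mulmxA mulmxKV// mulmxK// pid_mx_id//.
    exact: rank_leq_row.
  rewrite !scal_mxM -(mulmxA _ (scal (invmx V))) -(scal_mxM A (invmx V) V) mulVmx//.
  by rewrite scal_mx1 mulmx1 -mulmxA XsZ mulmx0.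
have sZ : s *m scal Z = scal Z *m (scal V *m (s *m scal Z)).
  rewrite {2}ZE /copid_mx mulmxBr mulmx1 scal_mxB (scal_mxM A _ (pid_mx _)) mulmxBl.
  rewrite [X in X - _]mulmxA -(scal_mxM A (invmx V) V) mulVmx// scal_mx1 mul1mx.
  by rewrite -mulmxA [X in _ - _ *m X]mulmxA pV mulmx0 subr0.
have [Z0|rZ] := intertwiner_range is_ sZ.
  right; move: rkZ; rewrite Z0 mxrank0 => /esym/eqP.
  rewrite subn_eq0 => h; apply/eqP; rewrite eqn_leq h andbT; exact: rank_leq_col.
left; apply/eqP; rewrite -mxrank_eq0; move: rkZ; rewrite rZ => h.
have := rank_leq_col X; lia.
Qed.

Lemma schur n m (s : 'M[A]_m) (t : 'M[A]_n) (X : 'M[C]_(n, m)) :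
  irreducible_corep s -> irreducible_corep t -> scal X *m s = t *m scal X ->
  X = 0 \/ corep_equiv s t.
Proof.
move=> is_ it Xs; have [->|rm] := intertwiner_kernel is_ Xs; first by left.
have [->|rn] := intertwiner_range it (esym Xs); first by left.
right; have nm : n = m by rewrite -[RHS]rm [RHS]rn.
subst m; have uX : X \in unitmx by rewrite -row_free_unit /row_free rn.
by exists X, (invmx X); rewrite mulmxV// mulVmx.
Qed.

(** If c is an eigenvalue of X, then X - c is a singular endomorphism, hence 0. *)
Lemma schur_scalar n (t : 'M[A]_n) (X : 'M[C]_n) :
  (0 < n)%N -> irreducible_corep t -> scal X *m t = t *m scal X ->
  exists c : C, X = c%:M.
Proof.
move=> n0 it Xt; have [c /eigenvalueP[v vX v0]] := eigenvalue_closed X n0.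
exists c; apply/eqP; rewrite -subr_eq0; apply/eqP.
have Yt : scal (X - c%:M) *m t = t *m scal (X - c%:M).
  rewrite scal_mxB mulmxBl mulmxBr Xt; congr (_ - _).
  apply/matrixP => i j; rewrite scal_mulE mul_scalE.
  rewrite (bigD1 i)//= mxE eqxx big1 ?addr0 => [|l li]; last first.
    by rewrite mxE eq_sym (negbTE li) scale0r.
  rewrite (bigD1 j)//= mxE eqxx big1 ?addr0 => [//|l li].
  by rewrite mxE (negbTE li) scale0r.
have [//|rk] := intertwiner_range it (esym Yt).
have uY : X - c%:M \in unitmx by rewrite -row_free_unit /row_free rk.
have vY : v *m (X - c%:M) = 0 by rewrite mulmxBr vX mul_mx_scalar subrr.
by move: v0; rewrite -(mulmxK uY v) vY mul0mx eqxx.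
Qed.

End Schur.

(** * Linear independence of matrix elements *)

Section Independence.
Variables (R : realType) (A : hopf_star_alg R).
Local Notation C := R[i].
Local Notation scal := (scal_mx A).

(** Let the rows of M span a subspace of largest rank on which P holds; then all of P is
  spanned by them. Stability under every functional lifts to an identity t M^T = M^T Y
  over A because functionals separate points, so M^T has full rank by
  [intertwiner_range]. *)
Lemma stable_subspace_full n (t : 'M[A]_n) (P : 'cV[C]_n -> Prop) (Y0 : 'cV[C]_n) :
    irreducible_corep t ->
    (forall c Y Z, P Y -> P Z -> P (c *: Y + Z)) ->
    (forall (g : {scalar A}) Y, P Y -> P (map_mx g t *m Y)) ->
  P Y0 -> Y0 != 0 -> forall Y, P Y.
Proof.
move=> it Plin Pt PY0 Y0n0.
have P0 : P 0 by have := Plin (-1) _ _ PY0 PY0; rewrite scaleN1r addNr.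
pose span_in (M : 'M[C]_n) := forall v : 'rV_n, (v <= M)%MS -> P v^T.
pose Q r := `[< exists2 M, span_in M & \rank M = r >].
have Q0 : exists r, Q r.
  exists 0%N; apply/asboolP; exists 0; last by rewrite mxrank0.
  by move=> v; rewrite submx0 => /eqP ->; rewrite trmx0.
have Qn r : Q r -> (r <= n)%N by move=> /asboolP[M _ <-]; exact: rank_leq_row.
have [r /asboolP[M spanM rM] rmax] := ex_maxnP Q0 Qn.
have PM Y : P Y -> (Y^T <= M)%MS.
  move=> PY; have : Q (\rank (M + Y^T)%MS).
    apply/asboolP; exists (M + Y^T)%MS => // v /sub_addsmxP[[u1 u2] /= ->].
    rewrite (mx11_scalar u2) mul_scalar_mx addrC linearP/= trmxK.
    by apply: Plin => //; apply: spanM; exact: submxMl.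
  move=> /rmax; rewrite -rM => le_rk.
  apply: submx_trans (addsmxSr M Y^T) _.
  by rewrite -(mxrank_leqif_sup (addsmxSl M Y^T)) eqn_leq mxrankS ?addsmxSl.
have tM : t *m scal M^T = scal M^T *m (scal (pinvmx M)^T *m (t *m scal M^T)).
  apply: mx_functionals_separate => g.
  rewrite !map_scal_mul map_mul_scal; apply: trmx_inj.
  rewrite [RHS]trmx_mul [X in _ = X *m _]trmx_mul !trmxK mulmxKpV// trmx_mul trmxK.
  apply/row_subP => i; rewrite row_mul -[X in (X <= _)%MS]trmxK.
  by apply: PM; rewrite trmx_mul trmxK; apply/Pt/spanM; exact: row_sub.
have [M0|Mn] := intertwiner_range it tM.
  have M00 : M = 0 by rewrite -[M]trmxK M0 trmx0.
  move: Y0n0; have := PM _ PY0; rewrite M00 submx0 => /eqP Y00.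
  by rewrite -[Y0]trmxK Y00 trmx0 eqxx.
move=> Y; rewrite -[Y]trmxK; apply: spanM; apply: submx_full.
by rewrite /row_full -mxrank_tr Mn.
Qed.

Variables (I : eqType) (n_ : I -> nat) (t : forall i, 'M[A]_(n_ i)).
Hypothesis t_corep : forall i, corep (t i).
Hypothesis t_irr : forall i, irreducible_corep (t i).
Hypothesis n_gt0 : forall i, (0 < n_ i)%N.
Hypothesis t_inequiv : forall i j, i != j -> ~ corep_equiv (t i) (t j).

Local Notation J := {i : I & 'I_(n_ i)}.

(** A combination of the entries in one row; the left action of a functional g changes
  its coefficient column Y into g(t) Y ([lact_row_comb]), which is what makes rows the
  right unit for the induction in [independent_rows]. *)
Definition row_comb (x : J) (Y : 'cV[C]_(n_ (tag x))) : A :=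
  \sum_j Y j 0 *: t (tag x) (tagged x) j.

Lemma row_combP x c Y Z :
  row_comb (x := x) (c *: Y + Z) = c *: row_comb Y + row_comb Z.
Proof.
rewrite /row_comb scaler_sumr -big_split/=; apply: eq_bigr => j _.
by rewrite !mxE scalerDl scalerA.
Qed.

Lemma row_comb_sum x m (F : 'I_m -> C) (T : 'M[C]_(n_ (tag x), m)) :
  row_comb (x := x) (T *m \col_l F l) = \sum_l F l *: row_comb (x := x) (col l T).
Proof.
rewrite /row_comb; under [RHS]eq_bigr do rewrite scaler_sumr.
rewrite exchange_big/=; apply: eq_bigr => j _; rewrite mxE scaler_suml.
by apply: eq_bigr => l _; rewrite !mxE scalerA mulrC.
Qed.

Lemma lact_row_comb x (g : {scalar A}) (Y : 'cV[C]_(n_ (tag x))) :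
  lact g (row_comb Y) = row_comb (map_mx g (t (tag x)) *m Y).
Proof.
rewrite /row_comb linear_sum/=.
under eq_bigr do rewrite linearZ/= lact_corep// scaler_sumr.
rewrite exchange_big/=; apply: eq_bigr => l _; rewrite mxE scaler_suml.
by apply: eq_bigr => j _; rewrite mxE scalerA mulrC.
Qed.

(** Induction on the list of rows. Suppose that row x occurs with a nonzero column. The
  columns that occur at x in some relation form a subspace stable under all g(t), so
  every column occurs, and each entry of row x is a combination of the remaining rows,
  with coefficient matrices T_y. Acting with functionals on these expressions and
  comparing with the induction hypothesis shows that T_y intertwines the
  corepresentation of x with that of y. By Schur's lemma T_y is zero, or scalar when y
  is another row of the same corepresentation; in both cases the matrix element of T_y
  that links the two rows vanishes. Then the counit of the diagonal entry in row x,
  which is 1, would be 0. *)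
Lemma independent_rows (l : seq J) : uniq l ->
  forall X : (forall x : J, 'cV[C]_(n_ (tag x))),
  \sum_(x <- l) row_comb (X x) = 0 -> forall x, x \in l -> X x = 0.
Proof.
elim: l => [//|x l IH] /= /andP[xl ul] X; rewrite big_cons => X0.
suff Xx0 : X x = 0.
  move=> y; rewrite inE => /orP[/eqP->//|yl]; apply: IH => //.
  move: X0; rewrite Xx0 [row_comb _]big1 ?add0r// => j _.
  by rewrite mxE scale0r.
apply/eqP/negP => /negP Xx0.
(* The columns that occur at x in a relation among the rows of x :: l. *)
pose P Y := exists X' : (forall y : J, 'cV[C]_(n_ (tag y))),
  row_comb (x := x) Y + \sum_(y <- l) row_comb (X' y) = 0.
have Pfull : forall Y, P Y.
  apply: (@stable_subspace_full _ (t (tag x)) P (X x)) => //.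
  - move=> c Y Z [Y' eY] [Z' eZ]; exists (fun y => c *: Y' y + Z' y).
    rewrite row_combP; under eq_bigr do rewrite row_combP.
    by rewrite big_split/= -scaler_sumr addrACA -scalerDr eY eZ scaler0 addr0.
  - move=> g Y [Y' eY]; exists (fun y => map_mx g (t (tag y)) *m Y' y).
    have := congr1 (lact g) eY; rewrite linearD linear0 /= lact_row_comb (linear_sum (lact g)) /=.
    by under eq_bigr do rewrite lact_row_comb.
  - by exists X.
(* The relation whose column at x is the j-th basis vector expresses the j-th entry of
  row x by the rows in l. *)
pose T y : 'M[C]_(n_ (tag y), n_ (tag x)) :=
  \matrix_(i, j) (- projT1 (cid (Pfull (delta_mx j 0))) y i 0).
have rowE j : t (tag x) (tagged x) j = \sum_(y <- l) row_comb (x := y) (col j (T y)).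
  have : row_comb (x := x) (delta_mx j 0) = t (tag x) (tagged x) j.
    rewrite /row_comb (bigD1 j)//= mxE !eqxx scale1r big1 ?addr0// => k kj.
    by rewrite mxE (negbTE kj) scale0r.
  have /eqP := projT2 (cid (Pfull (delta_mx j 0))).
  rewrite addr_eq0 => /eqP -> <-; rewrite -sumrN.
  apply: eq_bigr => y _; rewrite -sumrN; apply: eq_bigr => k _.
  by rewrite !mxE scaleNr.
have Tint y : y \in l -> t (tag y) *m scal (T y) = scal (T y) *m t (tag x).
  move=> yl; apply: mx_functionals_separate => g.
  rewrite map_mul_scal map_scal_mul; apply/eqP; rewrite -subr_eq0; apply/eqP.
  apply/matrixP => k j; rewrite [RHS]mxE.
  pose D y := map_mx g (t (tag y)) *m T y - T y *m map_mx g (t (tag x)).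
  (* The columns of the defect D of the intertwining relation are the coefficients of
    a relation among the rows in l. *)
  suff /(IH ul (fun y => col j (D y)))/(_ y yl)/colP/(_ k) :
      \sum_(y <- l) row_comb (x := y) (col j (D y)) = 0.
    by rewrite !mxE.
  have DE z : row_comb (x := z) (col j (D z)) = lact g (row_comb (x := z) (col j (T z)))
      - \sum_i g (t (tag x) i j) *: row_comb (x := z) (col i (T z)).
    rewrite lact_row_comb -row_comb_sum -[X in _ = _ - X]scale1r -scaleNr addrC -row_combP.
    congr row_comb; rewrite scaleN1r addrC; apply/colP => i.
    by rewrite !mxE; congr (_ - _); apply: eq_bigr => p _; rewrite !mxE.
  under eq_bigr do rewrite DE.
  rewrite big_split/= -linear_sum/= -rowE lact_corep// sumrN exchange_big/=.
  under [X in _ - X]eq_bigr do rewrite -scaler_sumr -rowE.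
  by rewrite subrr.
have T0 y : y \in l -> T y (tagged y) (tagged x) = 0.
  move=> yl; have := Tint y yl; have : y != x.
    by apply: contraNneq xl => <-.
  case: y {yl} (T y) => i j; case: (x) => i' j' /= Ty; have [ii'|ii'] := eqVneq i i'.
    subst i'; rewrite eq_Tagged/= => jj' Tc.
    have [c ->] := schur_scalar (n_gt0 i) (@t_irr i) (esym Tc).
    by rewrite mxE (negbTE jj').
  move=> _ Tc; have [->|/corep_equiv_sym] := schur (@t_irr i') (@t_irr i) (esym Tc).
    by rewrite mxE.
  by move=> /t_inequiv; case.
have := congr1 (counit A) (rowE (tagged x)).
rewrite (t_corep _ _).2 eqxx linear_sum/= big_seq big1 => [/eqP|y yl].
  by rewrite oner_eq0.
rewrite /row_comb linear_sum (bigD1 (tagged y))//= big1 => [|k ky].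
  by rewrite linearZ/= mxE T0// mul0r addr0.
by rewrite linearZ/= (t_corep _ _).2 eq_sym (negbTE ky) mulr0.
Qed.
End Independence.

(** * Adjoint matrices *)

Section Adjoints.
Variable C : numClosedFieldType.

Lemma adjM m n p (X : 'M[C]_(m, n)) (Y : 'M[C]_(n, p)) : (X *m Y)^t* = Y^t* *m X^t*.
Proof. by rewrite trmx_mul map_mxM. Qed.

Lemma adjB m n (X Y : 'M[C]_(m, n)) : (X - Y)^t* = X^t* - Y^t*.
Proof. by rewrite linearB map_mxB. Qed.

Lemma adjZ m n (c : C) (X : 'M[C]_(m, n)) : (c *: X)^t* = c^* *: X^t*.
Proof. by apply/matrixP => i j; rewrite !mxE rmorphM. Qed.

Lemma adj1 n : (1%:M : 'M[C]_n)^t* = 1%:M.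
Proof. by rewrite trmx1 map_mx1. Qed.

Lemma adj_sum m n I (r : seq I) (F : I -> 'M[C]_(m, n)) :
  (\sum_(i <- r) F i)^t* = \sum_(i <- r) (F i)^t*.
Proof. by rewrite linear_sum/= raddf_sum. Qed.

Lemma adj_mul_ge0 m n (X : 'M[C]_(m, n)) j : 0 <= (X^t* *m X) j j.
Proof.
by rewrite mxE sumr_ge0// => i _; rewrite !mxE mulrC; exact: mul_conjC_ge0.
Qed.

Lemma adj_mul_eq0 m n (X : 'M[C]_(m, n)) : (forall j, (X^t* *m X) j j = 0) -> X = 0.
Proof.
move=> h; apply/matrixP => i j; rewrite [RHS]mxE; apply/eqP.
have := h j; rewrite mxE => /eqP.
rewrite psumr_eq0 => [/allP/(_ i (mem_index_enum _))|k _]; last first.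
  by rewrite !mxE mulrC; exact: mul_conjC_ge0.
by rewrite !mxE mulrC mul_conjC_eq0.
Qed.

End Adjoints.

(** * Unitary corepresentations *)

Section StarMatrices.
Variables (R : realType) (A : hopf_star_alg R).
Local Notation C := R[i].
Local Notation S := (antipode A).
Local Notation scal := (scal_mx A).

Lemma starD (a b : A) : star (a + b) = star a + star b.
Proof. by have := star_antilinear 1 a b; rewrite !scale1r rmorph1 scale1r. Qed.

Lemma star0 : star (0 : A) = 0.
Proof. by apply: (@addrI _ (star (0 : A))); rewrite -starD !addr0. Qed.

Lemma starZ (c : C) (a : A) : star (c *: a) = c^* *: star a.
Proof. by have := star_antilinear c a 0; rewrite !addr0 star0 addr0. Qed.

Lemma star1 : star (1 : A) = 1.
Proof. by rewrite -[LHS]mulr1 -{2}(starK (1 : A)) -starM mulr1 starK. Qed.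

Lemma star_sum I (r : seq I) (P : pred I) (F : I -> A) :
  star (\sum_(i <- r | P i) F i) = \sum_(i <- r | P i) star (F i).
Proof. by apply: big_morph; [exact: starD|exact: star0]. Qed.

Definition mxstar m n (X : 'M[A]_(m, n)) : 'M[A]_(n, m) := \matrix_(i, j) star (X j i).

Lemma mxstarM m n p (X : 'M[A]_(m, n)) (Y : 'M[A]_(n, p)) :
  mxstar (X *m Y) = mxstar Y *m mxstar X.
Proof.
apply/matrixP => i j; rewrite !mxE star_sum; apply: eq_bigr => k _.
by rewrite !mxE starM.
Qed.

Lemma mxstarK m n (X : 'M[A]_(m, n)) : mxstar (mxstar X) = X.
Proof. by apply/matrixP => i j; rewrite !mxE starK. Qed.

Lemma mxstar_scal m n (B : 'M[C]_(m, n)) : mxstar (scal B) = scal (B^t*).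
Proof. by apply/matrixP => i j; rewrite !mxE starZ star1. Qed.

Lemma mxstar1 n : mxstar (1%:M : 'M[A]_n) = 1%:M.
Proof. by rewrite -(scal_mx1 A) mxstar_scal adj1. Qed.

Lemma unitary_corepE n (t : 'M[A]_n) : unitary_corep t <-> map_mx S t = mxstar t.
Proof.
split=> [ut|e i j]; first by apply/matrixP => i j; rewrite !mxE ut.
by have /matrixP/(_ i j) := e; rewrite !mxE.
Qed.

Lemma unitary_mulstar n (t : 'M[A]_n) : corep t -> unitary_corep t ->
  t *m mxstar t = 1%:M.
Proof. by move=> ct /unitary_corepE <-; exact: corep_antipoder. Qed.

Lemma unitary_starmul n (t : 'M[A]_n) : corep t -> unitary_corep t ->
  mxstar t *m t = 1%:M.
Proof. by move=> ct /unitary_corepE <-; exact: corep_antipodel. Qed.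

(** S(t) and the adjoint are both inverses of t. *)
Lemma unitary_of_starmul n (t : 'M[A]_n) : corep t -> mxstar t *m t = 1%:M ->
  unitary_corep t.
Proof.
move=> ct tt; apply/unitary_corepE.
by rewrite -[LHS]mul1mx -tt -mulmxA corep_antipoder// mulmx1.
Qed.

(** For a unitary corepresentation, star followed by transposition inverts the matrix;
  taking adjoints in t^-1 X = X s^-1 gives the claim. *)
Lemma intertwiner_adj n m (t : 'M[A]_n) (s : 'M[A]_m) (X : 'M[C]_(n, m)) :
    corep t -> unitary_corep t -> corep s -> unitary_corep s ->
  t *m scal X = scal X *m s -> scal (X^t*) *m t = s *m scal (X^t*).
Proof.
move=> ct ut cs us tX.
have Xs : scal X *m mxstar s = mxstar t *m scal X.
  rewrite -[LHS]mul1mx -(unitary_starmul ct ut) -mulmxA [t *m _]mulmxA tX.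
  by rewrite -!mulmxA unitary_mulstar// mulmx1.
by have := congr1 (@mxstar _ _) Xs; rewrite !mxstarM !mxstarK mxstar_scal => <-.
Qed.

Lemma map_antipode_scal_mul m n p (B : 'M[C]_(m, n)) (X : 'M[A]_(n, p)) :
  map_mx S (scal B *m X) = scal B *m map_mx S X.
Proof.
apply/matrixP => i j; rewrite mxE !scal_mulE linear_sum/=.
by apply: eq_bigr => l _; rewrite linearZ/= mxE.
Qed.

Lemma map_antipode_mul_scal m n p (X : 'M[A]_(m, n)) (B : 'M[C]_(n, p)) :
  map_mx S (X *m scal B) = map_mx S X *m scal B.
Proof.
apply/matrixP => i j; rewrite mxE !mul_scalE linear_sum/=.
by apply: eq_bigr => l _; rewrite linearZ/= mxE.
Qed.

Lemma unitary_restrict n m (t : 'M[A]_n) (s : 'M[A]_m) (X : 'M[C]_(n, m)) :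
    corep t -> unitary_corep t -> X^t* *m X = 1%:M -> t *m scal X = scal X *m s ->
  corep s /\ unitary_corep s.
Proof.
move=> ct ut X1 tX; split; first exact: (corep_restrict ct X1 tX).
have -> : s = scal (X^t*) *m t *m scal X.
  by rewrite -mulmxA tX mulmxA -scal_mxM X1 scal_mx1 mul1mx.
apply/unitary_corepE; rewrite map_antipode_mul_scal map_antipode_scal_mul ((unitary_corepE t).1 ut).
by rewrite !mxstarM !mxstar_scal trmxCK mulmxA.
Qed.

End StarMatrices.

(** * Decomposition into irreducible unitary corepresentations *)

Section Decomposition.
Variables (R : realType) (A : hopf_star_alg R).
Local Notation C := R[i].
Local Notation scal := (scal_mx A).
Variables (rep : hat A -> irr A).
Hypothesis repK : forall alpha, irr_class (rep alpha) = alpha.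

Lemma irrP (x : irr A) :
  [/\ corep (irr_mx x), unitary_corep (irr_mx x) & irreducible_corep (irr_mx x)].
Proof. by have /asboolP := valP x. Qed.

Lemma tmx_corep alpha : corep (tmx rep alpha).
Proof. by case: (irrP (rep alpha)). Qed.

Lemma tmx_unitary alpha : unitary_corep (tmx rep alpha).
Proof. by case: (irrP (rep alpha)). Qed.

Lemma tmx_irr alpha : irreducible_corep (tmx rep alpha).
Proof. by case: (irrP (rep alpha)). Qed.

Lemma irr_classP (x y : irr A) :
  irr_class x = irr_class y <-> corep_equiv (irr_mx x) (irr_mx y).
Proof.
split=> [/(@eqmodP _ (irr_equiv A)) /asboolP//|h].
by apply/(@eqmodP _ (irr_equiv A))/asboolP.
Qed.

Lemma tmx_inj alpha beta : corep_equiv (tmx rep alpha) (tmx rep beta) -> alpha = beta.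
Proof. by move=> /irr_classP; rewrite !repK. Qed.

Lemma irr_unitary_class n (t : 'M[A]_n) : (0 < n)%N ->
    corep t -> unitary_corep t -> irreducible_corep t ->
  exists alpha, corep_equiv t (tmx rep alpha).
Proof.
case: n t => // n t _ ct ut it.
have ht : `[< irr_unitary (existT (fun n => 'M[A]_n.+1) n t) >] by apply/asboolP.
pose x : irr A := exist (fun x => `[< irr_unitary x >]) _ ht.
by exists (irr_class x); have /irr_classP/corep_equiv_sym := repK (irr_class x).
Qed.

(** If B implements the equivalence, then its adjoint times B commutes with the
  irreducible s, hence is a positive scalar c, and the adjoint of B divided by the
  square root of c is the unitary intertwiner. *)
Lemma unitary_equiv n m (s : 'M[A]_n) (t : 'M[A]_m) :
    (0 < n)%N -> corep s -> unitary_corep s -> irreducible_corep s ->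
    corep t -> unitary_corep t -> corep_equiv s t ->
  exists2 T : 'M[C]_(n, m), s *m scal T = scal T *m t & T *m T^t* = 1%:M.
Proof.
move=> n0 cs us is_ ct ut [B [B' [BB' B'B e]]].
have e' : scal (B^t*) *m t = s *m scal (B^t*) by exact: intertwiner_adj (esym e).
have [c cE] : exists c : C, B^t* *m B = c%:M.
  apply: (schur_scalar n0 is_).
  by rewrite !scal_mxM -mulmxA e mulmxA e' mulmxA.
have c0 : 0 < c.
  have cj : c = (B^t* *m B) (Ordinal n0) (Ordinal n0) by rewrite cE mxE eqxx.
  rewrite lt_def cj adj_mul_ge0 andbT -cj; apply/eqP => c0.
  move: cE; rewrite c0 => cE; have B0 : B = 0.
    by apply: adj_mul_eq0 => j; rewrite cE !mxE mul0rn.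
  move/matrixP: B'B => /(_ (Ordinal n0) (Ordinal n0)); rewrite B0 mulmx0 !mxE eqxx => /eqP.
  by rewrite eq_sym oner_eq0.
exists ((sqrtC c)^-1 *: B^t*).
  apply/matrixP => i j; move/matrixP: e' => /(_ i j).
  rewrite !mul_scalE !scal_mulE => e'.
  transitivity ((sqrtC c)^-1 *: \sum_l B^t* l j *: s i l).
    by rewrite scaler_sumr; apply: eq_bigr => l _; rewrite scalerA !mxE.
  by rewrite -e' scaler_sumr; apply: eq_bigr => l _; rewrite scalerA !mxE.
rewrite adjZ trmxCK -scalemxAl -scalemxAr scalerA cE scale_scalar_mx.
rewrite (CrealP _) ?realV ?ger0_real ?sqrtC_ge0 ?ltW//.
by rewrite -invfM -expr2 sqrtCK mulVf// gt_eqF.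
Qed.

(** The matrices T embed the irreducible summands: isometries onto orthogonal subspaces
  whose projections add up to 1. *)
Definition decomposes N (w : 'M[A]_N) (l : seq {alpha : hat A & 'M[C]_(N, hdim rep alpha)}) :=
  [/\ forall x, x \in l -> w *m scal (tagged x) = scal (tagged x) *m tmx rep (tag x) &
      \sum_(x <- l) tagged x *m (tagged x)^t* = 1%:M].

(** The invariant subspace is the range of the adjoint of V, spanned by the first m
  columns of the matrix that makes w block triangular. It is given through V because
  Gram-Schmidt orthonormalization works on rows. *)
Lemma reducible_invariant_subspace N (w : 'M[A]_N) :
    ~ irreducible_corep w ->
  exists V : 'M[C]_N, (0 < \rank V < N)%N /\
    exists K : 'M[A]_N, w *m scal (V^t*) = scal (V^t*) *m K.
Proof.
move=> /contrapT[s [B [B' [BB' B'B e]]] [m mN s0]].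
exists ((B *m pid_mx m)^t*); split.
  rewrite adjM mxrankMfree; last first.
    by rewrite row_free_unit map_unitmx unitmx_tr; case: (mulmx1_unit BB').
  rewrite mxrank_map mxrank_tr; rewrite rank_pid_mx//; case/andP: mN => _; exact: ltnW.
exists (s *m scal (pid_mx m)); rewrite trmxCK.
pose p : 'M[C]_N := pid_mx m.
have pE i j : p i j = ((i == j) && (i < m)%N)%:R by rewrite mxE -val_eqE.
have sp : s *m scal p = scal p *m (s *m scal p).
  apply/matrixP => i j; rewrite scal_mulE; have [im|mi] := ltnP i m.
    rewrite (bigD1 i)//= pE eqxx im scale1r big1 ?addr0// => k ki.
    by rewrite pE eq_sym (negbTE ki) scale0r.
  rewrite [RHS]big1 => [|k _]; last by rewrite pE [(i < m)%N]ltnNge mi andbF scale0r.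
  rewrite mul_scalE big1// => k _; rewrite pE; case: (ltnP k m) => km; last first.
    by rewrite andbF scale0r.
  by rewrite s0 ?km// scaler0.
by rewrite -/p !(scal_mxM A B) mulmxA -e -!mulmxA -sp.
Qed.

(** The columns of X and X' are orthonormal bases of the range of the adjoint of V and
  of its orthogonal complement, both obtained by Gram-Schmidt; the factors K and K'
  express that X and the adjoint of V have the same range. *)
Lemma complementary_isometries N (V : 'M[C]_N) :
  exists r' (X : 'M[C]_(N, \rank V)) (X' : 'M[C]_(N, r'))
    (K : 'M[C]_(N, \rank V)) (K' : 'M[C]_(\rank V, N)),
  [/\ (\rank V + r' = N)%N, X = V^t* *m K, V^t* = X *m K' & 
     [/\ X^t* *m X = 1%:M, X'^t* *m X' = 1%:M,
     X^t* *m X' = 0 & X *m X^t* + X' *m X'^t* = 1%:M]].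
Proof.
set Q := schmidt (row_base V).
have uQ : Q \is unitarymx by apply: schmidt_unitarymx; exact: rank_leq_col.
have QV : (Q :=: V)%MS.
  by apply: eqmx_trans (eq_row_base V); apply: eqmx_schmidt_free; exact: row_base_free.
set Q' := schmidt (row_base (kermx (Q^t*))).
have uQ' : Q' \is unitarymx by apply: schmidt_unitarymx; exact: rank_leq_col.
have Q'Q : Q' *m Q^t* = 0.
  apply/sub_kermxP.
  have -> : (Q' :=: kermx (Q^t*))%MS; last exact: submx_refl.
  by apply: eqmx_trans (eq_row_base _); apply: eqmx_schmidt_free; exact: row_base_free.
have QQ' : Q *m Q'^t* = 0.
  by rewrite -[LHS]trmxCK adjM trmxCK Q'Q trmx0 map_mx0.
have rk : (\rank V + \rank (kermx (Q^t*)) = N)%N.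
  rewrite mxrank_ker mxrank_map mxrank_tr QV subnKC//; exact: rank_leq_col.
have /submxP[K QK] : (Q <= V)%MS by rewrite QV.
have /submxP[K' VK] : (V <= Q)%MS by rewrite QV.
exists _, (Q^t*), (Q'^t*), (K^t*), (K'^t*); split=> //.
- by rewrite {1}QK adjM.
- by rewrite {1}VK adjM.
rewrite !trmxCK !(unitarymxP _)//; split=> //.
set E := _ + _.
pose Z := col_mx Q Q'.
have uZ : Z \is unitarymx.
  apply/unitarymxP; rewrite tr_col_mx map_row_mx mul_col_row.
  by rewrite !(unitarymxP _)// QQ' Q'Q -scalar_mx_block.
have /row_fullP[Y YZ] : row_full Z by rewrite /row_full mxrank_unitary// rk.
have ZE : Z *m E = Z.
  rewrite /Z mul_col_mx !mulmxDr !mulmxA QQ' Q'Q !(unitarymxP _)//.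
  by rewrite !mul0mx !mul1mx addr0 add0r.
by rewrite -[E]mul1mx -YZ -mulmxA ZE.
Qed.

(** Induction on the dimension. If w has a proper invariant subspace, then the
  orthogonal complement is invariant as well, because adjoints of intertwiners are
  intertwiners, and both restrictions are unitary. *)
Lemma unitary_decomposition N (w : 'M[A]_N) : corep w -> unitary_corep w ->
  exists l, decomposes w l.
Proof.
have [n] := ubnP N; elim: n N w => // n IH N w; rewrite ltnS => Nn cw uw.
have [N0|N0] := posnP N.
  exists [::]; split=> //; apply/matrixP => i.
  by exfalso; case: i => i; rewrite N0.
have [iw|/reducible_invariant_subspace[V [/andP[V0 VN] [K VK]]]] := pselect (irreducible_corep w).
  have [alpha walpha] := irr_unitary_class N0 cw uw iw.
  have [T wT TT] := unitary_equiv N0 cw uw iw (@tmx_corep alpha) (@tmx_unitary alpha) walpha.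
  exists [:: Tagged (fun alpha => 'M[C]_(N, hdim rep alpha)) T]; split.
    by move=> x; rewrite inE => /eqP ->.
  by rewrite big_seq1.
have [r' [X [X' [H [H' [rk XV VX [XX X'X' XX' X1]]]]]]] := complementary_isometries V.
have wX : w *m scal X = scal X *m (scal H' *m K *m scal H).
  by rewrite {1}XV scal_mxM mulmxA VK {1}VX scal_mxM !mulmxA.
have [cs us] := unitary_restrict cw uw XX wX.
have wX' : w *m scal X' = scal X' *m (scal (X'^t*) *m w *m scal X').
  have Xw := intertwiner_adj cw uw cs us wX.
  rewrite -[LHS]mul1mx -(scal_mx1 A) -X1 scal_mxD mulmxDl !scal_mxM.
  rewrite -[X in X + _]mulmxA [scal (X^t*) *m _]mulmxA Xw -!mulmxA -scal_mxM XX'.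
  by rewrite scal_mx0 !mulmx0 add0r.
have [cs' us'] := unitary_restrict cw uw X'X' wX'.
have [|l [lw l1]] := IH _ _ _ cs us; first by apply: leq_trans VN _.
have [|l' [lw' l1']] := IH _ _ _ cs' us'.
  by apply: leq_trans Nn; move: (\rank V) V0 rk => r r0 <-; rewrite -addn1 addnC leq_add2r.
pose lift m (X : 'M[C]_(N, m)) (x : {alpha : hat A & 'M[C]_(m, hdim rep alpha)}) :=
  Tagged (fun alpha => 'M[C]_(N, hdim rep alpha)) (X *m tagged x).
exists ([seq lift _ X x | x <- l] ++ [seq lift _ X' x | x <- l']); split.
  move=> x; rewrite mem_cat => /orP[] /mapP[y yl ->] /=.
  - by rewrite scal_mxM mulmxA wX -mulmxA lw// mulmxA.
  - by rewrite scal_mxM mulmxA wX' -mulmxA lw'// mulmxA.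
rewrite big_cat !big_map/=.
under eq_bigr do rewrite adjM mulmxA -(mulmxA X).
under [X in _ + X]eq_bigr do rewrite adjM mulmxA -(mulmxA X').
by rewrite -!mulmx_suml -!mulmx_sumr l1 l1' !mulmx1.
Qed.

End Decomposition.

(** * Formal combinations of matrix elements *)

Section FormalSums.
Variables (R : realType) (A : hopf_star_alg R).
Local Notation C := R[i].
Variables (I : eqType) (n_ : I -> nat) (t : forall i, 'M[A]_(n_ i)).

(** The nesting makes the tag of an entry its row, the index of [independent_rows]. *)
Definition entry : Type :=
  {x : {i : I & 'I_(n_ i)} & 'I_(n_ (tag x))}.
HB.instance Definition _ := Equality.on entry.

Definition mkentry i (j k : 'I_(n_ i)) : entry :=
  Tagged (fun x : {i : I & 'I_(n_ i)} => 'I_(n_ (tag x)))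
    (k : 'I_(n_ (tag (Tagged (fun i => 'I_(n_ i)) j)))).

Definition entry_val (x : entry) : A := t (tag (tag x)) (tagged (tag x)) (tagged x).

Definition lincomb (p : seq (C * entry)) : A := \sum_(q <- p) q.1 *: entry_val q.2.

(** Collects a formal combination row by row, merging the repeated entries. *)
Lemma regroup_entries (W : lmodType C) (F : entry -> W) (p : seq (C * entry)) :
  \sum_(q <- p) q.1 *: F q.2 =
  \sum_(y <- undup [seq tag q.2 | q <- p]) \sum_(j < n_ (tag y))
    (\sum_(q <- p | q.2 == Tagged (fun y : {i : I & 'I_(n_ i)} => 'I_(n_ (tag y))) j) q.1) *:
      F (Tagged (fun y : {i : I & 'I_(n_ i)} => 'I_(n_ (tag y))) j).
Proof.
set l := undup _.
transitivity (\sum_(y <- l) \sum_(j < n_ (tag y)) \sum_(q <- p)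
   if q.2 == Tagged (fun y : {i : I & 'I_(n_ i)} => 'I_(n_ (tag y))) j
   then q.1 *: F q.2 else 0); last first.
  apply: eq_bigr => y _; apply: eq_bigr => j _; rewrite scaler_suml [RHS]big_mkcond/=.
  by apply: eq_bigr => q _; case: eqP => // ->.
under [RHS]eq_bigr do rewrite exchange_big/=.
rewrite [RHS]exchange_big/= big_seq [RHS]big_seq; apply: eq_bigr => q qp.
have tl : tag q.2 \in l by rewrite mem_undup; apply/mapP; exists q.
rewrite [RHS](bigD1_seq (tag q.2)) ?undup_uniq//= (bigD1 (tagged q.2))//=.
rewrite taggedK eqxx big1 ?addr0 => [|j jq]; last first.
  by case: eqP => // /eqP; rewrite -{1}(taggedK q.2) eq_Tagged/= eq_sym (negbTE jq).
rewrite big1 ?addr0// => y yq; apply: big1 => j _.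
by case: eqP => // e; move: yq; rewrite e eqxx.
Qed.

Hypothesis t_corep : forall i, corep (t i).
Hypothesis t_irr : forall i, irreducible_corep (t i).
Hypothesis n_gt0 : forall i, (0 < n_ i)%N.
Hypothesis t_inequiv : forall i j, i != j -> ~ corep_equiv (t i) (t j).

(** Linear independence in the form that is needed to define functionals: extending F
  linearly to formal combinations is compatible with their evaluation in A. *)
Lemma independent_entries (p : seq (C * entry)) (F : entry -> C) :
  lincomb p = 0 -> \sum_(q <- p) q.1 * F q.2 = 0.
Proof.
rewrite /lincomb regroup_entries => p0.
rewrite (@regroup_entries C^o F p).
set l := undup _ in p0 *.
pose X y : 'cV[C]_(n_ (tag y)) := \col_j
  \sum_(q <- p | q.2 == Tagged (fun y : {i : I & 'I_(n_ i)} => 'I_(n_ (tag y))) j) q.1.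
have X0 : forall y, y \in l -> X y = 0.
  apply: (independent_rows t_corep t_irr n_gt0 t_inequiv (undup_uniq _)).
  rewrite -[RHS]p0; apply: eq_bigr => y _; apply: eq_bigr => j _.
  by rewrite mxE.
rewrite big_seq big1// => y yl; apply: big1 => j _.
by have /colP/(_ j) := X0 y yl; rewrite !mxE => ->; rewrite scale0r.
Qed.

End FormalSums.

(** * Functionals prescribed on the matrix elements *)

Section Basis.
Variables (R : realType) (A : hopf_star_alg R).
Local Notation C := R[i].
Local Notation scal := (scal_mx A).
Hypothesis hA : is_CQG A.
Variables (rep : hat A -> irr A).
Hypothesis repK : forall alpha, irr_class (rep alpha) = alpha.
Local Notation t := (tmx rep).

Local Notation entry := (entry (hdim rep)).

Lemma tmx_inequiv alpha beta : alpha != beta -> ~ corep_equiv (t alpha) (t beta).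
Proof. by move=> /eqP ab /(tmx_inj repK). Qed.

Lemma entries_independent (p : seq (C * entry)) (F : entry -> C) :
  lincomb t p = 0 -> \sum_(q <- p) q.1 * F q.2 = 0.
Proof.
apply: independent_entries => //; [exact: tmx_corep | exact: tmx_irr | exact: tmx_inequiv].
Qed.

Definition scale_terms (c : C) (p : seq (C * entry)) := [seq (c * q.1, q.2) | q <- p].

Lemma lincombP c p q : lincomb t (scale_terms c p ++ q) = c *: lincomb t p + lincomb t q.
Proof.
rewrite /lincomb big_cat big_map/= scaler_sumr; congr (_ + _).
by apply: eq_bigr => r _; rewrite scalerA.
Qed.

(** Insert 1 as the sum of the projections and move w past each embedding. *)
Lemma decomposes_sum N (w : 'M[A]_N) l : decomposes (rep := rep) w l ->
  w = \sum_(x <- l) scal (tagged x) *m t (tag x) *m scal ((tagged x)^t*).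
Proof.
move=> [wT T1]; rewrite -[LHS]mulmx1 -(scal_mx1 A) -T1.
rewrite /scal_mx raddf_sum/= mulmx_sumr big_seq [RHS]big_seq.
by apply: eq_bigr => x xl; rewrite map_mxM/= mulmxA wT.
Qed.

(** In a CQG algebra the entries of unitary corepresentations span, and each of these
  corepresentations decomposes into the t^alpha. *)
Lemma entries_span a : exists p, lincomb t p = a.
Proof.
have span0 : exists p, lincomb t p = 0 by exists [::]; rewrite /lincomb big_nil.
have spanP c x y : (exists p, lincomb t p = x) -> (exists p, lincomb t p = y) ->
    exists p, lincomb t p = c *: x + y.
  by move=> [p <-] [q <-]; exists (scale_terms c p ++ q); rewrite lincombP.
have span_sum I (r : seq I) (c : I -> C) F : (forall i, exists p, lincomb t p = F i) ->
    exists p, lincomb t p = \sum_(i <- r) c i *: F i.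
  move=> FE; elim: r => [|i r IH]; first by rewrite big_nil.
  by rewrite big_cons; exact: spanP.
have spant alpha i j : exists p, lincomb t p = t alpha i j.
  exists [:: (1, mkentry (n_ := hdim rep) i j)].
  by rewrite /lincomb big_seq1 scale1r.
have spanw N (w : 'M[A]_N) i j : corep w -> unitary_corep w -> exists p, lincomb t p = w i j.
  move=> cw uw; have [l /decomposes_sum ->] := unitary_decomposition repK cw uw.
  rewrite summxE; elim: l => [|x l IH]; first by rewrite big_nil.
  rewrite big_cons -[X in X + _]scale1r; apply: spanP => //.
  rewrite mul_scalE; apply: (@span_sum) => k.
  by rewrite scal_mulE; exact: span_sum.
have [l lP ->] := hA a; elim: l lP => [|x l IH] lP; first by rewrite big_nil.
rewrite big_cons; apply: spanP.
  by have [n [w [i [j [cw uw ->]]]]] := lP x (mem_head _ _); exact: spanw.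
by apply: IH => y yl; apply: lP; rewrite inE yl orbT.
Qed.

(** The value at a is computed from any expression of a by matrix elements; independence
  makes the choice irrelevant. *)
Lemma functional_on_entries (F : forall alpha, 'M[C]_(hdim rep alpha)) :
  exists f : {scalar A}, forall alpha, map_mx f (t alpha) = F alpha.
Proof.
pose G (x : entry) := F _ (tagged (tag x)) (tagged x).
pose f a := \sum_(q <- projT1 (cid (entries_span a))) q.1 * G q.2.
have fE a p : lincomb t p = a -> f a = \sum_(q <- p) q.1 * G q.2.
  move=> pa; rewrite /f; case: cid => q /= qa; apply/eqP; rewrite -subr_eq0.
  have := @entries_independent (scale_terms (-1) p ++ q) G.
  rewrite lincombP pa qa scaleN1r addNr big_cat big_map => /(_ erefl) /= e.
  rewrite addrC -sumrN -[X in _ == X]e; apply/eqP; congr (_ + _).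
  by apply: eq_bigr => r _; rewrite mulN1r mulNr.
have flin : scalar f.
  move=> c a b; have [p pa] := entries_span a; have [q qb] := entries_span b.
  rewrite (fE _ _ pa) (fE _ _ qb) (fE _ (scale_terms c p ++ q)) ?lincombP ?pa ?qb//.
  rewrite big_cat big_map /= mulr_sumr; congr (_ + _).
  by apply: eq_bigr => r _; rewrite mulrA.
exists (HB.pack f (GRing.isLinear.Build C A C _ f flin) : {scalar A}) => alpha.
apply/matrixP => i j; rewrite mxE /= (fE _ [:: (1, mkentry (n_ := hdim rep) i j)]).
  by rewrite big_seq1 mul1r.
by rewrite /lincomb big_seq1 scale1r.
Qed.

Lemma functional_ext (f g : {scalar A}) :
  (forall alpha, map_mx f (t alpha) = map_mx g (t alpha)) -> forall a, f a = g a.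
Proof.
move=> fg a; have [p <-] := entries_span a; rewrite /lincomb !linear_sum/=.
apply: eq_bigr => q _; rewrite !scalarZ; congr (_ * _).
have /matrixP/(_ (tagged (tag q.2)) (tagged q.2)) := fg (tag (tag q.2)).
by rewrite !mxE.
Qed.

End Basis.

(** * Positive definite matrices *)

Section PositiveDefinite.
Variable C : numClosedFieldType.

Definition posdef n (F : 'M[C]_n) : Prop :=
  F^t* = F /\ forall v : 'cV[C]_n, v != 0 -> 0 < (v^t* *m F *m v) 0 0.

Lemma posdef_gram m n (G : 'M[C]_(m, n)) (G' : 'M[C]_(n, m)) :
  G' *m G = 1%:M -> posdef (G^t* *m G).
Proof.
move=> G'G; split=> [|v v0]; first by rewrite adjM trmxCK.
have -> : v^t* *m (G^t* *m G) *m v = (G *m v)^t* *m (G *m v) by rewrite adjM !mulmxA.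
rewrite lt_def adj_mul_ge0 andbT.
apply: contraNneq v0 => Gv; rewrite -[v]mul1mx -G'G -mulmxA (_ : G *m v = 0) ?mulmx0//.
by apply: adj_mul_eq0 => j; rewrite ord1.
Qed.

Lemma posdef_conj m n (F : 'M[C]_m) (X : 'M[C]_(m, n)) (X' : 'M[C]_(n, m)) :
  X' *m X = 1%:M -> posdef F -> posdef (X^t* *m F *m X).
Proof.
move=> X'X [Fh Fp]; split=> [|v v0].
  by rewrite !adjM Fh trmxCK mulmxA.
have -> : v^t* *m (X^t* *m F *m X) *m v = (X *m v)^t* *m F *m (X *m v).
  by rewrite adjM !mulmxA.
apply: Fp; apply: contraNneq v0 => Xv.
by rewrite -[v]mul1mx -X'X -mulmxA Xv mulmx0.
Qed.

Lemma posdefZ n (F : 'M[C]_n) c : 0 < c -> posdef F -> posdef (c *: F).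
Proof.
move=> c0 [Fh Fp]; split=> [|v v0]; first by rewrite adjZ Fh (CrealP _) ?gtr0_real.
by rewrite -scalemxAr -scalemxAl mxE mulr_gt0 ?Fp.
Qed.

Lemma posdef_unit n (F : 'M[C]_n) : posdef F -> F \in unitmx.
Proof.
move=> [Fh Fp]; rewrite -unitmx_tr -row_free_unit -kermx_eq0; apply/rowV0P => u.
move=> /sub_kermxP uF; apply/eqP; apply: contraT => u0.
have : u^T != 0 by rewrite trmx_eq0.
have Fu : F *m u^T = 0 by rewrite -[LHS]trmxK trmx_mul trmxK uF trmx0.
by move=> /Fp; rewrite -mulmxA Fu mulmx0 mxE ltxx.
Qed.

(** The trace is the sum of the values of F at the columns of X. *)
Lemma posdef_trace_conj n m (F : 'M[C]_n) (X : 'M[C]_(n, m)) :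
  posdef F -> 0 <= \tr (X^t* *m F *m X) ?= iff (X == 0).
Proof.
move=> [Fh Fp]; have colE j : (X^t* *m F *m X) j j = ((col j X)^t* *m F *m col j X) 0 0.
  rewrite !mxE; apply: eq_bigr => k _; rewrite !mxE; congr (_ * _).
  by apply: eq_bigr => l _; rewrite !mxE.
have ge0 j : 0 <= (X^t* *m F *m X) j j.
  rewrite colE; have [->|/Fp/ltW//] := eqVneq (col j X) 0.
  by rewrite mulmx0 mxE.
split; first by rewrite sumr_ge0.
apply/eqP/eqP => [|->]; last by rewrite mulmx0 mxtrace0.
move=> /esym/eqP; rewrite psumr_eq0// => /allP h.
apply/matrixP => i j; rewrite [RHS]mxE.
have := h j (mem_index_enum _); rewrite colE.
have [/colP/(_ i) + _|/Fp/gt_eqF->//] := eqVneq (col j X) 0.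
by rewrite !mxE.
Qed.

Lemma posdef_trace_gt0 n (F : 'M[C]_n) : (0 < n)%N -> posdef F -> 0 < \tr F.
Proof.
move=> n0 pF; have := posdef_trace_conj (1%:M) pF; rewrite adj1 mul1mx mulmx1 => h.
rewrite lt_neqAle h.1 andbT h.2; apply/eqP => /matrixP/(_ (Ordinal n0) (Ordinal n0)).
by rewrite !mxE eqxx => /eqP; rewrite oner_eq0.
Qed.

Lemma posdef_diag_gt0 n (F : 'M[C]_n) i : posdef F -> 0 < F i i.
Proof.
move=> [_ Fp]; have : delta_mx i 0 != 0 :> 'cV[C]_n.
  by apply/eqP => /matrixP/(_ i 0); rewrite !mxE !eqxx => /eqP; rewrite oner_eq0.
move=> /Fp; congr (_ < _); rewrite -mulmxA -colE mxE (bigD1 i)//= !mxE !eqxx/=.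
by rewrite rmorph1 mul1r big1 ?addr0// => k ki; rewrite !mxE (negbTE ki) rmorph0 mul0r.
Qed.

Lemma posdef_inv n (F : 'M[C]_n) : posdef F -> posdef (invmx F).
Proof.
move=> pF; have uF := posdef_unit pF; have [Fh _] := pF.
have iFh : (invmx F)^t* = invmx F.
  by rewrite trmx_inv map_invmx Fh.
have -> : invmx F = (invmx F)^t* *m F *m invmx F by rewrite iFh mulVmx ?mul1mx.
by apply: (posdef_conj (X' := F)) => //; rewrite mulmxV.
Qed.

(** For Z = X - Y one has X Z + Z Y = 0, so tr(Z X Z) and tr(Z Y Z) are nonnegative with
  sum 0; hence Z = 0. *)
Lemma posdef_sqrt_uniq n (X Y : 'M[C]_n) :
  posdef X -> posdef Y -> X *m X = Y *m Y -> X = Y.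
Proof.
move=> pX pY XY; apply/eqP; rewrite -subr_eq0; set Z := X - Y.
have Zh : Z^t* = Z by rewrite adjB pX.1 pY.1.
have XZY : X *m Z + Z *m Y = 0.
  by rewrite mulmxBr mulmxBl addrA subrK XY subrr.
have [tX eX] := posdef_trace_conj Z pX.
have [tY eY] := posdef_trace_conj Z pY.
rewrite -eX eq_sym; have : \tr (Z^t* *m X *m Z) + \tr (Z^t* *m Y *m Z) = 0.
  rewrite Zh -(mulmxA Z X) [X in _ + X]mxtrace_mulC -mxtraceD -mulmxDr XZY.
  by rewrite mulmx0 mxtrace0.
by move=> /eqP; rewrite (paddr_eq0 tX tY) => /andP[tX0 _]; exact: tX0.
Qed.

(** The eigenvalues d of F are positive, so any two functions h, g that are a square
  root and its inverse on positive numbers give a positive square root of F and its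
  inverse. *)
Lemma posdef_spectral_calculus n (F U : 'M[C]_n) (d : 'rV[C]_n) (h g : C -> C) :
    U \in unitmx -> invmx U = U^t* -> F = invmx U *m diag_mx d *m U -> posdef F ->
    (forall x, 0 < x -> [/\ 0 < h x, h x * h x = x & g x * h x = 1]) ->
  let H := invmx U *m diag_mx (map_mx h d) *m U in
  let G := invmx U *m diag_mx (map_mx g d) *m U in
  [/\ posdef H, H *m H = F & G *m H = 1%:M].
Proof.
move=> uU VU FE [Fh Fp] hP H G.
have d0 i : 0 < d 0 i.
  have : (U^t* *m delta_mx i 0) != 0 :> 'cV[C]_n.
    apply/eqP => /(congr1 (mulmx U)); rewrite mulmxA -VU (mulmxV uU) mul1mx mulmx0.
    by move=> /matrixP/(_ i 0); rewrite !mxE !eqxx => /eqP; rewrite oner_eq0.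
  move=> /Fp; have -> : (U^t* *m delta_mx i 0)^t* *m F *m (U^t* *m delta_mx i (0 : 'I_1))
      = (delta_mx i 0 : 'cV[C]_n)^t* *m diag_mx d *m delta_mx i 0.
    rewrite adjM trmxCK [in LHS]FE -VU !mulmxA (mulmxK uU) -(mulmxA _ U (invmx U)).
    by rewrite (mulmxV uU) mulmx1.
  rewrite -mulmxA -colE mxE (bigD1 i)//= big1 => [|k ki].
    by rewrite !mxE !eqxx/= rmorph1 mul1r addr0.
  by rewrite !mxE (negbTE ki) rmorph0 mul0r.
have powM (h1 h2 : C -> C) :
    invmx U *m diag_mx (map_mx h1 d) *m U *m (invmx U *m diag_mx (map_mx h2 d) *m U) =
    invmx U *m diag_mx (\row_i (h1 (d 0 i) * h2 (d 0 i))) *m U.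
  rewrite !mulmxA (mulmxK uU) -(mulmxA _ (diag_mx _) (diag_mx _)) mulmx_diag.
  congr (_ *m diag_mx _ *m _); apply/rowP => i; by rewrite !mxE.
split.
- rewrite /H VU.
  set D := diag_mx _; have : posdef D.
    split=> [|v v0].
      apply/matrixP => i j; rewrite !mxE eq_sym; have [->|_] := eqVneq i j.
        by rewrite !mulr1n (CrealP _)// gtr0_real//; case: (hP _ (d0 j)).
      by rewrite !mulr0n rmorph0.
    have [i vi] : exists i, v i 0 != 0.
      apply: contrapT => nv; move/eqP: v0; apply; apply/colP => i; rewrite mxE.
      by apply/eqP/negP => /negP vi; apply: nv; exists i.
    rewrite -mulmxA mul_diag_mx mxE (bigD1 i)//= ltr_wpDr//.
      apply: sumr_ge0 => k _; rewrite !mxE mulrCA mulr_ge0//.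
        by apply/ltW; case: (hP _ (d0 k)).
      by rewrite mulrC mul_conjC_ge0.
    rewrite !mxE mulrCA mulr_gt0//; first by case: (hP _ (d0 i)).
    by rewrite mulrC mul_conjC_gt0.
  by apply: (posdef_conj (X' := U^t*)); rewrite -VU mulVmx.
- rewrite /H powM FE; congr (_ *m diag_mx _ *m _); apply/rowP => i.
  by rewrite mxE; case: (hP _ (d0 i)).
- rewrite /G /H powM (_ : \row_i _ = const_mx 1) ?diag_const_mx ?mulmx1 ?mulVmx//.
  by apply/rowP => i; rewrite !mxE; case: (hP _ (d0 i)).
Qed.

End PositiveDefinite.

(** * Half powers of positive definite matrices *)

Section Powers.
Variable R : realType.
Local Notation C := R[i].

Lemma cpow_half (x : C) : 0 < x ->
  [/\ 0 < cpow x 2^-1, cpow x 2^-1 * cpow x 2^-1 = x &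
      cpow x (- 2^-1) * cpow x 2^-1 = 1].
Proof.
move=> x0.
have half : (2^-1 : C) = (2^-1 : R)%:C by rewrite fmorphV rmorphD rmorph1.
have [r r0 ->] : exists2 r : R, 0 < r & x = r%:C.
  by case: x x0 => a b; rewrite ltcE/= => /andP[/eqP -> a0]; exists a.
have cpowE (s : R) : cpow r%:C s%:C = (expR (s * ln r))%:C.
  by rewrite /cpow/= mul0r cos0 sin0 mulr1 mulr0.
have hh : 2^-1 + 2^-1 = 1 :> R by rewrite [RHS]splitr !div1r.
rewrite half -rmorphN !cpowE -!rmorphM -!expRD -!mulrDl hh mul1r addNr mul0r expR0 lnK//.
by split=> //; rewrite ltcR expR_gt0.
Qed.

Lemma posdef_mxpow n (F : 'M[C]_n) : posdef F ->
  [/\ posdef (mxpow F 2^-1), mxpow F 2^-1 *m mxpow F 2^-1 = F &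
      mxpow F (- 2^-1) *m mxpow F 2^-1 = 1%:M].
Proof.
move=> pF; have Fn : F \is normalmx by apply/normalmxP; rewrite pF.1.
apply: (posdef_spectral_calculus (h := fun x => cpow x 2^-1) (g := fun x => cpow x (- 2^-1))).
- exact: spectral_unit.
- exact/invmx_unitary/spectral_unitarymx.
- exact: orthomx_spectralP Fn.
- exact: pF.
- exact: cpow_half.
Qed.

End Powers.

(** * Conjugate corepresentations *)

Section Conjugates.
Variables (R : realType) (A : hopf_star_alg R).
Local Notation C := R[i].
Local Notation S := (antipode A).
Local Notation scal := (scal_mx A).

(** Star commutes with the coproduct but reverses products in A, so the entrywise
  adjoint of a corepresentation is a corepresentation, in general not a unitary one. *)
Definition conj_corep n (t : 'M[A]_n) : 'M[A]_n := map_mx (@star R A) t.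

Lemma conj_corep_corep n (t : 'M[A]_n) : corep t -> corep (conj_corep t).
Proof.
move=> ct i j; rewrite mxE; split; last first.
  by rewrite counit_star (ct i j).2 rmorph_nat.
rewrite coprod_star /tmap tlift_coprod//.
  by apply: eq_bigr => l _; rewrite !mxE.
split=> [v x y|u x y|c x y]; rewrite ?starD ?pureDl ?pureDr//.
by rewrite !starZ pureZ pureZr.
Qed.

Lemma conj_corepK n (t : 'M[A]_n) : conj_corep (conj_corep t) = t.
Proof. by apply/matrixP => i j; rewrite !mxE starK. Qed.

Lemma conj_scal_mul m n p (B : 'M[C]_(m, n)) (X : 'M[A]_(n, p)) :
  map_mx (@star R A) (scal B *m X) = scal (mxconj B) *m map_mx (@star R A) X.
Proof.
apply/matrixP => i j; rewrite mxE !scal_mulE star_sum.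
by apply: eq_bigr => l _; rewrite starZ !mxE.
Qed.

Lemma conj_mul_scal m n p (X : 'M[A]_(m, n)) (B : 'M[C]_(n, p)) :
  map_mx (@star R A) (X *m scal B) = map_mx (@star R A) X *m scal (mxconj B).
Proof.
apply/matrixP => i j; rewrite mxE !mul_scalE star_sum.
by apply: eq_bigr => l _; rewrite starZ !mxE.
Qed.

Lemma tr_scal_mul m n p (B : 'M[C]_(m, n)) (X : 'M[A]_(n, p)) :
  (scal B *m X)^T = X^T *m scal (B^T).
Proof.
apply/matrixP => i j; rewrite mxE mul_scalE scal_mulE.
by apply: eq_bigr => l _; rewrite !mxE.
Qed.

Lemma tr_mul_scal m n p (X : 'M[A]_(m, n)) (B : 'M[C]_(n, p)) :
  (X *m scal B)^T = scal (B^T) *m X^T.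
Proof.
apply/matrixP => i j; rewrite mxE mul_scalE scal_mulE.
by apply: eq_bigr => l _; rewrite !mxE.
Qed.

Lemma corep_equiv_conj n m (s : 'M[A]_n) (t : 'M[A]_m) :
  corep_equiv s t -> corep_equiv (conj_corep s) (conj_corep t).
Proof.
case=> B [B' [BB' B'B e]]; exists (mxconj B), (mxconj B').
rewrite -!map_mxM BB' B'B !map_mx1; split=> //.
by rewrite -conj_scal_mul e conj_mul_scal.
Qed.

Lemma conj_corep_irr n (t : 'M[A]_n) :
  irreducible_corep t -> irreducible_corep (conj_corep t).
Proof.
move=> it [s st [m mn s0]]; apply: it; exists (conj_corep s).
  by rewrite -[t]conj_corepK; exact: corep_equiv_conj.
by exists m => // i j ij; rewrite mxE s0// star0.
Qed.

Definition antipode2 n (t : 'M[A]_n) : 'M[A]_n := map_mx (fun a => S (S a)) t.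

Lemma antipode2E n (t : 'M[A]_n) : antipode2 t = map_mx S (map_mx S t).
Proof. by apply/matrixP => i j; rewrite !mxE. Qed.

Lemma antipode2_unitary n (t : 'M[A]_n) : unitary_corep t ->
  antipode2 t = (map_mx S (conj_corep t))^T.
Proof.
move=> ut; apply/matrixP => i j; rewrite !mxE ut//.
Qed.

End Conjugates.

(** * The modular matrices *)

Section Modular.
Variables (R : realType) (A : hopf_star_alg R).
Local Notation C := R[i].
Local Notation S := (antipode A).
Local Notation scal := (scal_mx A).
Hypothesis hA : is_CQG A.
Variables (rep : hat A -> irr A).
Hypothesis repK : forall alpha, irr_class (rep alpha) = alpha.
Local Notation t := (tmx rep).

(** The t^alpha exhaust the irreducible corepresentations, unitary or not: adding an
  inequivalent s to the system would keep the matrix elements independent, although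
  those of the t^alpha already span. The index [None] stands for s. *)
Lemma irreducible_equiv_tmx n (s : 'M[A]_n.+1) : corep s -> irreducible_corep s ->
  exists alpha, corep_equiv s (t alpha).
Proof.
move=> cs is_; apply: contrapT => nst.
pose n_ (o : option (hat A)) := if o is Some a then hdim rep a else n.+1.
pose u (o : option (hat A)) : 'M[A]_(n_ o) :=
  match o return 'M[A]_(n_ o) with Some a => t a | None => s end.
have cu o : corep (u o) by case: o => [a|] //; exact: tmx_corep.
have iu o : irreducible_corep (u o) by case: o => [a|] //; exact: tmx_irr.
have nu o : (0 < n_ o)%N by case: o.
have neq o o' : o != o' -> ~ corep_equiv (u o) (u o').
  case: o o' => [a|] [b|]//= ab.
  - by apply: (tmx_inequiv repK); apply: contraNneq ab => ->.
  - by move=> /corep_equiv_sym h; apply: nst; exists a.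
  - by move=> h; apply: nst; exists b.
have [p pE] := entries_span hA repK (s ord0 ord0).
pose q : seq (C * entry n_) := (1, @mkentry _ n_ None ord0 ord0) ::
  [seq (- x.1, @mkentry _ n_ (Some (tag (tag x.2))) (tagged (tag x.2)) (tagged x.2)) | x <- p].
(* F does not annihilate the relation q between an entry of s and the t^alpha, contrary
  to independence. *)
pose F (x : entry n_) : C := if tag (tag x) is None then 1 else 0.
have q0 : lincomb u q = 0.
  rewrite /lincomb big_cons big_map scale1r /entry_val/= -pE /lincomb -big_split/= big1// => x _.
  by rewrite scaleNr subrr.
have := independent_entries cu iu nu neq F q0; rewrite big_cons big_map big1 => [|x _].
  by rewrite addr0 mulr1 => /eqP; rewrite oner_eq0.
exact: mulr0.
Qed.

(** Transposing B conj(s) = u B and using unitarity of s gives S(s) B^T = B^T u^T;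
  applying S and using unitarity of u gives S^2(s) B^T = B^T conj(u); and the entrywise
  adjoint of the hypothesis is conj(B) s = conj(u) conj(B). *)
Lemma gram_modular n (s : 'M[A]_n) m (u : 'M[A]_m) (B : 'M[C]_(m, n)) :
    unitary_corep s -> unitary_corep u ->
    scal B *m conj_corep s = u *m scal B ->
  scal (B^T *m mxconj B) *m s = antipode2 s *m scal (B^T *m mxconj B).
Proof.
move=> us uu e.
have e1 : map_mx S s *m scal (B^T) = scal (B^T) *m u^T.
  have := congr1 trmx e; rewrite tr_scal_mul tr_mul_scal => <-.
  by congr (_ *m _); apply/matrixP => i j; rewrite !mxE us.
have e2 : antipode2 s *m scal (B^T) = scal (B^T) *m conj_corep u.
  rewrite antipode2E -map_antipode_mul_scal e1 map_antipode_scal_mul.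
  by congr (_ *m _); apply/matrixP => i j; rewrite !mxE uu.
have e3 : scal (mxconj B) *m s = conj_corep u *m scal (mxconj B).
  have := congr1 (map_mx (@star R A)) e.
  by rewrite conj_scal_mul conj_mul_scal -/(conj_corep _) conj_corepK.
by rewrite scal_mxM -mulmxA e3 mulmxA -e2 -mulmxA.
Qed.

(** The conjugate of t^alpha is irreducible, hence equivalent to some t^beta; if B
  implements the equivalence, then B^T conj(B) is a positive definite intertwiner from
  t^alpha to S^2(t^alpha) by [gram_modular]. A positive multiple of it has the required
  trace. *)
Lemma modular_exists alpha : exists2 F, is_modular (t alpha) F & posdef F.
Proof.
have [beta [B [B' [BB' B'B e]]]] := irreducible_equiv_tmx
  (conj_corep_corep (@tmx_corep _ _ rep alpha)) (conj_corep_irr (@tmx_irr _ _ rep alpha)).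
pose F := B^T *m mxconj B.
have pF : posdef F.
  have -> : F = (mxconj B)^t* *m (mxconj B).
    by congr (_ *m _); apply/matrixP => i j; rewrite !mxE conjCK.
  by apply: (posdef_gram (G' := mxconj B')); rewrite -map_mxM B'B map_mx1.
have FE : scal F *m t alpha = antipode2 (t alpha) *m scal F.
  by apply: gram_modular e; exact: tmx_unitary.
have n0 : (0 < hdim rep alpha)%N by [].
have tF := posdef_trace_gt0 n0 pF; have tF' := posdef_trace_gt0 n0 (posdef_inv pF).
(* The scaling that balances the traces of c F and of its inverse. *)
pose c := sqrtC (\tr (invmx F) / \tr F).
have c0 : 0 < c by rewrite sqrtC_gt0 divr_gt0.
have c2 : c * c * \tr F = \tr (invmx F).
  by rewrite -expr2 sqrtCK divfK// gt_eqF.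
exists (c *: F); last exact: posdefZ.
have uF := posdef_unit pF; have cu : c \is a GRing.unit by rewrite unitfE gt_eqF.
split.
- by rewrite unitmxZ.
- apply/matrixP => i j; rewrite scal_mulE mul_scalE.
  transitivity (c *: (scal F *m t alpha) i j).
    by rewrite scal_mulE scaler_sumr; apply: eq_bigr => l _; rewrite mxE scalerA.
  rewrite FE mul_scalE scaler_sumr; apply: eq_bigr => l _; rewrite scalerA.
  by congr (_ *: _); rewrite [RHS]mxE.
- rewrite invmxZ ?unitmxZ// !linearZ/= -c2 !mulrA mulVf ?mul1r// gt_eqF//.
- by rewrite linearZ/= mulr_gt0.
Qed.

(** Two candidates differ by a scalar c by Schur's lemma; the signs of the traces give c
  > 0, and the balance of the traces gives c = c^-1. *)
Lemma modular_uniq alpha F G : is_modular (t alpha) F -> is_modular (t alpha) G -> F = G.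
Proof.
move=> [uF tF trF F0] [uG tG trG G0].
have [c cE] : exists c : C, invmx F *m G = c%:M.
  apply: (schur_scalar (t := t alpha)) => //; first exact: tmx_irr.
  rewrite scal_mxM -mulmxA tG.
  have -> : map_mx (fun a => S (S a)) (t alpha) = scal F *m t alpha *m scal (invmx F).
    by rewrite tF -mulmxA -scal_mxM (mulmxV uF) scal_mx1 mulmx1.
  by rewrite !mulmxA -scal_mxM (mulVmx uF) scal_mx1 mul1mx -mulmxA -scal_mxM.
have GE : G = c *: F.
  by rewrite -mul_mx_scalar -cE mulmxA (mulmxV uF) mul1mx.
have c0 : 0 < c by move: G0; rewrite GE linearZ/= pmulr_lgt0.
suff c1 : c = 1 by rewrite GE c1 scale1r.
have uG' : c *: F \in unitmx by rewrite -GE.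
move: trG; rewrite GE (invmxZ uG') !linearZ/= -trF => e.
have cV : c = c^-1 by exact: (mulIf (lt0r_neq0 F0) e).
have : c ^+ 2 = 1 by rewrite expr2 {1}cV mulVf// gt_eqF.
by move=> /eqP; rewrite sqrp_eq1 ?ltW// => /eqP.
Qed.

Definition modular_mx alpha := modular (t alpha).

Lemma modular_mxP alpha : is_modular (t alpha) (modular_mx alpha).
Proof.
have [F mF _] := modular_exists alpha.
by rewrite /modular_mx /modular; apply: (xgetPex 0); exists F.
Qed.

Lemma modular_mx_posdef alpha : posdef (modular_mx alpha).
Proof.
by have [F mF pF] := modular_exists alpha; rewrite (modular_uniq (modular_mxP alpha) mF).
Qed.

End Modular.

(** * Positive definite matrices with balanced traces *)

Section PosdefTrace.
Variable C : numClosedFieldType.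

(** Put X = P^-1 D. It is hermitian because it belongs to the algebra E, whose elements
  commute with P; so is X' = X^-1 = D^-1 P. The trace conditions for D at Z = X - X' and
  for P at X' Z, together with D^-1 = X' P^-1, give tr(P X Z) = tr(P X' Z), that is tr(Z
  P Z) = 0. Hence Z = 0, so X^2 = 1 and D^2 = P^2. *)
Lemma posdef_trace_uniq n (E : 'M[C]_n -> Prop) (P D : 'M[C]_n) :
    posdef P -> posdef D ->
    (forall X Y, E X -> E Y -> E (X *m Y)) -> (forall X Y, E X -> E Y -> E (X - Y)) ->
    E (invmx P *m D) -> E (invmx D *m P) ->
    (forall X, E X -> P *m X = X *m P) ->
    (forall X, E X -> \tr (P *m X) = \tr (invmx P *m X)) ->
    (forall X, E X -> \tr (D *m X) = \tr (invmx D *m X)) ->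
  P = D.
Proof.
move=> pP pD EM EB; set X := invmx P *m D; set X' := invmx D *m P => EX EX' PE trP trD.
have uP := posdef_unit pP; have uD := posdef_unit pD.
have DE : D = P *m X by rewrite mulmxA (mulmxV uP) mul1mx.
have DE' : D = X *m P by rewrite -(PE _ EX).
have XX' : X *m X' = 1%:M by rewrite mulmxA -(mulmxA _ D) (mulmxV uD) mulmx1 (mulVmx uP).
have X'X : X' *m X = 1%:M by rewrite mulmxA -(mulmxA _ P) (mulmxV uP) mulmx1 (mulVmx uD).
have Xh : X^t* = X.
  have iPh := (posdef_inv pP).1.
  by rewrite adjM iPh pD.1 [in LHS]DE' -mulmxA (mulmxV uP) mulmx1.
have X'h : X'^t* = X'.
  have X'X1 : X'^t* *m X = 1%:M by rewrite -[X in _ *m X]Xh -adjM XX' adj1.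
  by rewrite -[LHS]mulmx1 -XX' mulmxA X'X1 mul1mx.
pose Z := X - X'.
have EZ : E Z by exact: EB.
have Zh : Z^t* = Z by rewrite adjB Xh X'h.
have iDE : invmx D = X' *m invmx P by rewrite -mulmxA (mulmxV uP) mulmx1.
have ZX' : X' *m Z = Z *m X' by rewrite mulmxBr mulmxBl X'X XX'.
have trE : \tr (P *m X *m Z) = \tr (P *m X' *m Z).
  rewrite -DE trD// iDE -(mulmxA X') mxtrace_mulC -(mulmxA (invmx P)).
  by rewrite -trP; [rewrite -ZX' mulmxA | exact: EM].
have tr0 : \tr (Z^t* *m P *m Z) = 0.
  have PZZ : P *m Z *m Z = P *m X *m Z - P *m X' *m Z by rewrite -mulmxBl -mulmxBr.
  by rewrite Zh -(PE _ EZ) PZZ raddfB/= trE subrr.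
have [_] := posdef_trace_conj Z pP; rewrite eq_sym tr0 eqxx => /esym; rewrite subr_eq0 => /eqP XE.
apply: posdef_sqrt_uniq => //.
have XX : X *m X = 1%:M by rewrite [X in _ *m X]XE.
by rewrite [X in _ = X *m _]DE DE' mulmxA -(mulmxA P X) XX mulmx1.
Qed.

End PosdefTrace.

(** * Tensor products of corepresentations *)

Section Tensor.
Variables (R : realType) (A : hopf_star_alg R).
Local Notation C := R[i].
Local Notation S := (antipode A).
Local Notation scal := (scal_mx A).

Lemma sum_tidx (V : nmodType) m n (F : 'I_(m * n) -> V) :
  \sum_k F k = \sum_i \sum_j F (tidx (i, j)).
Proof.
rewrite pair_big/= (reindex (@mxtens.mxtens_index m n)); first by apply: eq_bigr => -[].
by exists (@mxtens.mxtens_unindex m n) => i _;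
   rewrite (mxtens.mxtens_indexK, mxtens.mxtens_unindexK).
Qed.

Lemma tidx_matrixP (V : Type) m n p q (X Y : 'M[V]_(m * n, p * q)) :
  (forall i k j l, X (tidx (i, k)) (tidx (j, l)) = Y (tidx (i, k)) (tidx (j, l))) -> X = Y.
Proof.
move=> h; apply/matrixP => i j.
by case: (mxtens.mxtens_indexP i) => ? ?; case: (mxtens.mxtens_indexP j) => ? ?.
Qed.

Lemma tidx_eq m n (i j : 'I_m) (k l : 'I_n) :
  (tidx (i, k) == tidx (j, l)) = (i == j) && (k == l).
Proof. by rewrite (can_eq (@mxtens.mxtens_indexK m n)). Qed.

Lemma tens1 (V : pzRingType) m n : (1%:M : 'M[V]_m) *t (1%:M : 'M[V]_n) = 1%:M.
Proof.
apply: tidx_matrixP => i k j l; rewrite mxtens.tensmxE !mxE tidx_eq.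
by case: (i == j); case: (k == l); rewrite ?mulr0 ?mul0r ?mulr1.
Qed.

Lemma tens_scal_mul m n p q r s (X : 'M[C]_(m, n)) (Y : 'M[C]_(p, q))
    (t : 'M[A]_(n, r)) (u : 'M[A]_(q, s)) :
  scal (X *t Y) *m (t *t u) = (scal X *m t) *t (scal Y *m u).
Proof.
apply: tidx_matrixP => i k j l.
rewrite scal_mulE mxtens.tensmxE !scal_mulE sum_tidx mulr_suml.
apply: eq_bigr => a _; rewrite mulr_sumr; apply: eq_bigr => b _.
by rewrite !mxtens.tensmxE -scalerAl -scalerAr scalerA.
Qed.

Lemma tens_mul_scal m n p q r s (X : 'M[C]_(n, r)) (Y : 'M[C]_(q, s))
    (t : 'M[A]_(m, n)) (u : 'M[A]_(p, q)) :
  (t *t u) *m scal (X *t Y) = (t *m scal X) *t (u *m scal Y).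
Proof.
apply: tidx_matrixP => i k j l.
rewrite mul_scalE mxtens.tensmxE !mul_scalE sum_tidx mulr_suml.
apply: eq_bigr => a _; rewrite mulr_sumr; apply: eq_bigr => b _.
by rewrite !mxtens.tensmxE -scalerAl -scalerAr scalerA.
Qed.

Lemma tens_adj m n p q (X : 'M[C]_(m, n)) (Y : 'M[C]_(p, q)) :
  (X *t Y)^t* = X^t* *t Y^t*.
Proof. by apply: tidx_matrixP => i k j l; rewrite !mxE !mxtens.mxtens_indexK rmorphM. Qed.

Variables (m n : nat) (t : 'M[A]_m) (u : 'M[A]_n).
Hypotheses (ct : corep t) (cu : corep u) (ut : unitary_corep t) (uu : unitary_corep u).
Local Notation w := (t *t u).

Lemma balanced_tmulr (a b : A) : balanced (fun c d : A => (a * c) ⊗ (b * d)).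
Proof.
split=> [v x y|v x y|k x y]; rewrite ?mulrDr ?pureDl ?pureDr//.
by rewrite -!scalerAr pureZ pureZr.
Qed.

Lemma balanced_tmull (z : (A ⊗ A)%type) :
  balanced (fun a b : A => tlift (fun c d => (a * c) ⊗ (b * d)) z).
Proof.
split=> [v x y|v x y|k x y]; rewrite /tlift /fsum_eval -?big_split/=.
- by apply: eq_bigr => p _; rewrite mulrDl pureDl.
- by apply: eq_bigr => p _; rewrite mulrDl pureDr.
- by apply: eq_bigr => p _; rewrite -!scalerAl pureZ pureZr.
Qed.

Lemma tens_corep : corep w.
Proof.
move=> a b; case: (mxtens.mxtens_indexP a) => i k; case: (mxtens.mxtens_indexP b) => j l.
rewrite mxtens.tensmxE; split; last first.
  by rewrite counitM (ct i j).2 (cu k l).2 tidx_eq -natrM mulnb.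
rewrite coprodM (ct i j).1 (cu k l).1 /tmul tlift_sum_pure; last exact: balanced_tmull.
rewrite sum_tidx; apply: eq_bigr => p _.
rewrite tlift_sum_pure; last exact: balanced_tmulr.
by apply: eq_bigr => q _; rewrite !mxtens.tensmxE.
Qed.

Lemma conj_tensE i k j l :
  conj_corep w (tidx (i, k)) (tidx (j, l)) = conj_corep u k l * conj_corep t i j.
Proof. by rewrite mxE mxtens.tensmxE starM !mxE. Qed.

(** The sum over the inner factor is done first: star reverses the order of the factors. *)
Lemma tens_unitary : unitary_corep w.
Proof.
apply: unitary_of_starmul; first exact: tens_corep.
apply: tidx_matrixP => i k j l; rewrite mxE sum_tidx.
transitivity (\sum_q \sum_p star (u q k) * (star (t p i) * t p j) * u q l).
  rewrite exchange_big/=; apply: eq_bigr => q _; apply: eq_bigr => p _.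
  by rewrite mxE !mxtens.tensmxE starM !mulrA.
have tE : \sum_p star (t p i) * t p j = (i == j)%:R.
  have /matrixP/(_ i j) := unitary_starmul ct ut; rewrite !mxE => <-.
  by apply: eq_bigr => p _; rewrite mxE.
have uE : \sum_q star (u q k) * u q l = (k == l)%:R.
  have /matrixP/(_ k l) := unitary_starmul cu uu; rewrite !mxE => <-.
  by apply: eq_bigr => p _; rewrite mxE.
under eq_bigr do rewrite -mulr_suml -mulr_sumr tE.
rewrite mxE tidx_eq; case: (i == j) => /=.
  by under eq_bigr do rewrite mulr1; rewrite uE.
by rewrite big1// => q _; rewrite mulr0 mul0r.
Qed.

(** The antipode reverses products, hence its square preserves them. For the entries of
  a tensor product the first half follows from the uniqueness of inverse matrices: both
  S of the conjugate of w and the tensor product Z of the S of the conjugates invert the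
  conjugate of w. *)
Lemma antipode2_tens : antipode2 w = antipode2 t *t antipode2 u.
Proof.
have cw := conj_corep_corep tens_corep.
have cct := conj_corep_corep ct; have ccu := conj_corep_corep cu.
pose Z := map_mx S (conj_corep t) *t map_mx S (conj_corep u).
have wZ : conj_corep w *m Z = 1%:M.
  apply: tidx_matrixP => i k j l; rewrite mxE sum_tidx.
  transitivity (\sum_q \sum_p conj_corep u k q *
      (conj_corep t i p * S (conj_corep t p j)) * S (conj_corep u q l)).
    rewrite exchange_big/=; apply: eq_bigr => q _; apply: eq_bigr => p _.
    rewrite conj_tensE mxtens.tensmxE !mulrA; congr (_ * _); rewrite mxE //.
    by congr (_ * _); rewrite mxE.
  have tE : \sum_p conj_corep t i p * S (conj_corep t p j) = (i == j)%:R.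
    have /matrixP/(_ i j) := corep_antipoder cct; rewrite !mxE => <-.
    by apply: eq_bigr => p _; rewrite !mxE.
  have uE : \sum_q conj_corep u k q * S (conj_corep u q l) = (k == l)%:R.
    have /matrixP/(_ k l) := corep_antipoder ccu; rewrite !mxE => <-.
    by apply: eq_bigr => p _; rewrite !mxE.
  under eq_bigr do rewrite -mulr_suml -mulr_sumr tE.
  rewrite mxE tidx_eq; case: (i == j) => /=.
    by under eq_bigr do rewrite mulr1; rewrite uE.
  by rewrite big1// => q _; rewrite mulr0 mul0r.
have SZ : map_mx S (conj_corep w) = Z.
  by rewrite -[LHS]mulmx1 -wZ mulmxA (corep_antipodel cw) mul1mx.
rewrite (antipode2_unitary tens_unitary) SZ (antipode2_unitary ut) (antipode2_unitary uu).
by rewrite mxtens.trmx_tens.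
Qed.

(** In the sum of the v_rq S(v_pr) the factors are in the wrong order for the antipode
  axiom. Since G v = S^2(v) G, the twist by G replaces the v_rq by combinations of the
  S^2(v_rs), and the sum over r of S^2(v_rs) S(v_pr) is the antipode axiom for the
  conjugate corepresentation. *)
Lemma twisted_antipode (k : nat) (v : 'M[A]_k) (G : 'M[C]_k) p q :
    corep v -> unitary_corep v -> scal G *m v = antipode2 v *m scal G ->
  \sum_r (scal G *m v) r q * S (v p r) = (G p q)%:A.
Proof.
move=> cv uv Gv; have ccv := conj_corep_corep cv.
under eq_bigr => r _ do rewrite Gv uv mul_scalE mulr_suml.
rewrite exchange_big/= (bigD1 p)//= [X in _ + X]big1 ?addr0 => [|s sp].
- under eq_bigr => r _ do rewrite -scalerAl.
  rewrite -scaler_sumr; congr (_ *: _).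
  have /matrixP/(_ p p) := corep_antipodel ccv; rewrite !mxE eqxx => e.
  apply: etrans _ e.
  by apply: eq_bigr => r _; rewrite (antipode2_unitary uv) !mxE.
- under eq_bigr => r _ do rewrite -scalerAl.
  rewrite -scaler_sumr; have /matrixP/(_ s p) := corep_antipodel ccv.
  rewrite !mxE (negbTE sp) => e; apply: (etrans (y := G s q *: 0)); last exact: scaler0.
  congr (_ *: _); apply: etrans _ e.
  by apply: eq_bigr => r _; rewrite (antipode2_unitary uv) !mxE.
Qed.

End Tensor.

(** * Twisted partial traces *)

Section PartialTraces.
Variables (R : realType) (A : hopf_star_alg R).
Local Notation C := R[i].
Local Notation S := (antipode A).
Local Notation scal := (scal_mx A).

(** The mirror image of [twisted_antipode], for a twist in the opposite direction. *)
Lemma twisted_antipode_inv (k : nat) (v : 'M[A]_k) (G : 'M[C]_k) p q :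
    corep v -> unitary_corep v -> v *m scal G = scal G *m antipode2 v ->
  \sum_r S (v r q) * (v *m scal G) p r = (G p q)%:A.
Proof.
move=> cv uv Gv; have ccv := conj_corep_corep cv.
under eq_bigr => r _ do rewrite Gv uv scal_mulE mulr_sumr.
rewrite exchange_big/= (bigD1 q)//= [X in _ + X]big1 ?addr0 => [|s sq].
- under eq_bigr => r _ do rewrite -scalerAr.
  rewrite -scaler_sumr; congr (_ *: _).
  have /matrixP/(_ q q) := corep_antipoder ccv; rewrite !mxE eqxx => e.
  apply: etrans _ e.
  by apply: eq_bigr => r _; rewrite (antipode2_unitary uv) !mxE.
- under eq_bigr => r _ do rewrite -scalerAr.
  rewrite -scaler_sumr; have /matrixP/(_ q s) := corep_antipoder ccv.
  rewrite !mxE eq_sym (negbTE sq) => e; apply: (etrans (y := G p s *: 0)); last exact: scaler0.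
  congr (_ *: _); apply: etrans _ e.
  by apply: eq_bigr => r _; rewrite (antipode2_unitary uv) !mxE.
Qed.

Variables (m n : nat) (t : 'M[A]_m) (u : 'M[A]_n).
Hypotheses (ct : corep t) (cu : corep u) (ut : unitary_corep t) (uu : unitary_corep u).
Local Notation w := (t *t u).
Variables (X : 'M[C]_(m * n)).
Hypothesis Xw : scal X *m w = w *m scal X.

Lemma tens_intertwinerE i k j l :
  \sum_p \sum_q X (tidx (i, k)) (tidx (p, q)) *: (t p j * u q l) =
  \sum_p \sum_q X (tidx (p, q)) (tidx (j, l)) *: (t i p * u k q).
Proof.
have /matrixP/(_ (tidx (i, k)) (tidx (j, l))) := Xw.
rewrite scal_mulE mul_scalE !sum_tidx.
under eq_bigr do under eq_bigr do rewrite mxtens.tensmxE.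
by under [X in _ = X -> _]eq_bigr do under eq_bigr do rewrite mxtens.tensmxE.
Qed.

(** The trace over the second factor, weighted by G. *)
Definition ptrace2 (G : 'M[C]_n) : 'M[C]_m :=
  \matrix_(i, j) \sum_k \sum_l G l k * X (tidx (i, k)) (tidx (j, l)).

(** The trace over the first factor, weighted by H. *)
Definition ptrace1 (H : 'M[C]_m) : 'M[C]_n :=
  \matrix_(k, l) \sum_i \sum_j H j i * X (tidx (i, k)) (tidx (j, l)).

(** In the entries of X w = w X, multiplication by S(u) on the right isolates t on the
  left-hand side; on the right-hand side the weighted sum over the second factor turns u
  and S(u) into the scalar matrix G by [twisted_antipode]. *)
Lemma ptrace2_intertwiner G : scal G *m u = antipode2 u *m scal G ->
  scal (ptrace2 G) *m t = t *m scal (ptrace2 G).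
Proof.
move=> Gu; apply/matrixP => i j; rewrite scal_mulE mul_scalE.
(* The entries of X w = w X multiplied by S(u) on the right and summed. *)
have step k q : \sum_p X (tidx (i, k)) (tidx (p, q)) *: t p j =
    \sum_l (\sum_p \sum_r X (tidx (p, r)) (tidx (j, l)) *: (t i p * u k r)) * S (u l q).
  under [RHS]eq_bigr do rewrite -tens_intertwinerE mulr_suml.
  rewrite [RHS]exchange_big/=; apply: eq_bigr => p _.
  under [RHS]eq_bigr do rewrite mulr_suml.
  rewrite [RHS]exchange_big/= (bigD1 q)//= [X in _ + X]big1 ?addr0 => [|r rq].
  - under [RHS]eq_bigr do rewrite -scalerAl -mulrA.
    rewrite -scaler_sumr -mulr_sumr; congr (_ *: _).
    have /matrixP/(_ q q) := corep_antipoder cu; rewrite !mxE eqxx => e.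
    rewrite -[LHS]mulr1; congr (_ * _); apply/esym; apply: etrans _ e.
    by apply: eq_bigr => l _; rewrite mxE.
  - under eq_bigr do rewrite -scalerAl -mulrA.
    rewrite -scaler_sumr -mulr_sumr.
    have /matrixP/(_ r q) := corep_antipoder cu; rewrite !mxE (negbTE rq) => e.
    rewrite (_ : \sum_(l < n) u r l * S (u l q) = 0) ?mulr0 ?scaler0//.
    by apply: etrans _ e; apply: eq_bigr => l _; rewrite mxE.
transitivity (\sum_k \sum_q G q k *: \sum_p X (tidx (i, k)) (tidx (p, q)) *: t p j).
  under eq_bigr do rewrite mxE scaler_suml.
  rewrite exchange_big/=; apply: eq_bigr => k _.
  under eq_bigr do rewrite scaler_suml.
  rewrite exchange_big/=; apply: eq_bigr => q _; rewrite scaler_sumr.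
  by apply: eq_bigr => p _; rewrite scalerA.
transitivity (\sum_p \sum_r \sum_l X (tidx (p, r)) (tidx (j, l)) *:
    (t i p * \sum_q (scal G *m u) q r * S (u l q))); last first.
  apply: eq_bigr => p _; rewrite mxE scaler_suml; apply: eq_bigr => r _.
  rewrite scaler_suml; apply: eq_bigr => l _.
  by rewrite (twisted_antipode _ _ cu uu Gu) mulr_algr scalerA mulrC.
transitivity (\sum_k \sum_q \sum_l \sum_p \sum_r
    X (tidx (p, r)) (tidx (j, l)) *: (t i p * (G q k *: u k r * S (u l q)))).
  apply: eq_bigr => k _; apply: eq_bigr => q _; rewrite step scaler_sumr.
  apply: eq_bigr => l _; rewrite mulr_suml scaler_sumr; apply: eq_bigr => p _.
  rewrite mulr_suml scaler_sumr; apply: eq_bigr => r _.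
  by rewrite -!scalerAl -!scalerAr scalerA mulrC -scalerA mulrA.
(* The remaining steps bring the summations into the same order and collect the sum over
  q. *)
under eq_bigr do under eq_bigr do rewrite exchange_big/=.
under eq_bigr do rewrite exchange_big/=.
rewrite exchange_big/=; apply: eq_bigr => p _.
under eq_bigr do under eq_bigr do rewrite exchange_big/=.
under eq_bigr do rewrite exchange_big/=.
rewrite exchange_big/=; apply: eq_bigr => r _.
under eq_bigr do rewrite exchange_big/=.
rewrite exchange_big/=; apply: eq_bigr => l _.
rewrite exchange_big/= mulr_sumr scaler_sumr; apply: eq_bigr => q _.
by rewrite scal_mulE mulr_suml mulr_sumr scaler_sumr.
Qed.

(** As for [ptrace2_intertwiner], multiplying by S(t) on the left. *)
Lemma ptrace1_intertwiner H : t *m scal H = scal H *m antipode2 t ->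
  scal (ptrace1 H) *m u = u *m scal (ptrace1 H).
Proof.
move=> Ht; apply/matrixP => k l; rewrite scal_mulE mul_scalE.
(* The entries of X w = w X multiplied by S(t) on the left and summed. *)
have step i j : \sum_q X (tidx (i, q)) (tidx (j, l)) *: u k q =
    \sum_r S (t i r) * (\sum_p \sum_q X (tidx (r, k)) (tidx (p, q)) *: (t p j * u q l)).
  under [RHS]eq_bigr do rewrite tens_intertwinerE mulr_sumr.
  rewrite [RHS]exchange_big/= (bigD1 i)//= [X in _ + X]big1 ?addr0 => [|p pi].
  - under [RHS]eq_bigr do rewrite mulr_sumr.
    rewrite [RHS]exchange_big/=; apply: eq_bigr => q _.
    under [RHS]eq_bigr do rewrite -scalerAr mulrA.
    rewrite -scaler_sumr -mulr_suml; congr (_ *: _).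
    have /matrixP/(_ i i) := corep_antipodel ct; rewrite !mxE eqxx => e.
    rewrite -[LHS]mul1r; congr (_ * _); apply/esym; apply: etrans _ e.
    by apply: eq_bigr => r _; rewrite mxE.
  - under eq_bigr do rewrite mulr_sumr.
    rewrite exchange_big/=; apply: big1 => q _.
    under eq_bigr do rewrite -scalerAr mulrA.
    rewrite -scaler_sumr -mulr_suml.
    have /matrixP/(_ i p) := corep_antipodel ct; rewrite !mxE eq_sym (negbTE pi) => e.
    rewrite (_ : \sum_(r < m) S (t i r) * t r p = 0) ?mul0r ?scaler0//.
    by apply: etrans _ e; apply: eq_bigr => r _; rewrite mxE.
apply/esym.
transitivity (\sum_i \sum_j H j i *: \sum_q X (tidx (i, q)) (tidx (j, l)) *: u k q).
  under eq_bigr do rewrite mxE scaler_suml.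
  rewrite exchange_big/=; apply: eq_bigr => i _.
  under eq_bigr do rewrite scaler_suml.
  rewrite exchange_big/=; apply: eq_bigr => j _; rewrite scaler_sumr.
  by apply: eq_bigr => q _; rewrite scalerA.
transitivity (\sum_q \sum_r \sum_p X (tidx (r, k)) (tidx (p, q)) *:
    ((\sum_i S (t i r) * (t *m scal H) p i) * u q l)); last first.
  apply: eq_bigr => q _; rewrite mxE scaler_suml; apply: eq_bigr => r _.
  rewrite scaler_suml; apply: eq_bigr => p _.
  by rewrite (twisted_antipode_inv _ _ ct ut Ht) mulr_algl scalerA mulrC.
transitivity (\sum_i \sum_j \sum_r \sum_p \sum_q
    X (tidx (r, k)) (tidx (p, q)) *: ((S (t i r) * (H j i *: t p j)) * u q l)).
  apply: eq_bigr => i _; apply: eq_bigr => j _; rewrite step scaler_sumr.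
  apply: eq_bigr => r _; rewrite mulr_sumr scaler_sumr; apply: eq_bigr => p _.
  rewrite mulr_sumr scaler_sumr; apply: eq_bigr => q _.
  by rewrite -!scalerAr -!scalerAl scalerA mulrC -scalerA mulrA.
(* The remaining steps bring the summations into the same order and collect the sum over
  i. *)
under eq_bigr do under eq_bigr do under eq_bigr do rewrite exchange_big/=.
under eq_bigr do under eq_bigr do rewrite exchange_big/=.
under eq_bigr do rewrite exchange_big/=.
rewrite exchange_big/=; apply: eq_bigr => q _.
under eq_bigr do rewrite exchange_big/=.
rewrite exchange_big/=; apply: eq_bigr => r _.
under eq_bigr do rewrite exchange_big/=.
rewrite exchange_big/=; apply: eq_bigr => p _.
rewrite mulr_suml scaler_sumr; apply: eq_bigr => i _.
by rewrite mul_scalE mulr_sumr mulr_suml scaler_sumr.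
Qed.

End PartialTraces.

(** * Multiplicativity of the half powers of the modular matrices *)

Section Characters.
Variables (R : realType) (A : hopf_star_alg R).
Local Notation C := R[i].
Local Notation S := (antipode A).
Local Notation scal := (scal_mx A).
Hypothesis hA : is_CQG A.
Variables (rep : hat A -> irr A).
Hypothesis repK : forall alpha, irr_class (rep alpha) = alpha.
Local Notation t := (tmx rep).
Local Notation F := (modular_mx rep).

Lemma scal_mx_sum m n I (r : seq I) (B : I -> 'M[C]_(m, n)) :
  scal (\sum_(i <- r) B i) = \sum_(i <- r) scal (B i).
Proof. by apply: big_morph; [exact: scal_mxD|exact: scal_mx0]. Qed.

(** Every intertwiner between two of the t^alpha is zero or scalar. *)
Lemma tmx_natural (a : forall alpha, 'M[C]_(hdim rep alpha)) alpha beta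
    (M : 'M[C]_(hdim rep alpha, hdim rep beta)) :
  t alpha *m scal M = scal M *m t beta -> a alpha *m M = M *m a beta.
Proof.
move=> tM; have [M0|/(tmx_inj repK) ab] :=
    schur (@tmx_irr _ _ rep beta) (@tmx_irr _ _ rep alpha) (esym tM).
  by rewrite M0 mulmx0 mul0mx.
move: M tM; rewrite ab => M tM.
have [c ->] := schur_scalar (ltn0Sn _) (@tmx_irr _ _ rep alpha) (esym tM).
by rewrite mul_scalar_mx mul_mx_scalar.
Qed.

Section Decomposed.
Variables (N : nat) (w : 'M[A]_N) (l : seq {alpha : hat A & 'M[C]_(N, hdim rep alpha)}).
Hypotheses (cw : corep w) (uw : unitary_corep w) (wl : decomposes w l).

(** The endomorphism that acts as a_gamma on every copy of t^gamma contained in w. By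
  [tmx_natural] it commutes with all intertwiners, so it depends only on w and a. *)
Definition spread (a : forall alpha, 'M[C]_(hdim rep alpha)) : 'M[C]_N :=
  \sum_(x <- l) tagged x *m a (tag x) *m (tagged x)^t*.

Lemma spread_intertwiner a beta (M : 'M[C]_(N, hdim rep beta)) :
  w *m scal M = scal M *m t beta -> spread a *m M = M *m a beta.
Proof.
move=> wM; case: wl => wT T1; rewrite mulmx_suml -[RHS]mul1mx -T1 mulmx_suml.
rewrite big_seq [RHS]big_seq; apply: eq_bigr => x xl.
have Tw := intertwiner_adj cw uw (@tmx_corep _ _ rep (tag x)) (@tmx_unitary _ _ rep (tag x))
  (wT x xl).
have nat_ : a (tag x) *m ((tagged x)^t* *m M) = ((tagged x)^t* *m M) *m a beta.
  by apply: tmx_natural; rewrite scal_mxM mulmxA -Tw -!mulmxA wM.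
by rewrite -!mulmxA nat_ !mulmxA.
Qed.

Lemma spread_tagged a x : x \in l -> spread a *m tagged x = tagged x *m a (tag x).
Proof. by move=> xl; apply: spread_intertwiner; apply: wl.1. Qed.

Lemma spread_comm a (X : 'M[C]_N) : w *m scal X = scal X *m w ->
  spread a *m X = X *m spread a.
Proof.
move=> wX; case: (wl) => wT T1; rewrite -[LHS]mulmx1 -T1 mulmx_sumr mulmx_sumr.
rewrite big_seq [RHS]big_seq; apply: eq_bigr => x xl.
rewrite mulmxA -(mulmxA _ X) spread_intertwiner ?mulmxA//.
by rewrite scal_mxM mulmxA wX -mulmxA wT// mulmxA.
Qed.

Lemma spreadM a b :
  spread a *m spread b = spread (fun alpha => a alpha *m b alpha).
Proof.
rewrite [X in _ *m X]/spread mulmx_sumr big_seq [RHS]big_seq.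
by apply: eq_bigr => x xl; rewrite !mulmxA spread_tagged.
Qed.

Lemma spread1 : spread (fun=> 1%:M) = 1%:M.
Proof. by rewrite -wl.2; apply: eq_bigr => x _; rewrite mulmx1. Qed.

(** The quadratic form at v is the sum of the forms of the a_gamma at the components of
  v, and a nonzero v has a nonzero component. *)
Lemma spread_posdef a : (forall alpha, posdef (a alpha)) -> posdef (spread a).
Proof.
move=> pa; split=> [|v v0].
  by rewrite adj_sum; apply: eq_bigr => x _; rewrite !adjM trmxCK (pa _).1 mulmxA.
have quadE (b : forall alpha, 'M[C]_(hdim rep alpha)) : v^t* *m spread b *m v =
    \sum_(x <- l) ((tagged x)^t* *m v)^t* *m b (tag x) *m ((tagged x)^t* *m v).
  rewrite mulmx_sumr mulmx_suml; apply: eq_bigr => x _.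
  by rewrite adjM trmxCK !mulmxA.
have qP alpha (u : 'cV[C]_(hdim rep alpha)) : 0 <= (u^t* *m a alpha *m u) 0 0 ?= iff (u == 0).
  have [->|u0] := eqVneq u 0; first by split; rewrite mulmx0 mxE ?eqxx.
  have := (pa alpha).2 u u0 => q0; split; [exact: ltW | by rewrite lt_eqF].
rewrite quadE summxE lt_def sumr_ge0 ?andbT => [|x _]; last exact: (qP _ _).1.
apply: contraNneq v0 => /eqP; rewrite psumr_eq0 => [/allP vx0|x _]; last exact: (qP _ _).1.
rewrite -[v]mul1mx -wl.2 mulmx_suml big_seq big1// => x xl.
have := vx0 x xl; rewrite eq_sym (qP _ _).2 => /eqP Tv.
by rewrite -mulmxA Tv mulmx0.
Qed.

(** Evaluate f in the expansion [decomposes_sum]. *)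
Lemma map_spread (f : {scalar A}) : map_mx f w = spread (fun alpha => map_mx f (t alpha)).
Proof.
apply/matrixP => i j; rewrite mxE {1}(decomposes_sum wl) !summxE linear_sum/=.
apply: eq_bigr => x _; rewrite -map_scal_mul -map_mul_scal.
by rewrite [RHS]mxE.
Qed.

Lemma spread_twist : scal (spread F) *m w = antipode2 w *m scal (spread F).
Proof.
have [wT T1] := wl.
have w''T x : x \in l -> antipode2 w *m scal (tagged x) = scal (tagged x) *m antipode2 (t (tag x)).
  move=> xl; have := congr1 (map_mx S \o map_mx S) (wT x xl); rewrite /= !antipode2E.
  by rewrite !map_antipode_mul_scal !map_antipode_scal_mul.
rewrite /spread !scal_mx_sum mulmx_suml mulmx_sumr big_seq [RHS]big_seq.
apply: eq_bigr => x xl; rewrite !scal_mxM.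
have Tw := intertwiner_adj cw uw (@tmx_corep _ _ rep (tag x)) (@tmx_unitary _ _ rep (tag x))
  (wT x xl).
have [_ FE _ _] := modular_mxP hA repK (tag x).
by rewrite -!mulmxA Tw [scal (F _) *m _]mulmxA FE [RHS]mulmxA w''T// !mulmxA.
Qed.

Lemma spread_inv a : (forall alpha, a alpha \in unitmx) ->
  invmx (spread a) = spread (fun alpha => invmx (a alpha)).
Proof.
move=> ua; have e : spread a *m spread (fun alpha => invmx (a alpha)) = 1%:M.
  rewrite spreadM -spread1; apply: eq_bigr => x _.
  by rewrite (mulmxV (ua _)).
have [us _] := mulmx1_unit e.
by rewrite -[LHS]mulmx1 -e mulmxA (mulVmx us) mul1mx.
Qed.

(** The compression of X to a copy of t^gamma is a scalar, so the identity reduces to tr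
  F_gamma = tr F_gamma^-1. *)
Lemma spread_trace X : w *m scal X = scal X *m w ->
  \tr (spread F *m X) = \tr (invmx (spread F) *m X).
Proof.
move=> wX; have [wT T1] := wl.
rewrite spread_inv => [|alpha]; last by case: (modular_mxP hA repK alpha).
have trsum a : \tr (spread a *m X) =
    \sum_(x <- l) \tr (tagged x *m a (tag x) *m (tagged x)^t* *m X).
  by rewrite /spread mulmx_suml (raddf_sum (@mxtrace C N)).
rewrite !trsum; apply: eq_big_seq => x xl.
have Tw := intertwiner_adj cw uw (@tmx_corep _ _ rep (tag x)) (@tmx_unitary _ _ rep (tag x))
  (wT x xl).
have [c cE] : exists c : C, (tagged x)^t* *m X *m tagged x = c%:M.
  apply: (schur_scalar (t := t (tag x))) => //; first exact: tmx_irr.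
  by rewrite !scal_mxM -[LHS]mulmxA -wT// !mulmxA -Tw -!(mulmxA (scal ((tagged x)^t*))) wX !mulmxA.
have trE b : \tr (tagged x *m b *m (tagged x)^t* *m X) = c * \tr b.
  by rewrite -!mulmxA mxtrace_mulC -mulmxA cE mul_mx_scalar linearZ/=.
by rewrite !trE; case: (modular_mxP hA repK (tag x)) => _ _ ->.
Qed.

(** This characterizes the modular matrix of a reducible w; [posdef_trace_uniq] is
  applied to the algebra E of matrices commuting with w. *)
Lemma spread_uniq D : posdef D -> scal D *m w = antipode2 w *m scal D ->
    (forall X, w *m scal X = scal X *m w -> \tr (D *m X) = \tr (invmx D *m X)) ->
  spread F = D.
Proof.
move=> pD Dw trD; have pP : posdef (spread F).
  by apply: spread_posdef => alpha; exact: modular_mx_posdef.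
have uP := posdef_unit pP; have uD := posdef_unit pD.
have comm P Q : P \in unitmx -> scal P *m w = antipode2 w *m scal P ->
    scal Q *m w = antipode2 w *m scal Q -> w *m scal (invmx P *m Q) = scal (invmx P *m Q) *m w.
  move=> uP' Pw Qw; rewrite !scal_mxM -[RHS]mulmxA Qw.
  have -> : antipode2 w = scal P *m w *m scal (invmx P).
    by rewrite Pw -mulmxA -scal_mxM (mulmxV uP') scal_mx1 mulmx1.
  by rewrite !mulmxA -[scal (invmx P) *m scal P]scal_mxM (mulVmx uP') scal_mx1 mul1mx.
apply: (@posdef_trace_uniq _ _ (fun X => w *m scal X = scal X *m w) _ _ pP pD).
- by move=> X Y wX wY; rewrite !scal_mxM mulmxA wX -mulmxA wY mulmxA.
- by move=> X Y wX wY; rewrite !scal_mxB mulmxBr mulmxBl wX wY.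
- by apply: comm; [exact: uP|exact: spread_twist|exact: Dw].
- by apply: comm; [exact: uD|exact: Dw|exact: spread_twist].
- by move=> X; exact: spread_comm.
- by move=> X; exact: spread_trace.
- exact: trD.
Qed.

End Decomposed.

(** The tensor product of the positive square roots is hermitian and invertible, and X
  *t Y is its square. *)
Lemma posdef_tens m n (X : 'M[C]_m) (Y : 'M[C]_n) : posdef X -> posdef Y -> posdef (X *t Y).
Proof.
move=> pX pY; have [pX2 X2 XV] := posdef_mxpow pX; have [pY2 Y2 YV] := posdef_mxpow pY.
have -> : X *t Y = (mxpow X 2^-1 *t mxpow Y 2^-1)^t* *m (mxpow X 2^-1 *t mxpow Y 2^-1).
  by rewrite tens_adj pX2.1 pY2.1 mxtens.tensmx_mul X2 Y2.
apply: (posdef_gram (G' := mxpow X (- 2^-1) *t mxpow Y (- 2^-1))).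
by rewrite mxtens.tensmx_mul XV YV tens1.
Qed.

(** The twisted partial traces of X are intertwiners of irreducible corepresentations,
  hence scalars. Tracing out the second factor with weight F_beta replaces F_alpha by
  its inverse, then tracing out the first factor with weight F_alpha^-1 replaces F_beta
  by its inverse. *)
Lemma tens_trace alpha beta X (w := t alpha *t t beta) (D := F alpha *t F beta) :
  w *m scal X = scal X *m w -> \tr (D *m X) = \tr (invmx D *m X).
Proof.
move=> wX; have [uF Ft trF _] := modular_mxP hA repK alpha.
have [uG Gu trG _] := modular_mxP hA repK beta.
have ct := @tmx_corep _ _ rep; have ut := @tmx_unitary _ _ rep.
have invD : invmx D = invmx (F alpha) *t invmx (F beta).
  have e : D *m (invmx (F alpha) *t invmx (F beta)) = 1%:M.
    by rewrite mxtens.tensmx_mul (mulmxV uF) (mulmxV uG) tens1.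
  have [us _] := mulmx1_unit e.
  by rewrite -[LHS]mulmx1 -e mulmxA (mulVmx us) mul1mx.
(* A weighted trace may be taken one factor at a time, in either order. *)
have tr2 (P : 'M[C]_(hdim rep alpha)) (Q : 'M[C]_(hdim rep beta)) :
    \tr (P *t Q *m X) = \tr (P *m ptrace2 X Q).
  rewrite /mxtrace sum_tidx; apply: eq_bigr => i _; rewrite [RHS]mxE.
  under eq_bigr do rewrite mxE sum_tidx.
  rewrite exchange_big/=; apply: eq_bigr => j _; rewrite mxE mulr_sumr.
  rewrite exchange_big/=; apply: eq_bigr => k _; rewrite mulr_sumr.
  by apply: eq_bigr => q _; rewrite mxtens.tensmxE mulrA.
have tr1 (P : 'M[C]_(hdim rep alpha)) (Q : 'M[C]_(hdim rep beta)) :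
    \tr (P *t Q *m X) = \tr (Q *m ptrace1 X P).
  rewrite /mxtrace sum_tidx exchange_big; apply: eq_bigr => k _; rewrite [RHS]mxE.
  under eq_bigr do rewrite mxE sum_tidx exchange_big/=.
  rewrite exchange_big/=; apply: eq_bigr => l _; rewrite mxE mulr_sumr.
  rewrite exchange_big/=; apply: eq_bigr => i _; rewrite mulr_sumr.
  by apply: eq_bigr => j _; rewrite mxtens.tensmxE mulrA [P _ _ * _]mulrC.
have [y yE] : exists y : C, ptrace2 X (F beta) = y%:M.
  apply: (schur_scalar (t := t alpha)) => //; first exact: tmx_irr.
  by apply: (ptrace2_intertwiner (ct beta) (ut beta) (esym wX)); exact: Gu.
have [z zE] : exists z : C, ptrace1 X (invmx (F alpha)) = z%:M.
  apply: (schur_scalar (t := t beta)) => //; first exact: tmx_irr.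
  apply: (ptrace1_intertwiner (ct alpha) (ut alpha) (esym wX)).
  rewrite -[LHS]mul1mx -(scal_mx1 A) -(mulVmx uF) scal_mxM -mulmxA.
  rewrite [scal (F alpha) *m _]mulmxA Ft -(mulmxA _ (scal (F alpha))) -scal_mxM.
  by rewrite (mulmxV uF) scal_mx1 mulmx1.
have trM n (P : 'M[C]_n) c : \tr (P *m c%:M) = c * \tr P.
  by rewrite mul_mx_scalar linearZ.
rewrite invD tr2 yE trM trF -trM -yE -tr2.
by rewrite !tr1 zE !trM trG.
Qed.

(** By [spread_uniq]: the tensor product of the modular matrices has the properties that
  characterize the modular matrix of the tensor product. *)
Lemma spread_tens alpha beta l (wl : decomposes (rep := rep) (t alpha *t t beta) l) :
  spread l F = F alpha *t F beta.
Proof.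
have ct := @tmx_corep _ _ rep; have ut := @tmx_unitary _ _ rep.
have cw := tens_corep (ct alpha) (ct beta).
have uw := tens_unitary (ct alpha) (ct beta) (ut alpha) (ut beta).
apply: (spread_uniq cw uw wl).
- by apply: posdef_tens; exact: modular_mx_posdef.
- have [uF Ft _ _] := modular_mxP hA repK alpha; have [uG Gu _ _] := modular_mxP hA repK beta.
  rewrite (antipode2_tens (ct alpha) (ct beta) (ut alpha) (ut beta)).
  by rewrite tens_scal_mul tens_mul_scal Ft Gu.
- by move=> X; exact: tens_trace.
Qed.

Lemma fpow_exists z : exists f : {scalar A},
  fpow rep z = f /\ forall alpha, map_mx f (t alpha) = mxpow (F alpha) z.
Proof.
have [f fE] := functional_on_entries hA repK (fun alpha => mxpow (F alpha) z).
exists f; split=> //; have := @xgetPex _ (fun=> 0) [set f | lin_dual (A := A) f /\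
  forall alpha i j, f (t alpha i j) = mxpow (modular (t alpha)) z i j].
rewrite -/(fpow rep z) => -[|glin gE].
  exists (f : A -> C); split=> [c a b|alpha i j]; first exact: linearP.
  by rewrite -[mxpow _ _](fE alpha) mxE.
pose g : {scalar A} := HB.pack (fpow rep z) (GRing.isLinear.Build C A C _ (fpow rep z) glin).
apply/funext => a; apply: (functional_ext hA repK (f := g)) => alpha.
by rewrite fE; apply/matrixP => i j; rewrite mxE; exact: gE.
Qed.

Section HalfPower.
Variables fp fm : {scalar A}.
Hypothesis fpE : forall alpha, map_mx fp (t alpha) = mxpow (F alpha) 2^-1.
Hypothesis fmE : forall alpha, map_mx fm (t alpha) = mxpow (F alpha) (- 2^-1).

Lemma half_power_posdef alpha : posdef (map_mx fp (t alpha)).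
Proof. by rewrite fpE; case: (posdef_mxpow (modular_mx_posdef hA repK alpha)). Qed.

Lemma half_power_sqr alpha : map_mx fp (t alpha) *m map_mx fp (t alpha) = F alpha.
Proof. by rewrite fpE; case: (posdef_mxpow (modular_mx_posdef hA repK alpha)). Qed.

Lemma half_powers_inverse alpha : map_mx fm (t alpha) *m map_mx fp (t alpha) = 1%:M.
Proof. by rewrite fpE fmE; case: (posdef_mxpow (modular_mx_posdef hA repK alpha)). Qed.

(** Both sides are positive square roots of the modular matrix of the tensor product. *)
Lemma half_power_tens alpha beta :
  map_mx fp (t alpha *t t beta) = map_mx fp (t alpha) *t map_mx fp (t beta).
Proof.
have ct := @tmx_corep _ _ rep; have ut := @tmx_unitary _ _ rep.
have cw := tens_corep (ct alpha) (ct beta).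
have uw := tens_unitary (ct alpha) (ct beta) (ut alpha) (ut beta).
have [l wl] := unitary_decomposition repK cw uw.
apply: posdef_sqrt_uniq.
- by rewrite (map_spread wl); apply: (spread_posdef wl); exact: half_power_posdef.
- by apply: posdef_tens; exact: half_power_posdef.
rewrite mxtens.tensmx_mul !half_power_sqr -(spread_tens wl) (map_spread wl) (spreadM cw uw wl).
by apply: eq_bigr => x _; rewrite half_power_sqr.
Qed.

Lemma inv_half_power_tens alpha beta :
  map_mx fm (t alpha *t t beta) = map_mx fm (t alpha) *t map_mx fm (t beta).
Proof.
have ct := @tmx_corep _ _ rep; have ut := @tmx_unitary _ _ rep.
have cw := tens_corep (ct alpha) (ct beta).
have uw := tens_unitary (ct alpha) (ct beta) (ut alpha) (ut beta).
have [l wl] := unitary_decomposition repK cw uw.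
have e1 : map_mx fm (t alpha *t t beta) *m map_mx fp (t alpha *t t beta) = 1%:M.
  rewrite !(map_spread wl) (spreadM cw uw wl) -(spread1 wl).
  by apply: eq_bigr => x _; rewrite half_powers_inverse.
have e2 : map_mx fm (t alpha) *t map_mx fm (t beta) *m map_mx fp (t alpha *t t beta) = 1%:M.
  by rewrite half_power_tens mxtens.tensmx_mul !half_powers_inverse tens1.
have e3 := mulmx1C e2.
by rewrite -[LHS]mulmx1 -e3 mulmxA e1 mul1mx.
Qed.

End HalfPower.

(** Products of matrix elements are the entries of the tensor products, and the matrix
  elements span. *)
Lemma character_of_tens (f : {scalar A}) :
    (forall alpha beta, map_mx f (t alpha *t t beta) = map_mx f (t alpha) *t map_mx f (t beta)) ->
  {morph f : a b / a * b}.
Proof.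
move=> fT a b; have [p <-] := entries_span hA repK a; have [q <-] := entries_span hA repK b.
rewrite /lincomb mulr_suml !linear_sum mulr_suml; apply: eq_bigr => x _ /=.
rewrite mulr_sumr linear_sum mulr_sumr; apply: eq_bigr => y _ /=.
rewrite -scalerAl -scalerAr !scalarZ mulrACA mulrA; congr (_ * _).
have /matrixP/(_ (tidx (tagged (tag x.2), tagged (tag y.2))) (tidx (tagged x.2, tagged y.2))) :=
  fT (tag (tag x.2)) (tag (tag y.2)).
by rewrite mxE !mxtens.tensmxE !mxE.
Qed.

End Characters.

(** * The second involution *)

Section Bar.
Variables (R : realType) (A : hopf_star_alg R).
Local Notation C := R[i].
Local Notation S := (antipode A).
Local Notation scal := (scal_mx A).
Hypothesis hA : is_CQG A.
Variables (rep : hat A -> irr A).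
Hypothesis repK : forall alpha, irr_class (rep alpha) = alpha.
Local Notation t := (tmx rep).
Local Notation F := (modular_mx rep).

Lemma trivial_corep : corep (1%:M : 'M[A]_1).
Proof.
by move=> i j; rewrite !ord1 mxE eqxx big_ord1 coprod1 counit1 mxE.
Qed.

Lemma trivial_unitary : unitary_corep (1%:M : 'M[A]_1).
Proof. by apply: unitary_of_starmul; [exact: trivial_corep | rewrite mxstar1 mulmx1]. Qed.

Lemma trivial_irr : irreducible_corep (1%:M : 'M[A]_1).
Proof. by move=> [s _ [m /andP[m0 m1]]]; move: m1; rewrite ltnS leqNgt m0. Qed.

Lemma trivial_class : exists e, corep_equiv (1%:M : 'M[A]_1) (t e).
Proof.
exact: irr_unitary_class repK _ _ (ltn0Sn 0) trivial_corep trivial_unitary trivial_irr.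
Qed.

Lemma tmx_trivial e : corep_equiv (1%:M : 'M[A]_1) (t e) -> t e = 1%:M.
Proof.
case=> B [B' [BB' B'B]]; rewrite mulmx1 => tB.
by rewrite -[t e]mulmx1 -(scal_mx1 A) -BB' scal_mxM mulmxA -tB.
Qed.

Lemma hdim_trivial e : corep_equiv (1%:M : 'M[A]_1) (t e) -> hdim rep e = 1%N.
Proof.
case=> B [B' [BB' B'B _]]; apply/eqP; rewrite eqn_leq andbT.
rewrite -(mxrank1 C (hdim rep e)) -BB'; apply: leq_trans (mxrankM_maxl _ _) _.
exact: rank_leq_col.
Qed.

Lemma character1 (f : {scalar A}) : {morph f : a b / a * b} ->
  (exists a, f a != 0) -> f 1 = 1.
Proof.
move=> fM [a fa]; apply: (mulIf fa); rewrite -fM !mul1r//.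
Qed.

(** A character turns the antipode axiom into an identity of complex matrices. *)
Lemma character_antipode (f : {scalar A}) n (s : 'M[A]_n) : {morph f : a b / a * b} ->
  f 1 = 1 -> corep s -> map_mx f (map_mx S s) *m map_mx f s = 1%:M.
Proof.
move=> fM f1 cs; apply/matrixP => i j; have /matrixP/(_ i j) := corep_antipodel cs.
rewrite !mxE => /(congr1 f); rewrite linear_sum => e.
transitivity (f (i == j)%:R); last by case: (i == j); rewrite ?linear0.
by rewrite -e; apply: eq_bigr => k _; rewrite !mxE fM.
Qed.

(** For a character the value at an entry of a tensor product factorizes. *)
Lemma lact_tens m n (s : 'M[A]_m) (u : 'M[A]_n) (f : {scalar A}) i j k l :
  corep s -> corep u -> {morph f : a b / a * b} ->
  lact f (s i j * u k l) = lact f (s i j) * lact f (u k l).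
Proof.
move=> cs cu fM; rewrite -[s i j * _]mxtens.tensmxE (lact_corep _ _ _ (tens_corep cs cu)).
rewrite !lact_corep// sum_tidx mulr_suml; apply: eq_bigr => p _.
rewrite mulr_sumr; apply: eq_bigr => q _.
by rewrite !mxtens.tensmxE fM -scalerAl -scalerAr scalerA.
Qed.

Lemma ract_tens m n (s : 'M[A]_m) (u : 'M[A]_n) (f : {scalar A}) i j k l :
  corep s -> corep u -> {morph f : a b / a * b} ->
  ract (s i j * u k l) f = ract (s i j) f * ract (u k l) f.
Proof.
move=> cs cu fM; rewrite -[s i j * _]mxtens.tensmxE (ract_corep _ _ _ (tens_corep cs cu)).
rewrite !ract_corep// sum_tidx mulr_suml; apply: eq_bigr => p _.
rewrite mulr_sumr; apply: eq_bigr => q _.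
by rewrite !mxtens.tensmxE fM -scalerAl -scalerAr scalerA.
Qed.

(** Bilinear identities need only be checked on matrix elements, since these span. *)
Lemma bilinear_entries (V : lmodType C) (phi psi : A -> A -> V) :
    (forall b, linear (phi^~ b)) -> (forall a, linear (phi a)) ->
    (forall b, linear (psi^~ b)) -> (forall a, linear (psi a)) ->
    (forall alpha beta i j k l, phi (t alpha i j) (t beta k l) = psi (t alpha i j) (t beta k l)) ->
  forall a b, phi a b = psi a b.
Proof.
move=> phil phir psil psir e a b.
have lin_eq (g h : A -> V) : linear g -> linear h ->
    (forall alpha i j, g (t alpha i j) = h (t alpha i j)) -> g =1 h.
  move=> lg lh gh c; have [p <-] := entries_span hA repK c.
  have lin0 (k : A -> V) : linear k -> k 0 = 0.
    move=> lk; have := lk 1 0 0; rewrite !scale1r !addr0 => /esym/eqP.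
    by rewrite -subr_eq0 addrK => /eqP.
  elim: p => [|x p IH]; first by rewrite /lincomb big_nil !lin0.
  by rewrite /lincomb big_cons lg lh gh IH.
apply: (lin_eq (phi^~ b) (psi^~ b)) => // alpha i j.
by apply: (lin_eq (phi _) (psi _)) => // beta k l; exact: e.
Qed.

Lemma lactM (f : {scalar A}) : {morph f : a b / a * b} ->
  {morph (lact f : A -> A) : a b / a * b}.
Proof.
move=> fM a b; apply: (bilinear_entries (phi := fun a b => lact f (a * b))
   (psi := fun a b => lact f a * lact f b)) => [y c x z|y c x z|y c x z|y c x z|*].
- by rewrite mulrDl -scalerAl lact_is_linear.
- by rewrite mulrDr -scalerAr lact_is_linear.
- by rewrite lact_is_linear mulrDl -scalerAl.
- by rewrite lact_is_linear mulrDr -scalerAr.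
- by apply: lact_tens => //; exact: tmx_corep.
Qed.

Lemma ractM (f : {scalar A}) : {morph f : a b / a * b} ->
  {morph (@ract _ A)^~ f : a b / a * b}.
Proof.
move=> fM a b; apply: (bilinear_entries (phi := fun a b => ract (a * b) f)
   (psi := fun a b => ract a f * ract b f)) => [y c x z|y c x z|y c x z|y c x z|*].
- by rewrite mulrDl -scalerAl ract_is_linear.
- by rewrite mulrDr -scalerAr ract_is_linear.
- by rewrite ract_is_linear mulrDl -scalerAl.
- by rewrite ract_is_linear mulrDr -scalerAr.
- by apply: ract_tens => //; exact: tmx_corep.
Qed.

Lemma bar_functionals : exists fp fm : {scalar A},
  [/\ forall a, bar rep a = ract (lact fp (star a)) fm,
      forall alpha, map_mx fp (t alpha) = mxpow (F alpha) 2^-1,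
      forall alpha, map_mx fm (t alpha) = mxpow (F alpha) (- 2^-1),
      {morph fp : a b / a * b} /\ fp 1 = 1 &
      {morph fm : a b / a * b} /\ fm 1 = 1].
Proof.
have [fp [fpE fpt]] := fpow_exists hA repK 2^-1.
have [fm [fmE fmt]] := fpow_exists hA repK (- 2^-1).
have fpM : {morph fp : a b / a * b}.
  by apply: (character_of_tens hA repK) => *; exact: half_power_tens.
have fmM : {morph fm : a b / a * b}.
  by apply: (character_of_tens hA repK) => *; exact: (inv_half_power_tens hA repK fpt).
have [e _] := trivial_class.
have ne0 (f : {scalar A}) (G : 'M[C]_(hdim rep e)) :
    (map_mx f (t e) *m G = 1%:M \/ G *m map_mx f (t e) = 1%:M) -> exists a, f a != 0.
  move=> h; apply: contrapT => nf; have f0 : map_mx f (t e) = 0.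
    by apply/matrixP => i j; rewrite !mxE; apply/eqP/negP => /negP fa; apply: nf; exists (t e i j).
  case: h; rewrite f0 ?mulmx0 ?mul0mx => /matrixP/(_ ord0 ord0)/eqP;
  by rewrite !mxE eqxx eq_sym oner_eq0.
exists fp, fm; split=> //.
- by move=> a; rewrite /bar fpE fmE.
- split=> //; apply: character1 => //; apply: (ne0 _ (map_mx fm (t e))); right.
  exact: half_powers_inverse.
- split=> //; apply: character1 => //; apply: (ne0 _ (map_mx fp (t e))); left.
  exact: half_powers_inverse.
Qed.

(** Star reverses products, and the actions of the characters f_{1/2} and f_{-1/2}
  preserve them. *)
Lemma barM a b : bar rep (a * b) = bar rep b * bar rep a.
Proof.
have [fp [fm [barE _ _ [fpM _] [fmM _]]]] := bar_functionals.
by rewrite !barE starM lactM// ractM.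
Qed.

Lemma bar_antilinear c a b : bar rep (c *: a + b) = c^* *: bar rep a + bar rep b.
Proof.
have [fp [fm [barE _ _ _ _]]] := bar_functionals.
by rewrite !barE starD starZ lact_is_linear ract_is_linear.
Qed.

Lemma ract_sum (f : {scalar A}) I (s : seq I) (c : I -> C) (a : I -> A) :
  ract (\sum_(i <- s) c i *: a i) f = \sum_(i <- s) c i *: ract (a i) f.
Proof.
pose r := HB.pack (fun a : A => ract a f)
  (GRing.isLinear.Build C A A _ (fun a : A => ract a f) (ract_is_linear f)) : {linear A -> A}.
rewrite -[LHS]/(r _) linear_sum; apply: eq_bigr => i _.
by rewrite linearZ.
Qed.

(** Acting with f_{1/2} and f_{-1/2} multiplies the conjugate of t^alpha by the matrices
  of their values on it. As a character takes inverse values at S(t), and the conjugate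
  of t is the transpose of S(t), these are the transposes of G^-1 and G. *)
Lemma bar_tmx alpha : exists2 G : 'M[C]_(hdim rep alpha),
  posdef G /\ G *m G = F alpha &
  map_mx (bar rep) (t alpha) = scal G^T *m conj_corep (t alpha) *m scal (invmx G)^T.
Proof.
have [fp [fm [barE fpt fmt [fpM fp1] [fmM fm1]]]] := bar_functionals.
set G := map_mx fp (t alpha); exists G.
  by split; [exact: half_power_posdef | exact: half_power_sqr].
have pG : posdef G by exact: half_power_posdef.
have uG := posdef_unit pG.
have cta := @tmx_corep _ _ rep alpha; have uta := @tmx_unitary _ _ rep alpha.
have cconj := conj_corep_corep cta.
have conjE : conj_corep (t alpha) = (map_mx S (t alpha))^T.
  by apply/matrixP => i j; rewrite !mxE uta.
have inv_of (H K : 'M[C]_(hdim rep alpha)) : H *m K = 1%:M -> K \in unitmx -> H = invmx K.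
  by move=> HK uK; rewrite -[LHS]mulmx1 -(mulmxV uK) mulmxA HK mul1mx.
have fpc : map_mx fp (conj_corep (t alpha)) = (invmx G)^T.
  rewrite conjE -map_trmx; congr (_^T); apply: inv_of => //.
  exact: character_antipode.
have fmG : map_mx fm (t alpha) *m G = 1%:M by exact: half_powers_inverse.
have [ufm _] := mulmx1_unit fmG.
have fmc : map_mx fm (conj_corep (t alpha)) = G^T.
  rewrite conjE -map_trmx; congr (_^T).
  by rewrite -[LHS]mulmx1 -fmG mulmxA character_antipode// mul1mx.
rewrite -fpc -fmc; apply/matrixP => i j.
have starE : star (t alpha i j) = conj_corep (t alpha) i j by rewrite mxE.
rewrite [LHS]mxE barE starE lact_corep// mul_scalE.
rewrite ract_sum; apply: eq_bigr => k _; congr (_ *: _); first by rewrite [RHS]mxE.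
rewrite ract_corep// scal_mulE; apply: eq_bigr => q _; congr (_ *: _).
by rewrite [RHS]mxE.
Qed.

Definition bar_corep alpha : 'M[A]_(hdim rep alpha) := map_mx (bar rep) (t alpha).

Lemma tr_unitmx n (G : 'M[C]_n) : G \in unitmx -> (invmx G)^T *m G^T = 1%:M.
Proof. by move=> uG; rewrite -trmx_mul (mulmxV uG) trmx1. Qed.

Lemma bar_corep_equiv alpha : corep_equiv (bar_corep alpha) (conj_corep (t alpha)).
Proof.
have [G [pG _] E] := bar_tmx alpha; have uG := posdef_unit pG.
have e := tr_unitmx uG; have e' := mulmx1C e.
exists ((invmx G)^T), (G^T); split=> //.
by rewrite /bar_corep E !mulmxA -scal_mxM e scal_mx1 mul1mx.
Qed.

Lemma bar_corep_corep alpha : corep (bar_corep alpha).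
Proof.
by apply: (corep_of_equiv (bar_corep_equiv alpha)); apply: conj_corep_corep; exact: tmx_corep.
Qed.

Lemma bar_corep_irr alpha : irreducible_corep (bar_corep alpha).
Proof.
by apply: (irreducible_corep_equiv (bar_corep_equiv alpha)); apply: conj_corep_irr; exact: tmx_irr.
Qed.

(** S of the conjugate of t is the transpose of S^2(t) = F t F^-1 with F = G^2, and
  conjugation by G^-1 brings G^2 t G^-2 to G t G^-1. *)
Lemma bar_corep_unitary alpha : unitary_corep (bar_corep alpha).
Proof.
have [G [pG GG] E] := bar_tmx alpha; have uG := posdef_unit pG.
have cta := @tmx_corep _ _ rep alpha; have uta := @tmx_unitary _ _ rep alpha.
have [uF FE _ _] := modular_mxP hA repK alpha.
have Sbar : map_mx S (conj_corep (t alpha)) = (antipode2 (t alpha))^T.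
  by rewrite (antipode2_unitary uta) trmxK.
have tw : antipode2 (t alpha) = scal (F alpha) *m t alpha *m scal (invmx (F alpha)).
  by rewrite FE -mulmxA -scal_mxM (mulmxV uF) scal_mx1 mulmx1.
apply/unitary_corepE; rewrite /bar_corep E map_antipode_mul_scal map_antipode_scal_mul Sbar.
have -> : scal G^T *m (antipode2 (t alpha))^T *m scal (invmx G)^T =
    (scal (invmx G) *m antipode2 (t alpha) *m scal G)^T.
  by rewrite tr_mul_scal tr_scal_mul mulmxA.
have -> : scal (invmx G) *m antipode2 (t alpha) *m scal G =
    scal G *m t alpha *m scal (invmx G).
  have GF : invmx G *m F alpha = G by rewrite -GG mulmxA (mulVmx uG) mul1mx.
  have FG : invmx (F alpha) *m G = invmx G.
    rewrite -[RHS]mul1mx -(mulVmx uF) -mulmxA; congr (_ *m _).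
    by rewrite -GG -mulmxA (mulmxV uG) mulmx1.
  by rewrite tw !mulmxA -scal_mxM GF -(mulmxA (_ *m t alpha)) -scal_mxM FG.
rewrite tr_mul_scal tr_scal_mul !mxstarM !mxstar_scal !mulmxA.
have conjT (H : 'M[C]_(hdim rep alpha)) : H^t* = H -> (H^T)^t* = H^T.
  by move=> Hh; apply/matrixP => i j; have /matrixP/(_ j i) := Hh; rewrite !mxE.
rewrite (conjT _ pG.1) (conjT _ (posdef_inv pG).1); congr (_ *m _ *m _).
by apply/matrixP => i j; rewrite !mxE starK.
Qed.

(** * Orthogonality relations for the Haar functional *)

Section Haar.
Variable e : hat A.
Hypothesis eE : corep_equiv (1%:M : 'M[A]_1) (t e).

(** The projection onto the coefficient of the trivial corepresentation. *)
Lemma haar_exists : exists h : {scalar A},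
  (forall alpha, alpha != e -> map_mx h (t alpha) = 0) /\ h 1 = 1.
Proof.
have [h hE] := functional_on_entries hA repK
  (fun alpha => if alpha == e then 1%:M else 0 : 'M[C]_(hdim rep alpha)).
exists h; split=> [alpha ae|]; first by rewrite hE (negbTE ae).
by have /matrixP/(_ ord0 ord0) := hE e; rewrite eqxx (tmx_trivial eE) !mxE eqxx.
Qed.

Variable h : {scalar A}.
Hypothesis h0 : forall alpha, alpha != e -> map_mx h (t alpha) = 0.
Hypothesis h1 : h 1 = 1.

Lemma haar_tmx alpha i j : h (t alpha i j) = ((alpha == e) && (i == j))%:R.
Proof.
have [ae|ae] := eqVneq alpha e.
  by subst alpha; rewrite (tmx_trivial eE) mxE; case: (i == j); rewrite ?linear0.
by have /matrixP/(_ i j) := h0 ae; rewrite !mxE.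
Qed.

Lemma lact_haar a : lact h a = h a *: 1.
Proof.
have [p <-] := entries_span hA repK a; rewrite /lincomb !linear_sum scaler_suml.
apply: eq_bigr => x _ /=; rewrite linearZ/= scalarZ -scalerA; congr (_ *: _).
rewrite /entry_val; move: (tag (tag x.2)) (tagged (tag x.2)) (tagged x.2) => alpha i j.
rewrite lact_corep; last exact: tmx_corep.
rewrite haar_tmx (bigD1 j)//= haar_tmx eqxx andbT big1 ?addr0 => [|k kj]; last first.
  by rewrite haar_tmx (negbTE kj) andbF scale0r.
have [ae|_] := eqVneq alpha e; last by rewrite !scale0r.
subst alpha; rewrite (tmx_trivial eE) mxE.
by case: (i == j); rewrite !scale1r ?scale0r.
Qed.

Lemma ract_haar a : ract a h = h a *: 1.
Proof.
have [p <-] := entries_span hA repK a; rewrite /lincomb ract_sum linear_sum scaler_suml.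
apply: eq_bigr => x _ /=; rewrite scalarZ -scalerA; congr (_ *: _).
rewrite /entry_val; move: (tag (tag x.2)) (tagged (tag x.2)) (tagged x.2) => alpha i j.
rewrite ract_corep; last exact: tmx_corep.
rewrite haar_tmx (bigD1 i)//= haar_tmx eqxx andbT big1 ?addr0 => [|k ki]; last first.
  by rewrite haar_tmx [i == k]eq_sym (negbTE ki) andbF scale0r.
have [ae|_] := eqVneq alpha e; last by rewrite !scale0r.
subst alpha; rewrite (tmx_trivial eE) mxE.
by case: (i == j); rewrite !scale1r ?scale0r.
Qed.

(** At the products s_pj u_ql^* the identity h.a = h(a) 1 says s M u^-1 = M. *)
Lemma haar_conj m n (s : 'M[A]_m) (u : 'M[A]_n) j l : corep s -> corep u -> unitary_corep u ->
  let M := \matrix_(p, q) h (s p j * star (u q l)) in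
  scal M *m u = s *m scal M.
Proof.
move=> cs cu uu M; have ccu := conj_corep_corep cu.
have sM : s *m scal M *m mxstar u = scal M.
  apply/matrixP => i k.
  have -> : scal M i k = h (s i j * conj_corep u k l) *: 1 by rewrite mxE /= !mxE.
  rewrite -lact_haar -mxtens.tensmxE (lact_corep _ _ _ (tens_corep cs ccu)) sum_tidx.
  rewrite mxE [RHS]exchange_big/=.
  apply: eq_bigr => q _; rewrite mul_scalE mulr_suml; apply: eq_bigr => p _.
  by rewrite !mxtens.tensmxE !mxE -scalerAl.
by rewrite -{1}sM -mulmxA (unitary_starmul cu uu) mulmx1.
Qed.

Lemma haar_orthogonal alpha beta i j k l : alpha != beta ->
  h (t alpha i j * star (t beta k l)) = 0.
Proof.
move=> ab; have ct := @tmx_corep _ _ rep; have ut := @tmx_unitary _ _ rep.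
have := haar_conj j l (ct alpha) (ct beta) (ut beta).
move=> /(schur (@tmx_irr _ _ rep beta) (@tmx_irr _ _ rep alpha)) [M0|/(tmx_inj repK) ba].
  by have /matrixP/(_ i k) := M0; rewrite !mxE.
by case/eqP: ab.
Qed.

(** By h.a = h(a) 1 the dependence on the row indices is an endomorphism of t^alpha,
  hence a multiple of the identity; a.h = h(a) 1 makes the transpose of c an intertwiner
  from t^alpha to S^2(t^alpha), hence a multiple of F_alpha. Evaluating h at the sum of
  the t_1j t_1j^*, which is 1, gives lambda tr F_alpha = 1. *)
Lemma haar_orthogonality alpha : exists2 c : 'M[C]_(hdim rep alpha),
  (forall i j k l, h (t alpha i j * star (t alpha k l)) = (i == k)%:R * c j l) &
  exists2 lambda, 0 < lambda & c^T = lambda *: F alpha.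
Proof.
have ct := @tmx_corep _ _ rep; have ut := @tmx_unitary _ _ rep.
pose c := \matrix_(j, l) h (t alpha ord0 j * star (t alpha ord0 l)).
have cE i j k l : h (t alpha i j * star (t alpha k l)) = (i == k)%:R * c j l.
  have := haar_conj j l (ct alpha) (ct alpha) (ut alpha).
  move=> /(schur_scalar (ltn0Sn _) (@tmx_irr _ _ rep alpha)) [d dE].
  have dij p q : h (t alpha p j * star (t alpha q l)) = (p == q)%:R * d.
    have /matrixP/(_ p q) := dE; rewrite !mxE => ->.
    by case: (p == q); rewrite ?mul1r ?mul0r ?mulr1n ?mulr0n.
  by rewrite mxE !dij eqxx mul1r.
exists c => //.
have [uF FE trF F0] := modular_mxP hA repK alpha.
have ccu := conj_corep_corep (ct alpha).
have cT : scal c^T *m t alpha = antipode2 (t alpha) *m scal c^T.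
  have e1 : (t alpha)^T *m scal c *m conj_corep (t alpha) = scal c.
    apply/matrixP => j l.
    have -> : scal c j l = h (t alpha ord0 j * conj_corep (t alpha) ord0 l) *: 1.
      by rewrite mxE /= !mxE.
    rewrite -ract_haar -mxtens.tensmxE (ract_corep _ _ _ (tens_corep (ct alpha) ccu)).
    rewrite sum_tidx mxE [RHS]exchange_big/=.
    apply: eq_bigr => q _; rewrite mul_scalE mulr_suml; apply: eq_bigr => p _.
    by rewrite !mxtens.tensmxE !mxE -scalerAl.
  have e2 : (t alpha)^T *m scal c = scal c *m (antipode2 (t alpha))^T.
    rewrite (antipode2_unitary (ut alpha)) trmxK -[in RHS]e1 -[RHS]mulmxA.
    by rewrite corep_antipoder// mulmx1.
  by have := congr1 trmx e2; rewrite tr_mul_scal tr_scal_mul !trmxK.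
have [lambda cl] : exists lambda : C, invmx (F alpha) *m c^T = lambda%:M.
  apply: (schur_scalar (ltn0Sn _) (@tmx_irr _ _ rep alpha)).
  rewrite scal_mxM -mulmxA cT.
  have -> : antipode2 (t alpha) = scal (F alpha) *m t alpha *m scal (invmx (F alpha)).
    by rewrite FE -mulmxA -scal_mxM (mulmxV uF) scal_mx1 mulmx1.
  by rewrite !mulmxA -scal_mxM (mulVmx uF) scal_mx1 mul1mx -mulmxA -scal_mxM.
have cF : c^T = lambda *: F alpha.
  by rewrite -mul_mx_scalar -cl mulmxA (mulmxV uF) mul1mx.
exists lambda => //.
have : lambda * \tr (F alpha) = 1.
  rewrite -mxtraceZ -cF mxtrace_tr -h1.
  have /matrixP/(_ ord0 ord0) := unitary_mulstar (ct alpha) (ut alpha).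
  rewrite !mxE eqxx => /(congr1 h); rewrite linear_sum => <-.
  by apply: eq_bigr => j _; rewrite !mxE.
move=> lF; rewrite -(pmulr_lgt0 _ F0) lF; exact: ltr01.
Qed.

(** By [bar_tmx] and the orthogonality relations the value is lambda G_11 (G^-1
  F_alpha)_11, and G^-1 F_alpha = G. *)
Lemma haar_t11_bar alpha : 0 < h (t11 rep alpha * bar rep (t11 rep alpha)).
Proof.
have [G [pG GG] E] := bar_tmx alpha; have uG := posdef_unit pG.
have [c cE [lambda l0 cl]] := haar_orthogonality alpha.
have /matrixP/(_ ord0 ord0) := E; rewrite mxE mul_scalE => ->.
have -> : h (t11 rep alpha *
     (\sum_l (invmx G)^T l ord0 *: (scal G^T *m conj_corep (t alpha)) ord0 l)) =
  \sum_l (invmx G) ord0 l * (G ord0 ord0 * c ord0 l).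
  rewrite mulr_sumr linear_sum; apply: eq_bigr => l _ /=.
  rewrite scal_mulE -scalerAr scalarZ mxE; congr (_ * _).
  rewrite mulr_sumr linear_sum (bigD1 ord0)//= big1 ?addr0 => [|k k0].
    by rewrite -scalerAr scalarZ !mxE cE eqxx mul1r.
  by rewrite -scalerAr scalarZ !mxE cE eq_sym (negbTE k0) mul0r mulr0.
have -> : \sum_l (invmx G) ord0 l * (G ord0 ord0 * c ord0 l) =
    lambda * (G ord0 ord0 * (invmx G *m F alpha) ord0 ord0).
  rewrite [(invmx G *m _) _ _]mxE !mulr_sumr; apply: eq_bigr => l _.
  have /matrixP/(_ l ord0) := cl; rewrite mxE => ->; rewrite mxE.
  by rewrite mulrCA [RHS]mulrCA; congr (_ * _); rewrite mulrCA.
rewrite -GG mulmxA (mulVmx uG) mul1mx.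
by rewrite !mulr_gt0// posdef_diag_gt0.
Qed.

End Haar.

End Bar.

(** * Invariant vectors and linearization coefficients *)

Section Spherical.
Variables (R : realType) (A : hopf_star_alg R).
Local Notation C := R[i].
Local Notation S := (antipode A).
Local Notation scal := (scal_mx A).
Hypothesis hA : is_CQG A.
Variables (rep : hat A -> irr A).
Hypothesis repK : forall alpha, irr_class (rep alpha) = alpha.
Local Notation t := (tmx rep).
Local Notation F := (modular_mx rep).
Local Notation t11 := (t11 rep).
Local Notation bar_corep := (bar_corep rep).
Variable J : set (A -> C).
Hypothesis hJ : two_sided_coideal J.
Hypothesis hJS : [set dual_antipode f | f in J] = [set dual_bar rep f | f in J].
Hypothesis hG : gen_Gelfand_pair rep J.
Hypothesis hrep : adapted rep J.

Lemma coideal_scalar f : J f -> exists g : {scalar A}, f = g.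
Proof.
case: hJ => Jlin _ _ _ _ Jf; have flin : scalar f by exact: Jlin.
by exists (HB.pack f (GRing.isLinear.Build C A C _ f flin) : {scalar A}).
Qed.

(** S^2 is conjugation by F_alpha on the matrix elements of t^alpha, hence S is onto. *)
Lemma antipode_surj b : exists a, S a = b.
Proof.
have [p <-] := entries_span hA repK b; rewrite /lincomb.
elim: p => [|x p [a aE]]; first by exists 0; rewrite big_nil linear0.
have [a' a'E] : exists a', S a' = entry_val t x.2.
  rewrite /entry_val; move: (tag (tag x.2)) (tagged (tag x.2)) (tagged x.2) => alpha i j.
  have [uF FE _ _] := modular_mxP hA repK alpha.
  exists ((scal (invmx (F alpha)) *m map_mx S (t alpha) *m scal (F alpha)) i j).
  transitivity (map_mx S (scal (invmx (F alpha)) *m map_mx S (t alpha) *m scal (F alpha)) i j).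
    by rewrite [RHS]mxE.
  rewrite map_antipode_mul_scal map_antipode_scal_mul.
  by rewrite -antipode2E -mulmxA -FE mulmxA -scal_mxM (mulVmx uF) scal_mx1 mul1mx.
by exists (x.1 *: a' + a); rewrite linearP a'E aE big_cons.
Qed.

(** The form in which S(J) = J^- is used: with g also the functional b |-> conj(g(b^-))
  belongs to J. *)
Lemma coideal_bar g : J g -> exists2 f, J f & forall b, f b = (g (bar rep b))^*.
Proof.
move=> Jg; have : [set dual_bar rep f | f in J] (dual_bar rep g) by exists g.
rewrite -hJS => -[f Jf fg]; exists f => // b; have [a <-] := antipode_surj b.
by have := congr1 (fun k => k a) fg.
Qed.

Definition first_vector alpha : 'cV[C]_(hdim rep alpha) := delta_mx ord0 ord0.

Lemma first_vector_neq0 alpha : first_vector alpha != 0.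
Proof.
by apply/eqP => /matrixP/(_ ord0 ord0); rewrite !mxE !eqxx => /eqP; rewrite oner_eq0.
Qed.

Lemma spherical_first_column alpha f i : spherical rep J alpha -> J f -> f (t alpha i ord0) = 0.
Proof.
move=> sa Jf; have := hrep sa Jf; rewrite -colE => /matrixP/(_ i ord0).
by rewrite !mxE.
Qed.

Lemma invariant_spherical alpha (v : 'cV[C]_(hdim rep alpha)) :
  J_invariant J v -> v != 0 -> spherical rep J alpha.
Proof.
move=> Jv v0; have [_ _ /(_ alpha)[[U UP /eqP]|//]] := hG.
by rewrite dimv_eq0 => /eqP U0; move: v0; have /UP := Jv; rewrite U0 memv0 => ->.
Qed.

(** The invariant vectors form at most a line, which contains e_1 if it is not zero. *)
Lemma invariant_line alpha (v : 'cV[C]_(hdim rep alpha)) :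
  J_invariant J v -> v = v ord0 ord0 *: first_vector alpha.
Proof.
move=> Jv; have [->|v0] := eqVneq v 0; first by rewrite mxE scale0r.
have sa := invariant_spherical Jv v0; case: (sa) => U UP dU.
have eU : (<[first_vector alpha]> == U)%VS.
  rewrite eqEdim -memvE dU dim_vline first_vector_neq0 andbT.
  by apply/UP; exact: hrep.
have : v \in U by apply/UP.
rewrite -(eqP eU) => /vlineP[c ->].
by rewrite mxE [first_vector _ _ _]mxE !eqxx mulr1.
Qed.

(** The adjoint of an embedding of t^gamma into w is an intertwiner from w to t^gamma. *)
Lemma transport_invariant N (w : 'M[A]_N) gamma (T : 'M[C]_(N, hdim rep gamma)) (v : 'cV[C]_N) :
    corep w -> unitary_corep w -> w *m scal T = scal T *m t gamma ->
    (forall f, J f -> map_mx f w *m v = 0) ->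
  J_invariant J (T^t* *m v).
Proof.
move=> cw uw wT wv f Jf; have [g fg] := coideal_scalar Jf.
have Tw := intertwiner_adj cw uw (@tmx_corep _ _ rep gamma) (@tmx_unitary _ _ rep gamma) wT.
have := congr1 (map_mx g) Tw; rewrite map_scal_mul map_mul_scal => e.
by rewrite /dual_rep fg mulmxA -e -mulmxA -fg wv// mulmx0.
Qed.

(** Each term of Delta(f) has a factor in J, which annihilates one of the two vectors
  e_1. *)
Lemma tens_invariant alpha beta f : spherical rep J alpha -> spherical rep J beta -> J f ->
  map_mx f (t alpha *t t beta) *m delta_mx (tidx (ord0, ord0)) ord0 = 0 :> 'cV[C]_ _.
Proof.
move=> sa sb Jf; rewrite -colE; apply/matrixP => a j; rewrite !mxE.
case: (mxtens.mxtens_indexP a) => i k; rewrite !mxtens.mxtens_indexK /=.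
case: hJ => _ _ _ _ /(_ f Jf)[l lP ->].
rewrite big_seq big1// => p /lP[[Jp _]|[_ Jp]].
- by rewrite (spherical_first_column _ sa Jp) mul0r.
- by rewrite (spherical_first_column _ sb Jp) mulr0.
Qed.

(** The components of the invariant basis vector at i are invariant, so each of them is
  the multiple of e_1 by the conjugate of the entry of T at i and the first index. Hence
  in the expansion of w_ii by matrix elements of the t^gamma only the t_11^gamma
  survive. *)
Lemma decomposed_entry N (w : 'M[A]_N) l (i : 'I_N) :
    corep w -> unitary_corep w -> decomposes (rep := rep) w l ->
    (forall f, J f -> map_mx f w *m delta_mx i ord0 = 0 :> 'cV[C]_N) ->
  w i i = \sum_(x <- l) (tagged x i ord0 * (tagged x i ord0)^*) *: t11 (tag x) /\
  forall x, x \in l -> tagged x i ord0 != 0 -> spherical rep J (tag x).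
Proof.
move=> cw uw wl wi.
have Jx x : x \in l -> J_invariant J ((tagged x)^t* *m delta_mx i ord0 : 'cV[C]_ _).
  by move=> xl; apply: (transport_invariant cw uw) => //; apply: wl.1.
have vE (x : {alpha : hat A & 'M[C]_(N, hdim rep alpha)}) q :
    ((tagged x)^t* *m delta_mx i ord0 : 'cV[C]_ _) q ord0 = (tagged x i q)^*.
  by rewrite -colE !mxE.
have x0 x q : x \in l -> q != ord0 -> tagged x i q = 0.
  move=> xl q0; have := congr1 (fun v : 'cV_ _ => v q ord0) (invariant_line (Jx x xl)).
  rewrite /= vE => e; apply/eqP; rewrite -conjC_eq0; apply/eqP.
  by rewrite e !mxE (negbTE q0) mulr0.
split.
  rewrite {1}(decomposes_sum wl) summxE; apply: eq_big_seq => x xl.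
  rewrite mul_scalE (bigD1 ord0)//= big1 ?addr0 => [|q q0]; last first.
    by rewrite !mxE x0// rmorph0 scale0r.
  rewrite scal_mulE (bigD1 ord0)//= big1 ?addr0 => [|q q0]; last by rewrite x0// scale0r.
  by rewrite !mxE scalerA mulrC.
move=> x xl xi; apply: (invariant_spherical (Jx x xl)); apply: contraNneq xi => e.
by rewrite -conjC_eq0 -vE e mxE.
Qed.

Local Notation K := (spherical rep J).

Lemma spherical_elt alpha : K alpha -> exists a : K, val a = alpha.
Proof. by move=> sa; exists (exist _ alpha (mem_set sa)). Qed.

Lemma spherical_val (a : K) : K (val a).
Proof. exact: set_mem (valP a). Qed.

Lemma product_expansion (alpha beta : K) : exists l : seq (C * K),
  (forall x, x \in l -> 0 <= x.1) /\
  t11 (val alpha) * t11 (val beta) = \sum_(x <- l) x.1 *: t11 (val x.2).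
Proof.
have ct := @tmx_corep _ _ rep; have ut := @tmx_unitary _ _ rep.
have cw := tens_corep (ct (val alpha)) (ct (val beta)).
have uw := tens_unitary (ct (val alpha)) (ct (val beta)) (ut (val alpha)) (ut (val beta)).
have [l wl] := unitary_decomposition repK cw uw.
have [wE lP] := decomposed_entry cw uw wl
  (fun f Jf => tens_invariant (spherical_val alpha) (spherical_val beta) Jf).
have -> : t11 (val alpha) * t11 (val beta) =
    \sum_(x <- l) (tagged x (tidx (ord0, ord0)) ord0 *
      (tagged x (tidx (ord0, ord0)) ord0)^*) *: t11 (tag x).
  by rewrite -wE mxtens.tensmxE.
move: lP {wE}; move: (tidx (ord0, ord0)) => i0; elim: l {wl} => [|x l IH] lP.
  by exists [::]; rewrite !big_nil.
have [|l' [l'0 e]] := IH; first by move=> y yl; apply: lP; rewrite inE yl orbT.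
rewrite big_cons e; have [x0|x0] := eqVneq (tagged x i0 ord0) 0.
  by exists l'; rewrite x0 mul0r scale0r add0r.
have [a aE] := spherical_elt (lP x (mem_head _ _) x0).
exists ((tagged x i0 ord0 * (tagged x i0 ord0)^*, a) :: l'); split.
  by move=> y; rewrite inE => /orP[/eqP->|/l'0//]; exact: mul_conjC_ge0.
by rewrite big_cons /= aE.
Qed.

Lemma coord_exists : exists coord : K -> {scalar A},
  forall a b : K, coord a (t11 (val b)) = (a == b)%:R.
Proof.
have /choice[coord coordP] : forall a : K, exists f : {scalar A},
    forall b : K, f (t11 (val b)) = (a == b)%:R.
  move=> a; have [f fE] := functional_on_entries hA repK
    (fun gamma => if gamma == val a then const_mx 1 else 0 : 'M[C]_(hdim rep gamma)).
  exists f => b; have /matrixP/(_ ord0 ord0) := fE (val b); rewrite mxE => ->.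
  by rewrite [a == b]eq_sym -val_eqE; case: eqP; rewrite mxE.
by exists coord.
Qed.

Section Coefficients.
Variable coord : K -> {scalar A}.
Hypothesis coordE : forall a b : K, coord a (t11 (val b)) = (a == b)%:R.

Definition product_coef (a b g : K) : C := coord g (t11 (val a) * t11 (val b)).

Lemma counit_t11 alpha : counit A (t11 alpha) = 1.
Proof. by have [_ ->] := @tmx_corep _ _ rep alpha ord0 ord0; rewrite eqxx. Qed.

Lemma product_coef_ge0 a b g : 0 <= product_coef a b g.
Proof.
have [l [l0 e]] := product_expansion a b.
rewrite /product_coef e linear_sum big_seq sumr_ge0// => x xl.
by rewrite scalarZ coordE mulr_ge0 ?l0.
Qed.

Lemma product_coef_expansion a b : exists s : seq K,
  [/\ uniq s, forall g, g \notin s -> product_coef a b g = 0,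
      t11 (val a) * t11 (val b) = \sum_(g <- s) product_coef a b g *: t11 (val g) &
      \sum_(g <- s) product_coef a b g = 1].
Proof.
have [l [l0 e]] := product_expansion a b; pose s := undup [seq x.2 | x <- l].
have ccE g : product_coef a b g = \sum_(x <- l) x.1 * (g == x.2)%:R.
  by rewrite /product_coef e linear_sum; apply: eq_bigr => x _; rewrite scalarZ coordE.
have us : uniq s by exact: undup_uniq.
have ts : t11 (val a) * t11 (val b) = \sum_(g <- s) product_coef a b g *: t11 (val g).
  under eq_bigr do rewrite ccE scaler_suml.
  rewrite exchange_big e; apply: eq_big_seq => x xl /=.
  have xs : x.2 \in s by rewrite mem_undup; apply: map_f.
  rewrite (bigD1_seq x.2)//= eqxx mulr1 big1 ?addr0// => g gx.
  by rewrite (negbTE gx) mulr0 scale0r.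
exists s; split=> //.
  move=> g gs; rewrite ccE big_seq big1// => x xl.
  have [gx|] := eqVneq g x.2; last by rewrite mulr0.
  by move: gs; rewrite gx mem_undup map_f.
have := congr1 (counit A) ts; rewrite counitM !counit_t11 mulr1 linear_sum => ->.
by apply: eq_bigr => g _; rewrite scalarZ counit_t11 mulr1.
Qed.

(** The structure constants are a linearization, and the coordinate functionals show
  that there is no other. *)
Lemma lin_coefE a b : lin_coef a b = product_coef a b.
Proof.
have [s [us s0 ts _]] := product_coef_expansion a b.
have lin_cc : is_linearization a b (product_coef a b).
  split.
    apply: (sub_finite_set (B := [set` s])); last exact: finite_seq.
    by move=> g /= cg; apply: contraT => /s0 c0; rewrite c0 eqxx in cg.
  rewrite (fsbigE s)//; last by move=> g _ /s0 ->; rewrite scale0r.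
  by rewrite ts; apply: eq_bigl => g; rewrite in_setT.
have uniq_cc c : is_linearization a b c -> c = product_coef a b.
  move=> [cfin ce]; apply/funext => g; rewrite /product_coef ce.
  have /finite_seqP[s1 s1E] := cfin; pose X := undup s1.
  have uX : uniq X by exact: undup_uniq.
  have XE k : (c k != 0) = (k \in X).
    rewrite mem_undup; have : [set` s1] k = [set gamma | c gamma != 0] k by rewrite -s1E.
    by rewrite /= => e; apply/idP/idP; rewrite e.
  rewrite (fsbigE X)//; last first.
    by move=> k _; rewrite -XE negbK => /eqP ->; rewrite scale0r.
  rewrite (eq_bigl xpredT) => [|k]; last by rewrite in_setT.
  rewrite linear_sum; under eq_bigr do rewrite scalarZ coordE.
  have [gX|gX] := boolP (g \in X).
    rewrite (bigD1_seq g)//= eqxx mulr1 big1 ?addr0// => k kg.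
    by rewrite eq_sym (negbTE kg) mulr0.
  rewrite big_seq big1 => [|k kX].
    by apply/eqP; move: gX; rewrite -XE negbK.
  by have [gk|] := eqVneq g k; [move: gX; rewrite gk kX | rewrite mulr0].
by apply: uniq_cc; rewrite /lin_coef; apply: (xgetPex (fun=> 0)); exists (product_coef a b).
Qed.

Lemma product_coef_assoc a b c d s s' :
    t11 (val b) * t11 (val c) = \sum_(g <- s) product_coef b c g *: t11 (val g) ->
    t11 (val a) * t11 (val b) = \sum_(g <- s') product_coef a b g *: t11 (val g) ->
  \sum_(g <- s) product_coef b c g * product_coef a g d =
  \sum_(g <- s') product_coef a b g * product_coef g c d.
Proof.
move=> e e'; have := congr1 (coord d) (mulrA (t11 (val a)) (t11 (val b)) (t11 (val c))).
rewrite e e' mulr_sumr mulr_suml !linear_sum => h.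
transitivity (\sum_(i <- s) coord d (t11 (val a) * (product_coef b c i *: t11 (val i)))).
  by apply: eq_bigr => g _; rewrite -scalerAr scalarZ.
by rewrite h; apply: eq_bigr => g _; rewrite -scalerAl scalarZ.
Qed.

Lemma spherical_trivial e : corep_equiv (1%:M : 'M[A]_1) (t e) -> K e.
Proof.
move=> eE; exists fullv; last by rewrite dimvf /dim /= muln1 (hdim_trivial eE).
move=> v; split=> [_ f Jf|_]; last exact: memvf.
have [g fg] := coideal_scalar Jf; case: hJ => _ _ _ /(_ f Jf) f1 _.
rewrite /dual_rep (tmx_trivial eE) (_ : map_mx f 1%:M = 0) ?mul0mx//.
apply/matrixP => i j; rewrite !mxE; case: (i == j) => //=.
by rewrite fg linear0.
Qed.

Lemma t11_trivial e : corep_equiv (1%:M : 'M[A]_1) (t e) -> t11 e = 1.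
Proof.
by move=> eE; have := tmx_trivial eE => /matrixP/(_ ord0 ord0); rewrite [RHS]mxE eqxx.
Qed.

(** By [coideal_bar], J annihilates the first column of the matrix of the (t_ij)^-. Let
  T be a unitary matrix intertwining this corepresentation with its representative
  t^beta; then [decomposed_entry] gives (t_11^alpha)^- as a multiple of t_11^beta by a
  squared modulus, and the counit shows that this multiple is 1. *)
Lemma conjugate_spherical alpha : K alpha -> exists2 beta, K beta &
  corep_equiv (bar_corep alpha) (t beta) /\ t11 beta = bar rep (t11 alpha).
Proof.
move=> sa; have cb := @bar_corep_corep _ _ hA _ repK alpha.
have ub := @bar_corep_unitary _ _ hA _ repK alpha.
have ib := @bar_corep_irr _ _ hA _ repK alpha.
have [beta ab] := irr_unitary_class repK (ltn0Sn _) cb ub ib.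
have [T bT TT] := unitary_equiv (ltn0Sn _) cb ub ib (@tmx_corep _ _ rep beta)
  (@tmx_unitary _ _ rep beta) ab.
(* The unitary equivalence is a decomposition with a single summand. *)
pose l := [:: Tagged (fun beta => 'M[C]_(hdim rep alpha, hdim rep beta)) T].
have wl : decomposes (rep := rep) (bar_corep alpha) l.
  by split=> [x|]; [rewrite inE => /eqP-> | rewrite big_seq1].
have binv f : J f -> map_mx f (bar_corep alpha) *m delta_mx ord0 ord0 = 0
      :> 'cV[C]_(hdim rep alpha).
  move=> Jf; have [g Jg gE] := coideal_bar Jf; rewrite -colE; apply/matrixP => i j.
  rewrite !mxE; apply/eqP; rewrite -conjC_eq0 -gE.
  by apply/eqP; exact: spherical_first_column.
have [bE lP] := decomposed_entry cb ub wl binv.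
rewrite big_seq1 /= in bE.
have TT1 : T ord0 ord0 * (T ord0 ord0)^* = 1.
  by have := congr1 (counit A) bE; rewrite (cb _ _).2 eqxx linearZ/= counit_t11 mulr1.
exists beta.
  apply: (lP _ (mem_head _ _)); apply/eqP => /= T0; move: TT1; rewrite T0 mul0r => /eqP.
  by rewrite eq_sym oner_eq0.
by split=> //; move: bE; rewrite TT1 scale1r mxE.
Qed.

End Coefficients.
End Spherical.

(** * Hypergroups on discrete spaces *)

Section DiscreteMeasures.
Variables (R : realType) (K : discreteTopologicalType) (e : K).
Local Notation B := (borel e).

Lemma discrete_measurable (E : set B) : measurable E.
Proof. by apply: sub_sigma_algebra; exact: discrete_open. Qed.

Lemma discrete_measurable_fun (f : B -> \bar R) : measurable_fun setT f.
Proof. by move=> _ Y _; exact: discrete_measurable. Qed.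

(** The finite support is carried by a list that need not be minimal, so that functions
  with different supports can be summed over a common list. *)
Definition supports (s : seq K) (f : K -> R) := uniq s /\ forall g, g \notin s -> f g = 0.

Lemma supports_sum s s' f : supports s f -> supports s' f ->
  \sum_(g <- s) f g = \sum_(g <- s') f g.
Proof.
move=> [us s0] [us' s0'].
have cut (p q : seq K) : uniq p -> (forall g, g \notin q -> f g = 0) ->
    \sum_(g <- p) f g = \sum_(g <- [seq g <- p | g \in q]) f g.
  move=> up q0; rewrite big_filter [RHS]big_mkcond; apply: eq_bigr => g _.
  by case: ifPn => // /q0.
rewrite (cut s s')// (cut s' s)//; apply: perm_big; apply: uniq_perm; rewrite ?filter_uniq//.
by move=> g; rewrite !mem_filter andbC.
Qed.

Lemma supports_mulr s f (k : K -> R) : supports s f -> supports s (fun g => f g * k g).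
Proof. by move=> [us s0]; split=> // g /s0 ->; rewrite mul0r. Qed.

Section Atoms.
Variables (s : seq K) (c : K -> R).
Hypothesis c_ge0 : forall g, 0 <= c g.

Definition atoms : set B -> \bar R :=
  msum (fun k => mscale (NngNum (c_ge0 (nth e s k))) (\d_(nth e s k : B))) (size s).

HB.instance Definition _ := Measure.on atoms.

Lemma atomsE (E : set B) : atoms E = (\sum_(g <- s) c g * (g \in E)%:R)%:E.
Proof.
rewrite (big_nth e) big_mkord -sumEFin; apply: eq_bigr => k _.
by rewrite -[LHS]/((c _)%:E * \d_(nth e s k : B) E)%E diracE EFinM.
Qed.

Lemma atoms_integral (f : B -> \bar R) : (forall x, 0 <= f x)%E ->
  (\int[atoms]_x f x = \sum_(g <- s) (c g)%:E * f g)%E.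
Proof.
move=> f0; have mf := discrete_measurable_fun f.
rewrite ge0_integral_measure_sum//; rewrite [RHS](big_nth e) big_mkord.
apply: eq_bigr => k _; rewrite ge0_integral_mscale//=.
by rewrite integral_dirac// diracT mul1e.
Qed.

Lemma atoms_regular : @regular_measure R K e atoms.
Proof.
move=> E _; split; apply/eqP; rewrite eq_le; apply/andP; split.
- apply: le_ereal_inf_tmp => _ [U [_ EU] <-].
  rewrite !atomsE lee_fin; apply: ler_sum => g _; apply: ler_wpM2l => //.
  by rewrite ler_nat; case: (boolP (g \in E)) => // /set_mem/EU/mem_set ->.
- by apply: ereal_inf_lbound; exists E => //; split=> //; exact: discrete_open.
- apply: ereal_sup_ubound; exists (E `&` [set` s]).
    split; last by move=> g [].
    by apply: finite_compact; apply: sub_finite_set (finite_seq s) => g [].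
  rewrite !atomsE; congr (_%:E); apply: eq_big_seq => g gs.
  by rewrite in_setI (mem_set (A := [set` s])) // andbT.
- apply: ge_ereal_sup => _ [U [_ UE] <-].
  rewrite !atomsE lee_fin; apply: ler_sum => g _; apply: ler_wpM2l => //.
  by rewrite ler_nat; case: (boolP (g \in U)) => // /set_mem/UE/mem_set ->.
Qed.

End Atoms.

Lemma atoms_M1 (s : seq K) (c : K -> R) : (forall g, 0 <= c g) ->
    \sum_(g <- s) c g = 1 ->
  exists mu : M1 R e,
    (forall E : set B, mu E = (\sum_(g <- s) c g * (g \in E)%:R)%:E) /\
    (forall f : B -> \bar R, (forall x, 0 <= f x)%E ->
       \int[M1_prob mu]_x f x = \sum_(g <- s) (c g)%:E * f g)%E.
Proof.
move=> c0 c1; have mT : atoms s c0 setT = 1%E.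
  by rewrite atomsE; under eq_bigr do rewrite in_setT mulr1; rewrite c1.
pose P : probability B R := HB.pack (atoms s c0)
  (Measure_isProbability.Build _ _ R (atoms s c0) mT).
exists (@MkM1 R K e P (@atoms_regular s c c0)); split=> [E|f f0].
- exact: atomsE.
- exact: atoms_integral.
Qed.

Lemma continuous_discrete2 (T : topologicalType) (f : K * K -> T) : continuous f.
Proof.
move=> [x y] U /nbhs_singleton fU; exists ([set x], [set y]).
  by split; exact: discrete_set1.
by move=> [x' y'] [/= -> ->].
Qed.

Variables (c : K -> K -> K -> R) (inv : K -> K).
Hypothesis c_ge0 : forall x y g, 0 <= c x y g.
Hypothesis c_fin : forall x y, exists s, supports s (c x y) /\ \sum_(g <- s) c x y g = 1.
Hypothesis c_assoc : forall x y z d s s', supports s (c y z) -> supports s' (c x y) ->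
  \sum_(g <- s) c y z g * c x g d = \sum_(g <- s') c x y g * c g z d.
Hypothesis c_unitl : forall x g, c e x g = (g == x)%:R.
Hypothesis c_unitr : forall x g, c x e g = (g == x)%:R.
Hypothesis invK : involutive inv.
Hypothesis c_inv : forall x y g, c (inv y) (inv x) (inv g) = c x y g.
Hypothesis c_inv_unit : forall x y, c x (inv y) e != 0 <-> x = y.

(** On a discrete space all maps are continuous, all sets are measurable and finite sets
  are compact. The products are finite sums of point masses, so that the integrals in
  the associativity axiom are finite sums, and the axioms become statements about the
  masses c x y g. *)
Theorem discrete_hypergroup : exists conv : K -> K -> M1 R e,
  (forall x y g, conv x y [set g] = (c x y g)%:E) /\ DJS_hypergroup conv inv.
Proof.
have /choice[conv convP] : forall xy : K * K, exists mu : M1 R e,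
    exists2 s, supports s (c xy.1 xy.2) &
    (forall E : set B, mu E = (\sum_(g <- s) c xy.1 xy.2 g * (g \in E)%:R)%:E) /\
    (forall f : B -> \bar R, (forall x, 0 <= f x)%E ->
       \int[M1_prob mu]_x f x = \sum_(g <- s) (c xy.1 xy.2 g)%:E * f g)%E.
  move=> [x y]; have [s [sc s1]] := c_fin x y.
  have [mu muP] := @atoms_M1 s (c x y) (c_ge0 x y) s1.
  by exists mu, s.
have convE x y s (E : set B) : supports s (c x y) ->
    conv (x, y) E = (\sum_(g <- s) c x y g * (g \in E)%:R)%:E.
  move=> sc; have [s' sc' [-> _]] := convP (x, y).
  by congr (_%:E); apply: supports_sum; exact: supports_mulr.
have set1E (k g : K) : (k \in [set g]) = (k == g).
  by apply/idP/eqP => [/set_mem|->]//; rewrite inE.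
have conv1 x y g : conv (x, y) [set g] = (c x y g)%:E.
  have [s [[us s0] _]] := c_fin x y; rewrite (convE x y s)//; congr (_%:E).
  have [gs|gs] := boolP (g \in s); last first.
    rewrite s0// big_seq big1// => k ks; rewrite set1E.
    by have [kg|] := eqVneq k g; [move: gs; rewrite -kg ks | rewrite mulr0].
  rewrite (bigD1_seq g)//= set1E eqxx mulr1 big1 ?addr0// => k kg.
  by rewrite set1E (negbTE kg) mulr0.
have suppE x y : supp (conv (x, y)) = [set g | c x y g != 0].
  apply/seteqP; split=> g /= h.
    have := h [set g] (discrete_open _) erefl; rewrite conv1.
    by apply: contra_neq => ->.
  move=> U _ Ug; apply/eqP => U0; move/eqP: h; apply; apply/eqP; rewrite eq_le c_ge0 andbT.
  have : (conv (x, y) [set g] <= conv (x, y) U)%E.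
    apply: le_measure; rewrite ?inE; [exact: discrete_measurable..|].
    by move=> _ ->.
  by rewrite U0 conv1 lee_fin.
have supp_fin x y : finite_set (supp (conv (x, y))).
  rewrite suppE; have [s [[us s0] _]] := c_fin x y.
  apply: sub_finite_set (finite_seq s) => g /= cg.
  by apply: contraT => /s0 c0; rewrite c0 eqxx in cg.
exists (fun x y => conv (x, y)); split=> //; split.
- exact: discrete_hausdorff.
- move=> x _; exists [set x].
    by apply: filterS (discrete_set1 x) => y ->.
  by split; [apply: finite_compact; exact: finite_set1 | exact: discrete_closed].
- exact: continuous_discrete2.
- exact: invK.
- by move=> x U /nbhs_singleton; rewrite nbhs_principalE => Ux; apply/principal_filterP.
- move=> x y z E mE; rewrite /conv_ext.
  have nn x' y' : (0 <= conv (x', y') E)%E by exact: measure_ge0.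
  rewrite integral_dirac//; last exact: discrete_measurable_fun.
  rewrite diracT mul1e; have [sl slc [_ ->//]] := convP (y, z).
  under [RHS]eq_integral => x' _.
    rewrite integral_dirac//; last exact: discrete_measurable_fun.
    rewrite diracT mul1e; over.
  have [sr src [_ ->//]] := convP (x, y); move: slc src => /= slc src.
  (* A list that supports all the inner products at once. *)
  have [ss ssc] : exists ss, (forall g, g \in sl -> supports ss (c x g)) /\
      (forall g, g \in sr -> supports ss (c g z)).
    have /choice[f fP] : forall xy : K * K, exists s, supports s (c xy.1 xy.2).
      by move=> [x' y']; have [s [? _]] := c_fin x' y'; exists s.
    exists (undup (flatten [seq f (x, g) | g <- sl] ++ flatten [seq f (g, z) | g <- sr])).
    have sup x' y' s : {subset f (x', y') <= s} -> supports (undup s) (c x' y').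
      move=> fs; split; first exact: undup_uniq.
      by move=> d; rewrite mem_undup => ds; apply: (fP (x', y')).2; apply: contra ds => /fs.
    split=> g gs; apply: sup => d df; rewrite mem_cat; apply/orP.
    - by left; apply/flattenP; exists (f (x, g)) => //; exact: (map_f (fun g => f (x, g))).
    - by right; apply/flattenP; exists (f (g, z)) => //; exact: (map_f (fun g => f (g, z))).
  transitivity (\sum_(d <- ss) (\sum_(g <- sl) c y z g * c x g d) * (d \in E)%:R)%:E.
    transitivity (\sum_(g <- sl) \sum_(d <- ss) c y z g * c x g d * (d \in E)%:R)%:E.
      rewrite -sumEFin; apply: eq_big_seq => g gs.
      rewrite (convE x g ss); last exact: ssc.1.
      rewrite -EFinM mulr_sumr; congr (_%:E).
      by apply: eq_bigr => d _; rewrite mulrA.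
    by rewrite exchange_big/=; congr (_%:E); apply: eq_bigr => d _; rewrite mulr_suml.
  transitivity (\sum_(g <- sr) \sum_(d <- ss) c x y g * c g z d * (d \in E)%:R)%:E.
    rewrite [in RHS]exchange_big/=; congr (_%:E); apply: eq_bigr => d _.
    by rewrite (c_assoc _ slc src) mulr_suml.
  rewrite -sumEFin; apply: eq_big_seq => g gs.
  rewrite (convE g z ss); last exact: ssc.2.
  rewrite -EFinM mulr_sumr; congr (_%:E).
  by apply: eq_bigr => d _; rewrite mulrA.
- by move=> x y; exact: finite_compact.
- move=> x y E mE; have [s [[us s0] _]] := c_fin x y.
  rewrite /pushforward (convE x y s)// (convE _ _ [seq inv g | g <- s]).
    rewrite big_map; congr (_%:E); apply: eq_bigr => g _; rewrite c_inv.
    by congr (_ * (nat_of_bool _)%:R); apply/idP/idP => /set_mem h; apply/mem_set.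
  split; first by rewrite map_inj_uniq//; exact: inv_inj.
  move=> g gs; rewrite -(invK g) c_inv s0//; apply: contra gs => gs.
  by rewrite -(invK g) map_f.
- have unit_mass (x : K) (E : set K) : (\sum_(g <- [:: x]) (g == x)%:R * (g \in E)%:R)%:E =
      \d_(x : B) (E : set B) :> \bar R.
    by rewrite big_seq1 eqxx mul1r diracE.
  have unit_supp (x : K) : supports [:: x] (fun g => (g == x)%:R).
    by split=> // g; rewrite inE => /negbTE ->.
  move=> x E mE; split.
  + rewrite (convE _ _ [:: x]) -?unit_mass; last first.
      by have := unit_supp x; congr supports; apply/funext => g; rewrite c_unitl.
    by under eq_bigr do rewrite c_unitl.
  + rewrite (convE _ _ [:: x]) -?unit_mass; last first.
      by have := unit_supp x; congr supports; apply/funext => g; rewrite c_unitr.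
    by under eq_bigr do rewrite c_unitr.
- by move=> x y; rewrite suppE; exact: c_inv_unit.
- have supp_compact xy : compact (supp (conv xy)) /\ supp (conv xy) !=set0.
    case: xy => x y; split; first exact: finite_compact.
    apply: contrapT => /set0P/negP; rewrite negbK => /eqP s0.
    have [s [_ s1]] := c_fin x y; move: s1; rewrite big1 => [/eqP|g _].
      by rewrite eq_sym oner_eq0.
    apply/eqP/negPn/negP => cg; have : supp (conv (x, y)) g by rewrite suppE.
    by rewrite s0.
  exists (fun xy => exist _ (supp (conv xy)) (supp_compact xy)) => //.
  exact: continuous_discrete2.
Qed.

End DiscreteMeasures.

(** * Involution and unit on the spherical classes *)

Section Structure.
Variables (R : realType) (A : hopf_star_alg R).
Local Notation C := R[i].
Hypothesis hA : is_CQG A.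
Variables (rep : hat A -> irr A).
Hypothesis repK : forall alpha, irr_class (rep alpha) = alpha.
Local Notation t := (tmx rep).
Local Notation t11 := (t11 rep).
Variable J : set (A -> C).
Hypothesis hJ : two_sided_coideal J.
Hypothesis hJS : [set dual_antipode f | f in J] = [set dual_bar rep f | f in J].
Hypothesis hG : gen_Gelfand_pair rep J.
Hypothesis hrep : adapted rep J.
Local Notation K := (spherical rep J).

Lemma bar_sum I (s : seq I) (c : I -> C) (a : I -> A) :
  bar rep (\sum_(i <- s) c i *: a i) = \sum_(i <- s) (c i)^* *: bar rep (a i).
Proof.
have bar0 : bar rep (0 : A) = 0.
  apply: (@addrI _ (bar rep (0 : A))); rewrite addr0.
  by have := bar_antilinear hA repK 1 0 0; rewrite conjC1 !scale1r addr0.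
elim: s => [|i s IH]; first by rewrite !big_nil bar0.
by rewrite !big_cons (bar_antilinear hA repK) IH.
Qed.

Variables (coord : K -> {scalar A}) (inv : K -> K) (e : K).
Hypothesis coordE : forall a b : K, coord a (t11 (val b)) = (a == b)%:R.
Hypothesis invP : forall a : K, corep_equiv (bar_corep rep (val a)) (t (val (inv a))).
Hypothesis inv_t11 : forall a : K, t11 (val (inv a)) = bar rep (t11 (val a)).
Hypothesis eE : corep_equiv (1%:M : 'M[A]_1) (t (val e)).

Local Notation product_coef := (product_coef coord).

(** The classes of the corepresentations by (t_ij)^- and by t_ij^* coincide, and star is
  an involution. *)
Lemma inv_involutive : involutive inv.
Proof.
move=> a; apply: val_inj; apply: (tmx_inj repK).
have tc b : corep_equiv (t (val (inv b))) (conj_corep (t (val b))).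
  exact: corep_equiv_trans (corep_equiv_sym (invP b)) (bar_corep_equiv hA repK (val b)).
apply: corep_equiv_trans (tc (inv a)) _.
by have := corep_equiv_conj (tc a); rewrite conj_corepK.
Qed.

(** Apply the involution to the linearization formula: it reverses the product and
  conjugates the coefficients, which are real. *)
Lemma product_coef_inv x y g : product_coef (inv y) (inv x) (inv g) = product_coef x y g.
Proof.
have [s [us s0 ts _]] := product_coef_expansion repK hJ hG hrep coordE x y.
rewrite {1}/product_coef !inv_t11 -(barM hA repK) ts bar_sum linear_sum.
have coordbar k : coord (inv g) (bar rep (t11 (val k))) = (g == k)%:R.
  by rewrite -inv_t11 coordE (inj_eq (inv_inj inv_involutive)).
under eq_bigr do rewrite scalarZ coordbar.
have [gs|gs] := boolP (g \in s).
  rewrite (bigD1_seq g)//= eqxx mulr1 big1 ?addr0 => [|k kg].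
    by apply/CrealP/ger0_real; exact: (product_coef_ge0 repK hJ hG hrep coordE).
  by rewrite eq_sym (negbTE kg) mulr0.
rewrite s0// big_seq big1// => k ks.
by have [gk|] := eqVneq g k; [move: gs; rewrite gk ks | rewrite mulr0].
Qed.

Lemma product_coef_unitl x g : product_coef e x g = (g == x)%:R.
Proof. by rewrite /product_coef (t11_trivial eE) mul1r coordE. Qed.

Lemma product_coef_unitr x g : product_coef x e g = (g == x)%:R.
Proof. by rewrite /product_coef (t11_trivial eE) mulr1 coordE. Qed.

(** The coefficient of the unit in t_11^x (t_11^y)^- is the value of the Haar
  functional. Since (t_11^y)^- is a combination of the adjoints of the entries of t^y,
  it vanishes for distinct x and y by orthogonality, and it is positive for x = y by
  [haar_t11_bar]. *)
Lemma product_coef_unit_support x y : product_coef x (inv y) e != 0 <-> x = y.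
Proof.
have [h [h0 h1]] := haar_exists hA repK eE.
have hE g : h (t11 (val g)) = (e == g)%:R.
  rewrite (haar_tmx eE h0 h1) eqxx andbT; congr (nat_of_bool _)%:R.
  by rewrite [RHS]eq_sym -val_eqE.
have -> : product_coef x (inv y) e = h (t11 (val x) * bar rep (t11 (val y))).
  have [s [us s0 ts _]] := product_coef_expansion repK hJ hG hrep coordE x (inv y).
  rewrite -inv_t11 {1}/product_coef ts !linear_sum; apply: eq_bigr => g _ /=.
  by rewrite !scalarZ hE coordE.
split=> [|->]; last by rewrite gt_eqF// (haar_t11_bar hA repK eE h0 h1).
move=> hn0; apply: val_inj; apply/eqP; apply: contraNT hn0 => xy.
have [G _ E] := bar_tmx hA repK (val y).
have /matrixP/(_ ord0 ord0) := E; rewrite mxE mul_scalE => ->.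
apply/eqP; rewrite mulr_sumr linear_sum; apply: big1 => l _ /=.
rewrite scal_mulE -scalerAr scalarZ mulr_sumr linear_sum big1 ?mulr0// => k _ /=.
rewrite -scalerAr scalarZ [conj_corep _ _ _]mxE.
by rewrite (haar_orthogonal hA repK eE h0 h1)// mulr0.
Qed.

End Structure.

Lemma Re_ge0K (R : realType) (z : R[i]) : 0 <= z ->
  0 <= complex.Re z /\ (complex.Re z)%:C = z.
Proof. by case: z => a b; rewrite lecE/= => /andP[/eqP -> a0]. Qed.

Theorem theorem6p3 (R : realType) (A : hopf_star_alg R) (hA : is_CQG A)
    (rep : hat A -> irr A) (repK : forall alpha, irr_class (rep alpha) = alpha)
    (J : set (A -> R[i])) (hJ : two_sided_coideal J)
    (hJstar : [set dual_star f | f in J] = J)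
    (hJS : [set dual_antipode f | f in J] = [set dual_bar rep f | f in J])
    (hG : gen_Gelfand_pair rep J) (hrep : adapted rep J) :
  let K := discrete_topology (spherical rep J) in
  exists (e : K) (conv : K -> K -> M1 R e) (inv : K -> K),
    [/\ forall alpha beta gamma : K,
          (fine (conv alpha beta [set gamma]))%:C =
            lin_coef alpha beta gamma,
        forall alpha : K,
          is_class_of rep (map_mx (bar rep) (tmx rep (val alpha))) (val (inv alpha)),
        is_class_of rep (1%:M : 'M[A]_1) (val e) &
        DJS_hypergroup conv inv].
Proof.
move=> K; have [e0 e0E] := trivial_class repK.
have [e eE] := spherical_elt (spherical_trivial hJ e0E).
move: e0E; rewrite -{e0}eE => eE.
have [coord coordE] := coord_exists hA repK J.
have /choice[inv invP] : forall a : spherical rep J, exists b : spherical rep J,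
    corep_equiv (bar_corep rep (val a)) (tmx rep (val b)) /\
    t11 rep (val b) = bar rep (t11 rep (val a)).
  move=> a; have [beta Kb bP] := conjugate_spherical hA repK hJ hJS hG hrep (spherical_val a).
  by have [b be] := spherical_elt Kb; exists b; rewrite be.
have invE a := (invP a).1; have inv_t11 a := (invP a).2.
(* The coefficients are nonnegative, so nothing is lost by passing to real parts. *)
pose c (x y g : spherical rep J) : R := complex.Re (product_coef coord x y g).
have cK x y g : 0 <= c x y g /\ (c x y g)%:C = product_coef coord x y g.
  by apply: Re_ge0K; exact: (product_coef_ge0 repK hJ hG hrep coordE).
have realI : injective (real_complex R) by exact: complexI.
pose KT : discreteTopologicalType := discrete_topology (spherical rep J).
have supp_of (x y : KT) (s : seq KT) : uniq s ->
    (forall g, g \notin s -> product_coef coord x y g = 0) ->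
    supports s (c x y : KT -> R).
  by move=> us s0; split=> // g gs; rewrite /c s0.
have cfin (x y : KT) : exists s : seq KT,
    supports s (c x y : KT -> R) /\ \sum_(g <- s) c x y g = 1.
  have [s [us s0 _ s1]] := product_coef_expansion repK hJ hG hrep coordE x y.
  exists s; split; first exact: supp_of.
  apply: realI; rewrite rmorph_sum rmorph1/= -s1; apply: eq_bigr => g _.
  exact: (cK x y g).2.
have cassoc (x y z d : KT) (s s' : seq KT) : supports s (c y z : KT -> R) ->
    supports s' (c x y : KT -> R) ->
    \sum_(g <- s) c y z g * c x g d = \sum_(g <- s') c x y g * c g z d.
  move=> sc sc'.
  have [s1 [us1 s10 ts1 _]] := product_coef_expansion repK hJ hG hrep coordE y z.
  have [s2 [us2 s20 ts2 _]] := product_coef_expansion repK hJ hG hrep coordE x y.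
  rewrite (supports_sum (supports_mulr (fun g : KT => c x g d) sc)
     (supports_mulr (fun g : KT => c x g d) (supp_of y z s1 us1 s10))).
  rewrite (supports_sum (supports_mulr (fun g : KT => c g z d) sc')
     (supports_mulr (fun g : KT => c g z d) (supp_of x y s2 us2 s20))).
  apply: realI; rewrite !rmorph_sum.
  transitivity (\sum_(g <- s1) product_coef coord y z g * product_coef coord x g d).
    by apply: eq_bigr => g _; rewrite rmorphM -!(cK _ _ _).2.
  rewrite (product_coef_assoc d ts1 ts2).
  by apply: eq_bigr => g _; rewrite rmorphM -!(cK _ _ _).2.
have [|x g|x g|||x y|conv [convE djs]] := @discrete_hypergroup R KT e c inv _ cfin cassoc.
- by move=> x y g; exact: (cK x y g).1.
- by apply: realI; rewrite (cK _ _ _).2 (product_coef_unitl coordE eE) rmorph_nat.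
- by apply: realI; rewrite (cK _ _ _).2 (product_coef_unitr coordE eE) rmorph_nat.
- exact: (inv_involutive hA repK invE).
- move=> x y g; apply: realI; rewrite !(cK _ _ _).2.
  exact: (product_coef_inv hA repK hJ hG hrep coordE invE inv_t11).
- have [h h'] := product_coef_unit_support hA repK hJ hG hrep coordE inv_t11 eE x y.
  have c0 : (c x (inv y) e != 0) = (product_coef coord x (inv y) e != 0).
    by rewrite -(cK _ _ _).2 (inj_eq realI).
  by rewrite c0; split.
exists e, conv, inv; split.
- move=> alpha beta gamma; rewrite convE /= (cK _ _ _).2.
  by rewrite (lin_coefE repK hJ hG hrep coordE).
- exact: invE.
- exact: eE.
- exact: djs.
Qed.
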